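(* Let $r\ge 1$ be an integer and $\alpha_1,\ldots,\alpha_r\in[0,1)$. The multiple Hurwitz zeta function $\zeta_r(s_1,\ldots,s_r;\alpha_1,\ldots,\alpha_r)$ has a meromorphic continuation to $\mathbb{C}^r$. Further, all its poles are simple and they are (exactly) along the hyperplanes $$H_{1,0}\quad\text{and}\quad H_{i,k}\ \text{ for } 2\le i\le r,\ k\ge 0,$$ except when $i=2$ and $k\in K$, where $$K:=\{n\in\mathbb{N}\mid B_n(\alpha_2-\alpha_1)=0\}.$$ That is, the set of polar hyperplanes consists precisely of $H_{1,0}$ together with all $H_{i,k}$ with $2\le i\le r$, $k\ge0$ an integer, and not ($i=2$ and $k\in K$).
   Context: For $r \ge 1$ let $U_r := \{(s_1,\ldots,s_r)\in\mathbb{C}^r \mid \Re(s_1+\cdots+s_i) > i \text{ for all } 1\le i\le r\}$. For $(s_1,\ldots,s_r)\in U_r$ the multiple Hurwitz zeta function of depth $r$ is $$\zeta_r(s_1,\ldots,s_r;\alpha_1,\ldots,\alpha_r) := \sum_{n_1>\cdots>n_r>0}\frac{1}{(n_1+\alpha_1)^{s_1}\cdots(n_r+\alpha_r)^{s_r}},$$ where the $n_i$ are integers; the series converges normally on compact subsets of $U_r$ and defines a holomorphic function there. For integers $1\le i\le r$ and $k\ge 0$, $H_{i,k} := \{(s_1,\ldots,s_r)\in\mathbb{C}^r \mid s_1+\cdots+s_i=i-k\}$. $B_n(t)$ is the $n$-th Bernoulli polynomial, defined by $\frac{xe^{tx}}{e^x-1}=\sum_{n\ge0}B_n(t)\frac{x^n}{n!}$.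 (The set $K$ is only relevant when $r\ge2$; since $B_0=1$, it does not matter whether $0\in\mathbb{N}$.) *)

(* Defs.v *)
From HB Require Import structures.
From mathcomp Require Import all_boot all_order all_algebra.
From mathcomp Require Import all_classical all_reals all_analysis.
From mathcomp Require Import complex.

Set Implicit Arguments.
Unset Strict Implicit.
Unset Printing Implicit Defensive.

Import Order.TTheory GRing.Theory Num.Theory numFieldNormedType.Exports.

Local Open Scope classical_set_scope.
Local Open Scope ring_scope.

(* R[i] typed as a numFieldType carrier, so that it (and 'rV[R[i]]_r) gets its
   normed module structure over R[i] itself. *)
Notation Cplx R := (R[i] : numFieldType).

Section MeromorphicFunctions.
Variables (R : realType) (r : nat).
Local Notation C := (Cplx R).
Implicit Types (A D V W : set 'rV[C]_r) (f g h l : 'rV[C]_r -> C).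

(* [differentiable] is Frechet differentiability of a map between normed
   modules over R[i], hence complex differentiability in r variables.  Only
   meant for A open. *)
Definition holomorphic_on A f : Prop := forall s, A s -> differentiable f s.

(* A meromorphic function on C^r is a pair (D, f), where f is holomorphic on
   the dense open set D and is locally a quotient g / h of holomorphic
   functions, h vanishing identically on no nonempty open set.  The values of
   f outside D are irrelevant. *)
Definition meromorphic D f : Prop :=
  [/\ open D, dense D, holomorphic_on D f &
    forall p, exists V g h,
      [/\ open V /\ V p, holomorphic_on V g, holomorphic_on V h,
          forall W, open W -> W `<=` V -> W !=set0 ->
            exists2 s, W s & h s != 0
        & forall s, V s -> D s -> h s * f s = g s]].

Definition regular_at D f (p : 'rV[C]_r) : Prop :=
  exists V g, [/\ open V, V p, holomorphic_on V g &
                  forall s, V s -> D s -> f s = g s].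

Definition polar_set D f : set 'rV[C]_r := [set p | ~ regular_at D f p].

(* For l an affine form with zero set H: (D, f) has a pole of order exactly 1
   along H, i.e. it has a pole along H and l * f has none.  The order of a pole
   along a hypersurface is determined at its generic points (at special ones H
   may meet other components of the polar set), whence the density condition. *)
Definition simple_pole_along D f l : Prop :=
  let H := [set s | l s = 0] in
  H `<=` polar_set D f /\
  forall p, H p -> forall W, open W -> W p ->
    exists q, [/\ W q, H q & regular_at D (fun s => l s * f s) q].

Definition meromorphic_continuation A f0 D f : Prop :=
  [/\ meromorphic D f, A `<=` D & forall s, A s -> f s = f0 s].

End MeromorphicFunctions.

Section MultipleHurwitzZeta.
Variables (R : realType) (r : nat).
Local Notation C := (Cplx R).
Implicit Types (s : 'rV[C]_r) (alpha : 'I_r -> R).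

Definition cexp (z : C) : C :=
  Complex (expR (complex.Re z) * cos (complex.Im z))
          (expR (complex.Re z) * sin (complex.Im z)).

(* x ^ z for a real x > 0, with the principal (real) logarithm. *)
Definition cpow (x : R) (z : C) : C := cexp (z * real_complex R (ln x)).

(* All indices are shifted by one: i : 'I_r stands for the index i.+1 in
   {1, ..., r}; this is s_1 + ... + s_(i.+1). *)
Definition psum (i : 'I_r) s : C := \sum_(j < r | (j <= i)%N) s 0 j.

Definition Udom : set 'rV[C]_r :=
  [set s | forall i : 'I_r, i.+1%:R < complex.Re (psum i s)].

(* r-tuples n with N >= n_1 > ... > n_r > 0. *)
Definition zeta_index (N : nat) (n : {ffun 'I_r -> 'I_N.+1}) : bool :=
  [forall i : 'I_r, (0 < n i)%N] &&
  [forall i : 'I_r, forall j : 'I_r, (i < j)%N ==> (n j < n i)%N].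

Definition zeta_term alpha s (n : 'I_r -> nat) : C :=
  \prod_(i < r) (cpow ((n i)%:R + alpha i) (s 0 i))^-1.

Definition zeta_partial alpha s (N : nat) : C :=
  \sum_(n : {ffun 'I_r -> 'I_N.+1} | zeta_index n)
     zeta_term alpha s (fun i => n i).

(* Only meaningful on Udom, where the series converges absolutely, so that its
   value does not depend on the order of summation. *)
Definition multizeta alpha s : C := limn (zeta_partial alpha s).

(* The affine form s_1 + ... + s_(i.+1) - (i.+1 - k) defining H_(i.+1, k). *)
Definition hyper_form (i : 'I_r) (k : nat) s : C :=
  psum i s - (i.+1%:R - k%:R).

Definition hyper (i : 'I_r) (k : nat) : set 'rV[C]_r :=
  [set s | psum i s = i.+1%:R - k%:R].

(* Generating function of the Bernoulli polynomials; a power series expansion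
   near 0 determines its coefficients, hence B. *)
Definition bernoulli_polynomials (B : nat -> {poly R}) : Prop :=
  forall t : R, \forall x \near (0 : R)^',
    series (fun n => (B n).[t] * (x ^+ n / n`!%:R)) @ \oo -->
      x * expR (t * x) / (expR x - 1).

(* The zeros n of n |-> B_n (alpha_2 - alpha_1); empty for r = 1, where
   alpha_2 does not exist and this set plays no role. *)
Definition Kset (B : nat -> {poly R}) alpha : set nat :=
  [set n | exists i1 i2 : 'I_r,
     [/\ val i1 = 0%N, val i2 = 1%N & (B n).[alpha i2 - alpha i1] = 0]].

(* The pairs (i, k) such that H_(i.+1, k) is polar. *)
Definition polar_index (B : nat -> {poly R}) alpha (i : 'I_r) (k : nat) : Prop :=
  (val i = 0%N /\ k = 0%N) \/
  ((1 <= val i)%N /\ ~ (val i = 1%N /\ Kset B alpha k)).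

End MultipleHurwitzZeta.

Arguments Udom {R r}.

(* Main.v *)
Require Import Defs.
From HB Require Import structures.
From mathcomp Require Import all_boot all_order all_algebra.
From mathcomp Require Import all_classical all_reals all_analysis.
From mathcomp Require Import complex.
From mathcomp Require Import polyrcf ring lra zify.

Set Implicit Arguments.
Unset Strict Implicit.
Unset Printing Implicit Defensive.

Import Order.TTheory GRing.Theory Num.Theory numFieldNormedType.Exports.
Import Normc.

Local Open Scope classical_set_scope.
Local Open Scope ring_scope.

(* Summing over the largest index first, put T_0 = 1 and
     T_(i+1)(n) = sum_(m > n) (m + a_i)^(-s_i) T_i(m),
   so that zeta_r = T_r(0).  Euler-Maclaurin gives
     T_i(n) = sum_(k < N) c_i(k) (n + a_i)^(e_i - k) + R_i(n),
   with e_i = i - s_0 - ... - s_(i-1), where c_(i+1) is obtained from c_i by a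
   triangular recursion involving the Bernoulli polynomials at a_(i+1) - a_i and
   the factors 1 / (l - e_(i+1)), and R_i, of order n^(e_i - N), is a series that
   converges as soon as Re e_i < N.  This is the continuation; multiplying level i
   by the form that vanishes at a given point p turns it into a local quotient of
   holomorphic functions, whose denominator is a product of affine forms.

   On the hyperplane e_(i+1) = l the rescaled state at level i+1 is c_i(l) times
   an initial state, so the residue is c_i(l) times a multiple zeta function of
   depth r-i-1.  The latter does not vanish identically, by the identity theorem
   and positivity in the domain of convergence.  As for c_i(l): c_0(l) is nonzero
   only for l = 0 and c_1(l) is B_l(a_1 - a_0) times a product of nonzero forms.
   If some c_i(l), i >= 2, vanished on an open set, then so would c_2(l), since
   each c_(i+1)(l) determines c_i(l) by its dependence on s_i; then all the
   products B_k(a_1 - a_0) B_(l-k)(a_2 - a_1) would vanish, which is impossible. *)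

(** * Limits of complex sequences *)

(** Holomorphy is carried by quantitative data: a second order Taylor expansion at each point of a
    ball, with all bounds governed by one constant. Such data pass to sums, products, exponentials
    and dominated series. Order two serves the identity theorem: over the four increments t, -t, it,
    -it the linear and quadratic parts cancel, which yields a maximum principle.

    The parameters [lam] and [mu] stay free because one system serves three times: lam = 1 and mu =
    1/(l - e) give the continuation, a rescaled level gives a local numerator, and lam = 0 with mu a
    Kronecker delta is that numerator on a hyperplane.

    Poles are tested only at generic points of a hyperplane, where no other polar form vanishes and
    the local denominator is its affine form exactly; regularity being an open condition, the whole
    hyperplane is then polar. Genericity is arranged through imaginary parts: each polar form
    differs by an integer from a sum of coordinates, so it cannot vanish where that sum is not
    real. *)

Section ComplexLimits.
Variable R : realType.
Local Notation C := (Cplx R).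
Implicit Types (z w : C) (u v : nat -> C) (x : R).

Lemma normc_ge0 z : 0 <= normc z.
Proof. by case: z => a b; rewrite sqrtr_ge0. Qed.

Lemma normc_eq0 z : (normc z == 0) = (z == 0).
Proof. by apply/eqP/eqP => [/eq0_normc //|->]; rewrite normc0. Qed.

Lemma normc_gt0 z : (0 < normc z) = (z != 0).
Proof. by rewrite lt0r normc_eq0 normc_ge0 andbT. Qed.

Lemma normcB z w : normc (z - w) = normc (w - z).
Proof. by rewrite -normcN opprB. Qed.

Lemma le_normcB z w : normc (z - w) <= normc z + normc w.
Proof. by apply: le_trans (le_normcD _ _) _; rewrite normcN. Qed.

Lemma normcX z n : normc (z ^+ n) = normc z ^+ n.
Proof. by elim: n => [|n IH]; rewrite ?normc1 // !exprS normcM IH. Qed.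

Lemma normcC x : normc x%:C%C = `|x|.
Proof. by rewrite /normc /= expr0n /= addr0 sqrtr_sqr. Qed.

Lemma normc_nat n : normc (n%:R : C) = n%:R.
Proof. by rewrite -(rmorph_nat (real_complex R)) normcC normr_nat. Qed.

Lemma normc_sum (I : Type) (s : seq I) (P : pred I) (F : I -> C) :
  normc (\sum_(i <- s | P i) F i) <= \sum_(i <- s | P i) normc (F i).
Proof.
elim/big_rec2: _ => [|i x z _ IH]; first by rewrite normc0.
by apply: le_trans (le_normcD _ _) _; rewrite lerD2l.
Qed.

Lemma Re_le_normc z : `|complex.Re z| <= normc z.
Proof.
case: z => a b /=; rewrite -sqrtr_sqr ler_wsqrtr// lerDl sqr_ge0 //.
Qed.

Lemma Im_le_normc z : `|complex.Im z| <= normc z.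
Proof.
case: z => a b /=; rewrite -sqrtr_sqr ler_wsqrtr// lerDr sqr_ge0 //.
Qed.

Lemma normc_le_ReIm z : normc z <= `|complex.Re z| + `|complex.Im z|.
Proof.
case: z => a b /=.
rewrite -[leRHS]ger0_norm ?addr_ge0// -sqrtr_sqr ler_wsqrtr//.
rewrite -(real_normK (num_real a)) -(real_normK (num_real b)).
have := mulr_ge0 (normr_ge0 a) (normr_ge0 b).
by set x := `|a|; set y := `|b|; nra.
Qed.

Lemma normr_normc z : `|z| = (normc z)%:C%C.
Proof. by rewrite normc_def; case: z. Qed.

(** Convergence through the real-valued modulus, so that all estimates live in the ordered field
    [R]; [ctends_cvg] returns to the topology of [R[i]]. *)
Definition ctends u z : Prop :=
  forall e : R, 0 < e -> exists N, forall n, (N <= n)%N -> normc (u n - z) < e.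

Lemma ctends_cvg u z : ctends u z -> u @ \oo --> z.
Proof.
move=> uz; apply/cvgrPdist_lt => e; rewrite ltcE /= => /andP[/eqP e0 /uz[N uN]].
near=> n; rewrite normr_normc ltcE /= -e0 eqxx /= normcB; apply: uN.
by near: n; exists N.
Unshelve. all: by end_near. Qed.

Lemma ctends_uniq u z w : ctends u z -> ctends u w -> z = w.
Proof.
move=> uz uw; apply/eqP; rewrite -subr_eq0 -normc_eq0; apply/eqP/le_anti.
rewrite normc_ge0 andbT; apply/ler_addgt0Pr => e e0; rewrite add0r.
have [N1 h1] := uz _ (divr_gt0 e0 (ltr0Sn _ 1)).
have [N2 h2] := uw _ (divr_gt0 e0 (ltr0Sn _ 1)).
have {}h1 := h1 _ (leq_maxl N1 N2); have {}h2 := h2 _ (leq_maxr N1 N2).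
have -> : z - w = (u (maxn N1 N2) - w) - (u (maxn N1 N2) - z) by ring.
by apply: le_trans (le_normcB _ _) _; lra.
Qed.

Lemma ctends_near u v z (N : nat) : (forall n, (N <= n)%N -> u n = v n) ->
  ctends u z -> ctends v z.
Proof.
move=> uv uz e /uz[M uM]; exists (maxn N M) => n; rewrite geq_max => /andP[nN nM].
by rewrite -uv // uM.
Qed.

Lemma ctends_ext u v z : u =1 v -> ctends u z -> ctends v z.
Proof. by move=> uv; apply: (@ctends_near _ _ _ 0%N) => n _. Qed.

Lemma ctends_cst z : ctends (fun=> z) z.
Proof. by move=> e e0; exists 0%N => n _; rewrite subrr normc0. Qed.

Lemma ctendsD u v z w : ctends u z -> ctends v w ->
  ctends (fun n => u n + v n) (z + w).
Proof.
move=> uz vw e e0.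
have [N1 h1] := uz _ (divr_gt0 e0 (ltr0Sn _ 1)).
have [N2 h2] := vw _ (divr_gt0 e0 (ltr0Sn _ 1)).
exists (maxn N1 N2) => n; rewrite geq_max => /andP[/h1 {}h1 /h2 {}h2].
have -> : u n + v n - (z + w) = (u n - z) + (v n - w) by ring.
by apply: le_lt_trans (le_normcD _ _) _; lra.
Qed.

Lemma ctendsZ a u z : ctends u z -> ctends (fun n => a * u n) (a * z).
Proof.
move=> uz e e0.
have a1 : 0 < normc a + 1 by rewrite ltr_pwDr // normc_ge0.
have [N h] := uz _ (divr_gt0 e0 a1).
exists N => n /h {}h; rewrite -mulrBr normcM.
move: h; rewrite ltr_pdivlMr // => h.
have := normc_ge0 (u n - z); nra.
Qed.

Lemma ctendsN u z : ctends u z -> ctends (fun n => - u n) (- z).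
Proof.
move=> /(ctendsZ (-1)); rewrite mulN1r.
by apply: ctends_ext => n; rewrite mulN1r.
Qed.

Lemma ctendsB u v z w : ctends u z -> ctends v w ->
  ctends (fun n => u n - v n) (z - w).
Proof. by move=> uz /ctendsN; apply: ctendsD. Qed.

Lemma ctendsM u v z w : ctends u z -> ctends v w ->
  ctends (fun n => u n * v n) (z * w).
Proof.
move=> uz vw.
have h : ctends (fun n => (u n - z) * (v n - w)) 0.
  move=> e e0.
  have [N1 h1] := uz 1 ltr01; have [N2 h2] := vw _ e0.
  exists (maxn N1 N2) => n; rewrite geq_max => /andP[/h1 {}h1 /h2 {}h2].
  rewrite subr0 normcM.
  have := normc_ge0 (u n - z); have := normc_ge0 (v n - w); nra.
have := ctendsD h (ctendsD (ctendsZ w uz) (ctendsD (ctendsZ z vw) (ctends_cst (- (z * w))))).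
have -> : 0 + (w * z + (z * w - z * w)) = z * w by ring.
by apply: ctends_ext => n; ring.
Qed.

Lemma ctends_shift u z k : ctends u z <-> ctends (fun n => u (n + k)%N) z.
Proof.
split=> uz e /uz[N h].
  by exists N => n nN; apply: h; rewrite (leq_trans nN) ?leq_addr.
exists (N + k)%N => n nN; rewrite -(subnK (leq_trans (leq_addl N k) nN)); apply: h.
by rewrite leq_subRL ?(leq_trans (leq_addl N k) nN) // addnC.
Qed.

Lemma ctends_le u z (B : R) (N : nat) : (forall n, (N <= n)%N -> normc (u n) <= B) ->
  ctends u z -> normc z <= B.
Proof.
move=> uB uz; apply/ler_addgt0Pr => e e0.
have [M h] := uz _ e0.
have {}h := h _ (leq_maxr N M); have {}uB := uB _ (leq_maxl N M).
have -> : z = u (maxn N M) - (u (maxn N M) - z) by ring.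
by apply: le_trans (le_normcB _ _) _; lra.
Qed.

Lemma ctends0_le u (b : nat -> R) : (forall n, normc (u n) <= b n) ->
  (forall e, 0 < e -> exists N, forall n, (N <= n)%N -> b n < e) -> ctends u 0.
Proof.
move=> ub b0 e /b0[N h]; exists N => n /h; rewrite subr0.
by apply: le_lt_trans.
Qed.

Lemma ctendsC (r : nat -> R) (l : R) : r @ \oo --> l ->
  ctends (fun n => (r n)%:C%C) l%:C%C.
Proof.
move=> /cvgrPdist_lt rl e /rl[N _ h]; exists N => n /h {}h.
by rewrite -(rmorphB (real_complex R)) normcC distrC.
Qed.

Lemma ctendsReIm u (a b : R) : (fun n => complex.Re (u n)) @ \oo --> a ->
  (fun n => complex.Im (u n)) @ \oo --> b -> ctends u (Complex a b).
Proof.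
move=> ua ub.
have := ctendsD (ctendsC ua) (ctendsZ 'i%C (ctendsC ub)).
rewrite [X in ctends _ X](_ : _ = Complex a b); last by simpc.
by apply: ctends_ext => n; case: (u n) => ? ?; simpc.
Qed.

(** The value 0 at divergent sequences makes [clim_ext], and [climZ] for a nonzero factor,
    unconditional: identities between remainder series can be proved before any convergence. *)
Definition clim u : C := xget 0 [set z | ctends u z].

Lemma climE u z : ctends u z -> clim u = z.
Proof.
move=> uz; rewrite /clim; case: xgetP => [w _ /= uw|/(_ z)//].
exact: ctends_uniq uw uz.
Qed.

Lemma clim_ext u v : u =1 v -> clim u = clim v.
Proof. by move=> /funext ->. Qed.

Lemma abs_series_cvg u (n : nat) (B : R) :
  (forall K, \sum_(n <= m < K) normc (u m) <= B) ->
  exists z, ctends (fun K => \sum_(n <= m < K) u m) z.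
Proof.
move=> uB.
have key (f : C -> R) : (forall z, `|f z| <= normc z) ->
    {morph f : z w / z + w} -> f 0 = 0 ->
    exists a : R, (fun K => f (\sum_(n <= m < K) u m)) @ \oo --> a.
  move=> fle fD f0.
  pose v m := if (n <= m)%N then f (u m) else 0.
  have vE K : \sum_(0 <= m < K) v m = f (\sum_(n <= m < K) u m).
    rewrite (big_morph f fD f0) [RHS](big_nat_widenl _ 0) // big_mkcondr /=.
    by apply: eq_bigr => m _; rewrite /v.
  have : cvgn (series v).
    apply: normed_cvg; apply: nondecreasing_is_cvgn.
      apply: nondecreasing_series => m _ _; exact: normr_ge0.
    exists B => _ [K _ <-] /=; apply: le_trans (uB K).
    rewrite /series /= [leRHS](big_nat_widenl _ 0) // big_mkcondr /=.
    apply: ler_sum => m _; rewrite /v; case: ifP => _; rewrite ?normr0 //.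
  move=> /cvg_ex[a va]; exists a; move: va; apply: cvg_trans.
  by apply: near_eq_cvg; near=> K; rewrite -vE.
have [|||a ha] := key (@complex.Re R).
- exact: Re_le_normc.
- by move=> [? ?] [? ?].
- by [].
have [|||b hb] := key (@complex.Im R).
- exact: Im_le_normc.
- by move=> [? ?] [? ?].
- by [].
by exists (Complex a b); apply: ctendsReIm.
Unshelve. all: by end_near. Qed.

(** Dominated convergence for series in which [K] is both the cut-off and the parameter of the
    terms; this is the situation of [zeta_partial], which truncates all indices at once. *)
Lemma tannery (u : nat -> nat -> C) v (w : nat -> R) (n : nat) (B : R) z :
  (forall K m, normc (u K m) <= w m) ->
  (forall K, \sum_(n <= m < K) w m <= B) ->
  (forall m, ctends (u^~ m) (v m)) ->
  ctends (fun K => \sum_(n <= m < K) v m) z ->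
  ctends (fun K => \sum_(n <= m < K) u K m) z.
Proof.
move=> uw wB uv vz e e0.
have w0 m : 0 <= w m by apply: le_trans (uw 0%N m); exact: normc_ge0.
have e4 : 0 < e / 4 by apply: divr_gt0.
have vw m : normc (v m) <= w m.
  by apply: (@ctends_le (u^~ m) _ _ 0) => // K _; exact: uw.
(* If every tail of [w] exceeded e/4 somewhere, disjoint blocks of mass above e/4 could be piled up
   until the sum passes [B]. *)
have [N0 hN0] : exists N0, forall K, \sum_(N0 + n <= m < K) w m <= e / 4.
  apply: contrapT => /forallNP H.
  have big k : exists K, k%:R * (e / 4) <= \sum_(n <= m < K) w m.
    elim: k => [|k [K hK]]; first by exists n; rewrite mul0r big_geq.
    have /existsNP[K' /negP] := H K; rewrite -ltNge => hK'.
    have KK' : (K + n <= K')%N.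
      by rewrite leqNgt; apply/negP => /ltnW h; move: hK'; rewrite big_geq //; lra.
    exists K'; rewrite (@big_cat_nat _ _ _ (K + n)) ?leq_addl //= -natr1 mulrDl mul1r.
    apply: lerD (ltW hK'); apply: le_trans hK _.
    case: (leqP n K) => nK; last by rewrite [leLHS]big_geq ?(ltnW nK) // sumr_ge0.
    by rewrite [leRHS](@big_cat_nat _ _ _ K) ?leq_addr //= lerDl sumr_ge0.
  have [K] := big (Num.truncn (B / (e / 4))).+1.
  have : B < (Num.truncn (B / (e / 4))).+1%:R * (e / 4).
    by rewrite -ltr_pdivrMr // truncnS_gt.
  by move=> h1 h2; have := le_trans h2 (wB K); rewrite leNgt h1.
have [N1 hN1] : exists N1, forall K, (N1 <= K)%N ->
    normc (\sum_(n <= m < N0 + n) u K m - \sum_(n <= m < N0 + n) v m) < e / 4.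
  have : ctends (fun K => \sum_(n <= m < N0 + n) u K m) (\sum_(n <= m < N0 + n) v m).
    elim: (N0 + n)%N => [|k IH].
      by rewrite big_geq //; apply: ctends_ext (ctends_cst 0) => K; rewrite big_geq.
    case: (leqP n k) => nk; last first.
      by rewrite big_geq //; apply: ctends_ext (ctends_cst 0) => K; rewrite big_geq.
    rewrite big_nat_recr //=; apply: ctends_ext (ctendsD IH (uv k)) => K.
    by rewrite big_nat_recr.
  by move=> /(_ _ e4).
have [N2 hN2] := vz _ e4.
exists (maxn N1 (maxn N2 (N0 + n))) => K; rewrite !geq_max => /and3P[K1 K2 K3].
have nN : (n <= N0 + n)%N by exact: leq_addl.
have -> : \sum_(n <= m < K) u K m - z =
   (\sum_(n <= m < N0 + n) u K m - \sum_(n <= m < N0 + n) v m) +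
   \sum_(N0 + n <= m < K) u K m - \sum_(N0 + n <= m < K) v m +
   (\sum_(n <= m < K) v m - z).
  by rewrite !(@big_cat_nat _ _ _ (N0 + n) n K) //=; ring.
have := hN1 _ K1; have := hN2 _ K2; have := hN0 K.
have : normc (\sum_(N0 + n <= m < K) u K m) <= \sum_(N0 + n <= m < K) w m.
  by apply: le_trans (normc_sum _ _ _) _; apply: ler_sum.
have : normc (\sum_(N0 + n <= m < K) v m) <= \sum_(N0 + n <= m < K) w m.
  by apply: le_trans (normc_sum _ _ _) _; apply: ler_sum.
move=> h1 h2 h3 h4 h5.
apply: le_lt_trans (le_normcD _ _) _.
have := le_normcB (\sum_(n <= m < N0 + n) u K m - \sum_(n <= m < N0 + n) v m +
   \sum_(N0 + n <= m < K) u K m) (\sum_(N0 + n <= m < K) v m).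
have := le_normcD (\sum_(n <= m < N0 + n) u K m - \sum_(n <= m < N0 + n) v m)
   (\sum_(N0 + n <= m < K) u K m).
lra.
Qed.

End ComplexLimits.

(** * The complex exponential and its power series *)

Section ComplexExponential.
Variable R : realType.
Local Notation C := (Cplx R).
Implicit Types (z w : C) (x y : R).

Definition exp_sum z (K : nat) : C := \sum_(0 <= a < K) z ^+ a / a`!%:R.

Lemma exp_sum_real x K : exp_sum x%:C%C K = (series (exp_coeff x) K)%:C%C.
Proof.
rewrite /exp_sum /series /= rmorph_sum; apply: eq_bigr => a _ /=.
by rewrite rmorphM rmorphXn fmorphV rmorph_nat.
Qed.

Lemma exp_sum_real_cvg x : ctends (exp_sum x%:C%C) (expR x)%:C%C.
Proof.
have /ctendsC := is_cvg_series_exp_coeff x.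
by apply: ctends_ext => K; rewrite exp_sum_real.
Qed.

Lemma exp_sum_imag_cvg x :
  ctends (exp_sum ('i * x%:C)%C) (Complex (cos x) (sin x)).
Proof.
have E a : ('i * x%:C)%C ^+ a / a`!%:R =
    Complex (cos_coeff x a) (sin_coeff x a) :> C.
  rewrite cos_coeffE sin_coeffE /= exprMn.
  have -> : ('i%C : C) ^+ a =
      Complex ((~~ odd a)%:R * (-1) ^+ a./2) ((odd a)%:R * (-1) ^+ a.-1./2).
    rewrite -[in LHS](odd_double_half a) exprD -muln2 mulnC exprM sqr_i.
    have -> : (-1 : C) ^+ a./2 = ((-1) ^+ a./2)%:C%C by rewrite rmorphXn rmorphN rmorph1.
    case ao: (odd a) => /=; last by rewrite expr0 !mul0r mul1r; simpc.
    have -> : a.-1./2 = a./2 by rewrite -[in LHS](odd_double_half a) ao /= doubleK.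
    by rewrite expr1 !mul0r; simpc.
  rewrite -rmorphXn -(rmorph_nat (real_complex R)) -fmorphV /=; simpc.
  by congr Complex; ring.
apply: ctendsReIm.
  suff -> : (fun K => complex.Re (exp_sum ('i * x%:C)%C K)) = series (cos_coeff x).
    rewrite unlock; exact: is_cvg_series_cos_coeff.
  apply/funext => K; rewrite /exp_sum /series /=; elim: K => [|K IH]; first by rewrite !big_geq.
  by rewrite !big_nat_recr //= E -IH; case: (\sum_(_ <= _ < _) _).
suff -> : (fun K => complex.Im (exp_sum ('i * x%:C)%C K)) = series (sin_coeff x).
  rewrite unlock; exact: is_cvg_series_sin_coeff.
apply/funext => K; rewrite /exp_sum /series /=; elim: K => [|K IH]; first by rewrite !big_geq.
by rewrite !big_nat_recr //= E -IH; case: (\sum_(_ <= _ < _) _).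
Qed.

(** The excess of the product of the truncated series is the part a + b >= K of the square. Its
    coefficients are positive, so the excess at z and w is dominated by the excess at their moduli;
    hence the general field [F]. *)
Lemma exp_sumD_trunc (F : numFieldType) (z w : F) K :
  (\sum_(0 <= a < K) z ^+ a / a`!%:R) * (\sum_(0 <= b < K) w ^+ b / b`!%:R) -
  \sum_(0 <= a < K) (z + w) ^+ a / a`!%:R =
  \sum_(a < K) \sum_(b < K | (K <= a + b)%N) (z ^+ a / a`!%:R) * (w ^+ b / b`!%:R).
Proof.
rewrite !big_mkord big_distrlr /=.
have -> : \sum_(n < K) (z + w) ^+ n / n`!%:R =
   \sum_(a < K) \sum_(b < K | (a + b < K)%N) (z ^+ a / a`!%:R) * (w ^+ b / b`!%:R) :> F.
  transitivity (\sum_(n < K) \sum_(a < K | (a <= n)%N)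
     (z ^+ a / a`!%:R) * (w ^+ (n - a) / (n - a)`!%:R)).
    apply: eq_bigr => n _.
    rewrite addrC exprDn mulr_suml.
    rewrite (big_ord_widen_cond K xpredT (fun i => w ^+ (n - i) * z ^+ i *+ 'C(n, i) / n`!%:R)) //.
    apply: eq_big => [i|i]; first by rewrite ltnS.
    rewrite ltnS => ni; have nf m : m`!%:R != 0 :> F by rewrite pnatr_eq0 -lt0n fact_gt0.
    rewrite -mulr_natr -(bin_fact ni) !natrM.
    have b0 : 'C(n, i)%:R != 0 :> F by rewrite pnatr_eq0 -lt0n bin_gt0.
    by field; rewrite b0 !nf.
  rewrite (exchange_big_dep xpredT) //=; apply: eq_bigr => a _.
  set F' := fun b => z ^+ a / a`!%:R * (w ^+ b / b`!%:R).
  have aK : (a <= K)%N by exact: ltnW.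
  transitivity (\sum_(0 <= b < K - a) F' b).
    rewrite -(big_mkord (fun n => (a <= n)%N) (fun n => F' (n - a)%N)).
    rewrite (@big_cat_nat _ _ _ a) //= big_nat_cond big1 ?add0r; last first.
      by move=> i /andP[]; lia.
    rewrite -{1}(add0n a) big_addn big_nat_cond [RHS]big_nat_cond.
    by apply: eq_big => [i|i _]; [lia | rewrite addnK].
  rewrite -(big_mkord (fun b => (a + b < K)%N) F').
  rewrite [RHS](@big_cat_nat _ _ _ (K - a)) //= ?leq_subr //.
  rewrite [X in _ = _ + X]big_nat_cond [X in _ = _ + X]big1 ?addr0; last first.
    by move=> i /andP[]; lia.
  rewrite big_nat_cond [RHS]big_nat_cond; apply: eq_bigl => i; lia.
rewrite -sumrB; apply: eq_bigr => a _.
rewrite (bigID (fun b : 'I_K => (a + b < K)%N)) /= [X in X - _]addrC addrK.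
by apply: eq_bigl => b; rewrite -leqNgt.
Qed.

Lemma exp_sumD z w (e1 e2 : C) :
  ctends (exp_sum z) e1 -> ctends (exp_sum w) e2 -> ctends (exp_sum (z + w)) (e1 * e2).
Proof.
move=> ez ew.
pose b K : R := (series (exp_coeff (normc z)) K) * (series (exp_coeff (normc w)) K) -
  series (exp_coeff (normc z + normc w)) K.
(* The excess at the moduli tends to 0 because the real exponential is already known to be
   additive. *)
have bl : b @ \oo --> (0 : R).
  rewrite -(subrr (expR (normc z + normc w))) {1}expRD.
  apply: cvgB; last exact: is_cvg_series_exp_coeff.
  by apply: cvgM; exact: is_cvg_series_exp_coeff.
have h : ctends (fun K => exp_sum z K * exp_sum w K - exp_sum (z + w) K) 0.
  apply: (@ctends0_le _ _ b) => [K|e e0]; last first.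
    move/cvgrPdist_lt: bl => /(_ _ e0)[N _ hN]; exists N => K /hN.
    by rewrite sub0r normrN => /(le_lt_trans (ler_norm _)).
  rewrite /exp_sum exp_sumD_trunc /b /series /= /exp_coeff exp_sumD_trunc.
  apply: le_trans (normc_sum _ _ _) _; apply: ler_sum => i _.
  apply: le_trans (normc_sum _ _ _) _; apply: ler_sum => j _.
  by rewrite !normcM !normcV !normcX !normc_nat.
have := ctendsB (ctendsM ez ew) h; rewrite subr0.
by apply: ctends_ext => K; ring.
Qed.

(** [cexp] is defined by cosine and sine; the power series is what makes it accessible to
    [jet_series]. *)
Lemma cexp_series z : ctends (exp_sum z) (cexp z).
Proof.
case: z => x y; have -> : Complex x y = x%:C%C + ('i * y%:C)%C by simpc.
have := exp_sumD (exp_sum_real_cvg x) (exp_sum_imag_cvg y).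
by rewrite /cexp /=; congr ctends; simpc.
Qed.

Lemma cexpD z w : cexp (z + w) = cexp z * cexp w.
Proof. exact: ctends_uniq (cexp_series _) (exp_sumD (cexp_series _) (cexp_series _)). Qed.

Lemma cexp_real x : cexp x%:C%C = (expR x)%:C%C.
Proof. exact: ctends_uniq (cexp_series _) (exp_sum_real_cvg _). Qed.

Lemma cexp0 : cexp (0 : C) = 1.
Proof. by rewrite -(rmorph0 (real_complex R)) cexp_real expR0 rmorph1. Qed.

Lemma cexpN z : cexp (- z) = (cexp z)^-1.
Proof.
have h : cexp z * cexp (- z) = 1 by rewrite -cexpD subrr cexp0.
have z0 : cexp z != 0 by apply: contra_eq_neq h => ->; rewrite mul0r eq_sym oner_eq0.
by apply: (mulfI z0); rewrite h divff.
Qed.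

Lemma normc_cexp z : normc (cexp z) = expR (complex.Re z).
Proof.
rewrite /cexp /normc !exprMn -mulrDr cos2Dsin2 mulr1 sqrtr_sqr.
by rewrite ger0_norm ?expR_ge0.
Qed.

Lemma cexp_neq0 z : cexp z != 0.
Proof. by rewrite -normc_gt0 normc_cexp expR_gt0. Qed.

Lemma cexpMn z n : cexp (z * n%:R) = cexp z ^+ n.
Proof.
elim: n => [|n IH]; first by rewrite mulr0 cexp0.
by rewrite -natr1 mulrDr mulr1 cexpD IH exprSr.
Qed.

(** Term by term, from (J + b)! >= b!. *)
Lemma exp_tail_bound x J K : 0 <= x ->
  \sum_(J <= a < K) x ^+ a / a`!%:R <= x ^+ J * expR x.
Proof.
move=> x0; case: (leqP J K) => JK; last first.
  by rewrite big_geq ?(ltnW JK) // mulr_ge0 ?exprn_ge0 ?expR_ge0.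
have -> : \sum_(J <= a < K) x ^+ a / a`!%:R =
    \sum_(0 <= b < K - J) x ^+ (b + J) / (b + J)`!%:R.
  by rewrite -{1}(add0n J) big_addn.
apply: (@le_trans _ _ (x ^+ J * series (exp_coeff x) (K - J)%N)).
  rewrite /series /= mulr_sumr; apply: ler_sum => b _.
  rewrite /exp_coeff addnC exprD -mulrA; apply: ler_wpM2l; rewrite ?exprn_ge0 //.
  apply: ler_wpM2l; rewrite ?exprn_ge0 // lef_pV2 ?posrE ?ltr0n ?fact_gt0 //.
  rewrite ler_nat; elim: (J) => // j IHj.
  by rewrite addSn factS (leq_trans IHj) // leq_pmull.
apply: ler_wpM2l; rewrite ?exprn_ge0 //.
apply: nondecreasing_cvgn_le; last exact: is_cvg_series_exp_coeff.
by apply: nondecreasing_series => n _ _; rewrite /exp_coeff divr_ge0 ?exprn_ge0.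
Qed.

End ComplexExponential.

(** * Second order jets *)

Section Jets.
Variables (R : realType) (r : nat).
Local Notation C := (Cplx R).
Local Notation V := 'rV[C]_r.
Implicit Types (p s h k : V) (f g l : V -> C) (d M : R).

(** The l^1 norm with real values; by [nbhs_vn] it defines the same neighbourhoods as the norm of
    ['rV]. *)
Definition vn h : R := \sum_j normc (h 0 j).

Lemma vn_ge0 h : 0 <= vn h.
Proof. by apply: sumr_ge0 => j _; exact: normc_ge0. Qed.

Lemma vn0 : vn 0 = 0.
Proof. by rewrite /vn big1 // => j _; rewrite mxE normc0. Qed.

Lemma vnD h k : vn (h + k) <= vn h + vn k.
Proof. by rewrite /vn -big_split /=; apply: ler_sum => j _; rewrite mxE le_normcD. Qed.

Lemma vnN h : vn (- h) = vn h.
Proof. by apply: eq_bigr => j _; rewrite mxE normcN. Qed.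

Lemma vnB h k : vn (h - k) <= vn h + vn k.
Proof. by apply: le_trans (vnD _ _) _; rewrite vnN. Qed.

Lemma vnZ (a : C) h : vn (a *: h) = normc a * vn h.
Proof. by rewrite /vn mulr_sumr; apply: eq_bigr => j _; rewrite mxE normcM. Qed.

Lemma normc_le_vn h j : normc (h 0 j) <= vn h.
Proof.
by rewrite /vn (bigD1 j) //= lerDl; apply: sumr_ge0 => i _; exact: normc_ge0.
Qed.

(* f has a second order complex Taylor expansion at s with linear part L and
   quadratic part Q; all the bounds are relative to M and to the scale d. *)
Record jet_at p d M f s L (Q : V -> C) : Prop := JetAt {
  jet_lin : forall (a : C) h k, L (a *: h + k) = a * L h + L k;
  jet_quad : forall (a : C) h, Q (a *: h) = a ^+ 2 * Q h;
  jet_val : normc (f s) <= M;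
  jet_Lle : forall h, normc (L h) <= M * (vn h / d);
  jet_Qle : forall h, normc (Q h) <= M * (vn h / d) ^+ 2;
  jet_rem : forall h, vn (s + h - p) < d ->
    normc (f (s + h) - f s - L h - Q h) <= M * (vn h / d) ^+ 3 }.

(** One [M] serves all centres in the ball, which allows series to be summed jet by jet. Lengths are
    measured in units of [d], so that constants simply multiply in [jetM]. Homogeneity of [Q] is
    what restriction to complex lines uses. *)
Definition jet p d M f : Prop :=
  forall s, vn (s - p) < d -> exists L Q, jet_at p d M f s L Q.

Lemma jet_bound p d M f s : jet p d M f -> vn (s - p) < d -> normc (f s) <= M.
Proof. by move=> jf /jf[L [Q []]]. Qed.

Lemma jet_ge0 p d M f : 0 < d -> jet p d M f -> 0 <= M.
Proof.
move=> d0 jf; apply: le_trans (jet_bound jf (s := p) _); first exact: normc_ge0.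
by rewrite subrr vn0.
Qed.

Lemma jet_le p d M M' f : 0 < d -> M <= M' -> jet p d M f -> jet p d M' f.
Proof.
move=> d0 MM jf s /jf[L [Q [h1 h2 h3 h4 h5 h6]]]; exists L, Q.
have e0 h : 0 <= vn h / d by rewrite divr_ge0 ?vn_ge0 ?ltW.
split=> // [|h|h|h sh].
- exact: le_trans h3 MM.
- by apply: le_trans (h4 h) _; apply: ler_wpM2r.
- by apply: le_trans (h5 h) _; apply: ler_wpM2r; rewrite ?exprn_ge0.
- by apply: le_trans (h6 h sh) _; apply: ler_wpM2r; rewrite ?exprn_ge0.
Qed.

Lemma jet_shrink p d d' M f : 0 < d' <= d -> jet p d M f -> jet p d' M f.
Proof.
move=> /andP[d0 dd] jf s sd'; have sd : vn (s - p) < d by exact: lt_le_trans sd' dd.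
have d1 : 0 < d by exact: lt_le_trans dd.
have M0 := jet_ge0 d1 jf.
have [L [Q [h1 h2 h3 h4 h5 h6]]] := jf _ sd; exists L, Q.
have e0 h : 0 <= vn h / d by rewrite divr_ge0 ?vn_ge0 ?ltW.
have e1 h : vn h / d <= vn h / d'.
  by apply: ler_wpM2l; rewrite ?vn_ge0 // lef_pV2.
split=> // [h|h|h sh].
- by apply: le_trans (h4 h) _; apply: ler_wpM2l.
- by apply: le_trans (h5 h) _; apply: ler_wpM2l => //; apply: lerXn2r; rewrite ?nnegrE ?(le_trans (e0 h)).
- apply: le_trans (h6 h (lt_le_trans sh dd)) _.
  by apply: ler_wpM2l => //; apply: lerXn2r; rewrite ?nnegrE ?(le_trans (e0 h)).
Qed.

Lemma jet_ext p d M f g : (forall s, vn (s - p) < d -> f s = g s) ->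
  jet p d M f -> jet p d M g.
Proof.
move=> fg jf s sd; have [L [Q [h1 h2 h3 h4 h5 h6]]] := jf _ sd; exists L, Q.
by split=> // [|h sh]; rewrite -!fg //; exact: h6.
Qed.

Lemma jet_cst p d (c : C) : 0 < d -> jet p d (normc c) (fun=> c).
Proof.
move=> d0 s sd; exists (fun=> 0), (fun=> 0).
have e0 h : 0 <= vn h / d by rewrite divr_ge0 ?vn_ge0 ?ltW.
split=> // [a h k|a h|h|h|h _]; rewrite ?mulr0 ?addr0 ?subrr ?subr0 ?normc0 //;
  by rewrite mulr_ge0 ?exprn_ge0 // normc_ge0.
Qed.

Lemma jetD p d M M' f g : jet p d M f -> jet p d M' g ->
  jet p d (M + M') (fun s => f s + g s).
Proof.
move=> jf jg s sd.
have [L [Q [h1 h2 h3 h4 h5 h6]]] := jf _ sd.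
have [L' [Q' [k1 k2 k3 k4 k5 k6]]] := jg _ sd.
exists (fun h => L h + L' h), (fun h => Q h + Q' h).
split=> [a h k|a h||h|h|h sh].
- by rewrite h1 k1; ring.
- by rewrite h2 k2; ring.
- by apply: le_trans (le_normcD _ _) _; apply: lerD.
- by rewrite mulrDl; apply: le_trans (le_normcD _ _) _; apply: lerD.
- by rewrite mulrDl; apply: le_trans (le_normcD _ _) _; apply: lerD.
- rewrite mulrDl.
  have -> : f (s + h) + g (s + h) - (f s + g s) - (L h + L' h) - (Q h + Q' h) =
    (f (s + h) - f s - L h - Q h) + (g (s + h) - g s - L' h - Q' h) by ring.
  by apply: le_trans (le_normcD _ _) _; apply: lerD; [exact: h6|exact: k6].
Qed.

(** The constant 12 is 1 + 3 + 7 + 1, from the four terms into which the remainder of the product is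
    split; the value, the linear part and the quadratic part ask for 1, 2 and 3. *)
Lemma jetM p d M M' f g : 0 < d -> jet p d M f -> jet p d M' g ->
  jet p d (12 * (M * M')) (fun s => f s * g s).
Proof.
move=> d0 jf jg s sd.
have M0 := jet_ge0 d0 jf; have M1 := jet_ge0 d0 jg.
have MM : 0 <= M * M' by rewrite mulr_ge0.
have e0 h : 0 <= vn h / d by rewrite divr_ge0 ?vn_ge0 ?ltW.
have [L [Q [h1 h2 h3 h4 h5 h6]]] := jf _ sd.
have [L' [Q' [k1 k2 k3 k4 k5 k6]]] := jg _ sd.
have mulle (a b : C) (x y : R) : normc a <= x -> normc b <= y -> normc (a * b) <= x * y.
  by move=> ax bx; rewrite normcM; apply: ler_pM; rewrite ?normc_ge0.
exists (fun h => f s * L' h + g s * L h), (fun h => f s * Q' h + g s * Q h + L h * L' h).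
split=> [a h k|a h||h|h|h sh].
- by rewrite h1 k1; ring.
- have E (K : V -> C) : (forall (a : C) h k, K (a *: h + k) = a * K h + K k) ->
      K (a *: h) = a * K h.
    move=> KL; have K0 : K 0 = 0.
      by have := KL 1 0 0; rewrite scale1r addr0 mul1r -[LHS]addr0 => /addrI/esym.
    by have := KL a h 0; rewrite addr0 K0 addr0.
  by rewrite h2 k2 (E _ h1) (E _ k1); ring.
- by apply: le_trans (mulle _ _ _ _ h3 k3) _; rewrite ler_peMl // ler1n.
- apply: le_trans (le_normcD _ _) _.
  have a1 := mulle _ _ _ _ h3 (k4 h); have a2 := mulle _ _ _ _ k3 (h4 h).
  have := mulr_ge0 MM (e0 h); nra.
- apply: le_trans (le_normcD _ _) _.
  have a0 := le_normcD (f s * Q' h) (g s * Q h).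
  have a1 := mulle _ _ _ _ h3 (k5 h); have a2 := mulle _ _ _ _ k3 (h5 h).
  have a3 := mulle _ _ _ _ (h4 h) (k4 h).
  have := mulr_ge0 MM (exprn_ge0 2 (e0 h)).
  set x := vn h / d in a1 a2 a3 *; nra.
- set x := vn h / d.
  have x0 : 0 <= x by exact: e0.
  (* Both [s] and [s + h] lie in the ball of radius [d] about [p]; this absorbs the powers of [x]
     beyond the third. *)
  have x2 : x <= 2.
    rewrite ler_pdivrMr //; have -> : h = (s + h - p) - (s - p) by apply/rowP => j; rewrite !mxE; ring.
    by apply: le_trans (vnB _ _) _; lra.
  have {}h6 := h6 h sh; have {}k6 := k6 h sh; have {}h4 := h4 h; have {}k4 := k4 h.
  have {}h5 := h5 h; have {}k5 := k5 h.
  rewrite -/x in h4 h5 h6 k4 k5 k6.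
  set rf := f (s + h) - f s - L h - Q h in h6.
  set rg := g (s + h) - g s - L' h - Q' h in k6.
  have gb : normc (g (s + h)) <= M' by exact: jet_bound jg sh.
  have -> : f (s + h) * g (s + h) - f s * g s - (f s * L' h + g s * L h) -
     (f s * Q' h + g s * Q h + L h * L' h) =
     f s * rg + L h * (Q' h + rg) + Q h * (L' h + (Q' h + rg)) + rf * g (s + h).
    by rewrite /rf /rg; ring.
  have b1 : normc (Q' h + rg) <= M' * (x ^+ 2 * 3).
    apply: le_trans (le_normcD _ _) _.
    have : M' * x ^+ 3 <= M' * (x ^+ 2 * 2).
      by apply: ler_wpM2l => //; rewrite exprSr; apply: ler_wpM2l; rewrite ?exprn_ge0.
    lra.
  have b2 : normc (L' h + (Q' h + rg)) <= M' * (x * 7).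
    apply: le_trans (le_normcD _ _) _.
    have : M' * (x ^+ 2 * 3) <= M' * (x * 6).
      by apply: ler_wpM2l => //; rewrite exprSr expr1; nra.
    lra.
  have c1 := mulle _ _ _ _ h3 k6.
  have c2 := mulle _ _ _ _ h4 b1.
  have c3 := mulle _ _ _ _ h5 b2.
  have c4 := mulle _ _ _ _ h6 gb.
  apply: le_trans (le_normcD _ _) _.
  apply: le_trans (lerD (le_normcD _ _) (lexx _)) _.
  apply: le_trans (lerD (lerD (le_normcD _ _) (lexx _)) (lexx _)) _.
  apply: le_trans (lerD (lerD (lerD c1 c2) c3) c4) _.
  by rewrite le_eqVlt; apply/orP; left; apply/eqP; ring.
Qed.

Lemma jetZ p d M (a : C) f : 0 < d -> jet p d M f -> jet p d (normc a * M) (fun s => a * f s).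
Proof.
move=> d0 jf s sd.
have [L [Q [h1 h2 h3 h4 h5 h6]]] := jf _ sd.
exists (fun h => a * L h), (fun h => a * Q h).
have a0 := normc_ge0 a.
split=> [b h k|b h||h|h|h sh].
- by rewrite h1; ring.
- by rewrite h2; ring.
- by rewrite normcM ler_wpM2l.
- by rewrite normcM -mulrA ler_wpM2l.
- by rewrite normcM -mulrA ler_wpM2l.
- have -> : a * f (s + h) - a * f s - a * L h - a * Q h =
    a * (f (s + h) - f s - L h - Q h) by ring.
  by rewrite normcM -mulrA ler_wpM2l // h6.
Qed.

Lemma jetX p d M f n : 0 < d -> jet p d M f -> jet p d ((12 * M) ^+ n) (fun s => f s ^+ n).
Proof.
move=> d0 jf; elim: n => [|n IH].
  rewrite expr0 -(@normc1 R); apply: jet_ext (jet_cst (p := p) 1 d0) => // s _.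
have := jetM d0 jf IH.
by rewrite exprS !mulrA; apply: jet_ext => // s _; rewrite exprS.
Qed.

(** A Weierstrass theorem for jets: values, linear parts, quadratic parts and remainders are summed
    separately, all dominated by [M]. *)
Lemma jet_series (F : nat -> V -> C) (M : nat -> R) (B : R) n p d : 0 < d ->
  (forall m, jet p d (M m) (F m)) ->
  (forall K, \sum_(n <= m < K) M m <= B) ->
  (forall s, vn (s - p) < d ->
     exists z, ctends (fun K => \sum_(n <= m < K) F m s) z) /\
  jet p d B (fun s => clim (fun K => \sum_(n <= m < K) F m s)).
Proof.
move=> d0 jF MB.
have M0 m : 0 <= M m by exact: jet_ge0 (jF m).
(* The factor [x] will be 1 or a power of vn h / d, according to the part of the jet being
   summed. *)
have bnd (u : nat -> C) (x : R) : 0 <= x -> (forall m, normc (u m) <= M m * x) ->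
    forall K, \sum_(n <= m < K) normc (u m) <= B * x.
  move=> x0 uM K; apply: (@le_trans _ _ ((\sum_(n <= m < K) M m) * x)).
    by rewrite mulr_suml; apply: ler_sum.
  exact: ler_wpM2r.
have lim (u : nat -> C) (x : R) : 0 <= x -> (forall m, normc (u m) <= M m * x) ->
    ctends (fun K => \sum_(n <= m < K) u m) (clim (fun K => \sum_(n <= m < K) u m)).
  move=> x0 /(bnd _ _ x0)/abs_series_cvg[z uz].
  by rewrite (climE uz).
have lim_le (u : nat -> C) (x : R) : 0 <= x -> (forall m, normc (u m) <= M m * x) ->
    normc (clim (fun K => \sum_(n <= m < K) u m)) <= B * x.
  move=> x0 uM; apply: (ctends_le (N := 0) _ (lim _ _ x0 uM)) => K _.
  by apply: le_trans (normc_sum _ _ _) _; apply: bnd.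
have limF s : vn (s - p) < d -> ctends (fun K => \sum_(n <= m < K) F m s)
    (clim (fun K => \sum_(n <= m < K) F m s)).
  move=> sd; apply: (@lim _ 1) => // m.
  by rewrite mulr1; exact: jet_bound (jF m) sd.
split=> [s /limF h|s sd]; first by eexists; exact: h.
have /choice[LQ jLQ] : forall m, exists LQ : (V -> C) * (V -> C),
    jet_at p d (M m) (F m) s LQ.1 LQ.2.
  by move=> m; have [L [Q h]] := jF m _ sd; exists (L, Q).
have e0 h : 0 <= vn h / d by rewrite divr_ge0 ?vn_ge0 ?ltW.
have e2 h (i : nat) : 0 <= (vn h / d) ^+ i by rewrite exprn_ge0.
have limL h := lim (fun m => (LQ m).1 h) _ (e0 h) (fun m => jet_Lle (jLQ m) h).
have limQ h := lim (fun m => (LQ m).2 h) _ (e2 h 2%N) (fun m => jet_Qle (jLQ m) h).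
exists (fun h => clim (fun K => \sum_(n <= m < K) (LQ m).1 h)),
       (fun h => clim (fun K => \sum_(n <= m < K) (LQ m).2 h)).
split=> [a h k|a h||h|h|h sh].
- apply: climE; apply: ctends_ext (ctendsD (ctendsZ a (limL h)) (limL k)) => K.
  rewrite mulr_sumr -big_split /=; apply: eq_bigr => m _.
  by rewrite (jet_lin (jLQ m)).
- apply: climE; apply: ctends_ext (ctendsZ (a ^+ 2) (limQ h)) => K.
  rewrite mulr_sumr; apply: eq_bigr => m _.
  by rewrite (jet_quad (jLQ m)).
- rewrite -[leRHS]mulr1; apply: lim_le => // m.
  by rewrite mulr1; exact: jet_val (jLQ m).
- by apply: lim_le => // m; exact: jet_Lle (jLQ m) h.
- by apply: lim_le => // m; exact: jet_Qle (jLQ m) h.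
- have lm := ctendsB (ctendsB (ctendsB (limF _ sh) (limF _ sd)) (limL h)) (limQ h).
  apply: (ctends_le (N := 0%N) _ lm) => K _.
  rewrite -!sumrB; apply: le_trans (normc_sum _ _ _) _.
  by apply: bnd => // m; exact: jet_rem (jLQ m) h sh.
Qed.

(** Of order z^J at 0: this is the source of the decay of the Euler-Maclaurin remainder. *)
Definition exp_tail (J : nat) (z : C) : C := cexp z - \sum_(0 <= a < J) z ^+ a / a`!%:R.

Lemma exp_tailP J z : ctends (fun K => \sum_(J <= a < K) z ^+ a / a`!%:R) (exp_tail J z).
Proof.
have := ctendsB (cexp_series z) (ctends_cst (\sum_(0 <= a < J) z ^+ a / a`!%:R)).
apply: (@ctends_near _ _ _ _ J) => K JK.
by rewrite /exp_sum (@big_cat_nat _ _ _ J) //= [X in X - _]addrC addrK.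
Qed.

Lemma jet_exp_tail p d M f J : 0 < d -> jet p d M f ->
  jet p d ((12 * M) ^+ J * expR (12 * M)) (fun s => exp_tail J (f s)).
Proof.
move=> d0 jf; have M0 := jet_ge0 d0 jf.
have [] := @jet_series (fun a s => f s ^+ a / a`!%:R) (fun a => (12 * M) ^+ a / a`!%:R)
  ((12 * M) ^+ J * expR (12 * M)) J p d d0.
- move=> a; have := jetZ (a`!%:R^-1) d0 (jetX a d0 jf).
  rewrite normcV normc_nat mulrC.
  by apply: jet_ext => // s _; rewrite mulrC.
- by move=> K; apply: exp_tail_bound; rewrite mulr_ge0.
move=> _; apply: jet_ext => // s _.
exact/climE/exp_tailP.
Qed.

Lemma jet_cexp p d M f : 0 < d -> jet p d M f ->
  jet p d (expR (12 * M)) (fun s => cexp (f s)).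
Proof.
move=> d0 /(jet_exp_tail 0 d0); rewrite expr0 mul1r.
by apply: jet_ext => // s _; rewrite /exp_tail big_geq // subr0.
Qed.

Definition affine l : Prop := exists (lam : V -> C) (B : R),
  [/\ 0 <= B, forall (a : C) h k, lam (a *: h + k) = a * lam h + lam k,
      forall h, normc (lam h) <= B * vn h &
      forall s h, l (s + h) = l s + lam h].

Lemma affine_cst (c : C) : affine (fun=> c).
Proof.
exists (fun=> 0), 0; split=> //.
- by move=> a h k; rewrite mulr0 addr0.
- by move=> h; rewrite normc0 mul0r.
- by move=> s h; rewrite addr0.
Qed.

Lemma affineD l l' : affine l -> affine l' -> affine (fun s => l s + l' s).
Proof.
move=> [m [B [h0 h1 h2 h3]]] [m' [B' [k0 k1 k2 k3]]].
exists (fun h => m h + m' h), (B + B'); split=> [||h|s h].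
- exact: addr_ge0.
- by move=> a h k; rewrite h1 k1; ring.
- by rewrite mulrDl; apply: le_trans (le_normcD _ _) _; apply: lerD.
- by rewrite h3 k3; ring.
Qed.

Lemma affineZ (c : C) l : affine l -> affine (fun s => c * l s).
Proof.
move=> [m [B [h0 h1 h2 h3]]].
exists (fun h => c * m h), (normc c * B); split=> [||h|s h].
- by rewrite mulr_ge0 // normc_ge0.
- by move=> a h k; rewrite h1; ring.
- by rewrite normcM -mulrA ler_wpM2l // normc_ge0.
- by rewrite h3; ring.
Qed.

Lemma affine_ext l l' : l =1 l' -> affine l -> affine l'.
Proof. by move=> /funext ->. Qed.

Lemma affineN l : affine l -> affine (fun s => - l s).
Proof. by move=> /(affineZ (-1)); apply: affine_ext => s; rewrite mulN1r. Qed.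

Lemma affineB l l' : affine l -> affine l' -> affine (fun s => l s - l' s).
Proof. by move=> al /affineN; apply: affineD. Qed.

Lemma affine_sum (I : Type) (t : seq I) (P : pred I) (F : I -> V -> C) :
  (forall i, P i -> affine (F i)) -> affine (fun s => \sum_(i <- t | P i) F i s).
Proof.
move=> aF; elim: t => [|i t IH].
  by apply: affine_ext (affine_cst 0) => s; rewrite big_nil.
case Pi: (P i); last by apply: affine_ext IH => s; rewrite big_cons Pi.
by apply: affine_ext (affineD (aF _ Pi) IH) => s; rewrite big_cons Pi.
Qed.

Lemma affine_coord j : affine (fun s => s 0 j).
Proof.
exists (fun h => h 0 j), 1; split=> //.
- by move=> a h k; rewrite !mxE.
- by move=> h; rewrite mul1r normc_le_vn.
- by move=> s h; rewrite mxE.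
Qed.

Lemma affine_dist l : affine l -> exists2 B, 0 <= B &
  forall s t, normc (l s - l t) <= B * vn (s - t).
Proof.
move=> [m [B [h0 h1 h2 h3]]]; exists B => // s t.
by have := h3 t (s - t); rewrite subrKC => ->; rewrite addrC addKr.
Qed.

(** The bound tends to 0 with [d]: an exponent varies little on a small ball, so [hfam_cpow] loses
    arbitrarily little decay. *)
Lemma jet_affine l p : affine l -> exists2 B, 0 <= B &
  forall d, 0 < d -> jet p d (B * d) (fun s => l s - l p).
Proof.
move=> [m [B [h0 h1 h2 h3]]]; exists B => // d d0 s sd; exists m, (fun=> 0).
have e0 h : 0 <= vn h / d by rewrite divr_ge0 ?vn_ge0 ?ltW.
have Bd : 0 <= B * d by rewrite mulr_ge0 // ltW.
split=> // [a h||h|h|h sh].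
- by rewrite mulr0.
- have := h3 p (s - p); rewrite subrKC => ->; rewrite addrC addKr.
  by apply: le_trans (h2 _) _; apply: ler_wpM2l => //; exact: ltW.
- by rewrite -mulrA [d * _]mulrC divfK ?gt_eqF.
- by rewrite normc0 mulr_ge0 // exprn_ge0.
- rewrite h3; have -> : l s + m h - l p - (l s - l p) - m h - 0 = 0 by ring.
  by rewrite normc0 mulr_ge0 // exprn_ge0.
Qed.

Lemma jet_affine_bnd l p d : 0 < d -> affine l -> exists M, jet p d M l.
Proof.
move=> d0 /(@jet_affine _ p)[B B0 /(_ d d0) jl].
exists (B * d + normc (l p)).
by apply: jet_ext (jetD jl (jet_cst (p := p) (l p) d0)) => // s _; rewrite subrK.
Qed.

(** The expansion is 1/(l + m) = 1/l - m/l^2 + m^2/l^3 - m^3/(l^3 (l + m)). The radius is so small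
    that |l| >= |l p|/2 on the ball and |m h / l s| <= vn h / d. *)
Lemma jet_inv l p : affine l -> l p != 0 ->
  exists d M, 0 < d /\ jet p d M (fun s => (l s)^-1).
Proof.
move=> [m [B [h0 h1 h2 h3]]] lp.
set a := normc (l p); have a0 : 0 < a by rewrite normc_gt0.
have B1 : 0 < B + 1 by rewrite ltr_pwDr.
pose d := Num.min 1 (a / 2 / (B + 1)).
have d0 : 0 < d by rewrite lt_min ltr01 /= !divr_gt0.
have d1 : d <= 1 by rewrite ge_min lexx.
have Bd : B * d <= a / 2.
  have : d <= a / 2 / (B + 1) by rewrite ge_min lexx orbT.
  by rewrite ler_pdivlMr //; nra.
have lle s : vn (s - p) < d -> a / 2 <= normc (l s).
  move=> sd; have := h3 p (s - p); rewrite subrKC => ls.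
  have := h2 (s - p); have := ler_wpM2l h0 (ltW sd).
  have := le_normcB (l s) (m (s - p)); rewrite {1}ls addrK -/a; lra.
pose K := (a / 2)^-1.
have K0 : 0 < K by rewrite invr_gt0 divr_gt0.
have lK s : vn (s - p) < d -> normc (l s)^-1 <= K.
  by move=> /lle h; rewrite normcV lef_pV2 // posrE ?divr_gt0 // (lt_le_trans _ h) // divr_gt0.
have lN0 s : vn (s - p) < d -> l s != 0.
  by move=> /lle h; rewrite -normc_gt0 (lt_le_trans _ h) // divr_gt0.
have BK : B * d * K <= 1 by rewrite /K ler_pdivrMr ?divr_gt0 // mul1r.
have mx h : normc (m h) <= B * d * (vn h / d).
  by rewrite -mulrA [d * _]mulrC divfK ?gt_eqF.
have e0 h : 0 <= vn h / d by rewrite divr_ge0 ?vn_ge0 ?ltW.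
have mulle (b c : C) (x y : R) : normc b <= x -> normc c <= y -> normc (b * c) <= x * y.
  by move=> ax bx; rewrite normcM; apply: ler_pM; rewrite ?normc_ge0.
have mK s h : vn (s - p) < d -> normc (m h / l s) <= vn h / d.
  move=> sd; apply: le_trans (mulle _ _ _ _ (mx h) (lK _ sd)) _.
  by rewrite mulrAC ler_piMl.
exists d, K; split=> // s sd.
exists (fun h => - (m h / l s) * (l s)^-1), (fun h => (m h / l s) ^+ 2 * (l s)^-1).
have mZ b h : m (b *: h) = b * m h.
  have K00 : m 0 = 0.
    by have := h1 1 0 0; rewrite scale1r addr0 mul1r -[LHS]addr0 => /addrI/esym.
  by have := h1 b h 0; rewrite addr0 K00 addr0.
split=> [b h k|b h||h|h|h sh].
- by rewrite h1; ring.
- by rewrite mZ; ring.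
- exact: lK.
- rewrite [K * _]mulrC; apply: mulle; last exact: lK.
  by rewrite normcN; exact: mK.
- rewrite [K * _]mulrC; apply: mulle; last exact: lK.
  by rewrite normcX; apply: lerXn2r; rewrite ?nnegrE ?normc_ge0 ?mK.
- have -> : (l (s + h))^-1 - (l s)^-1 - - (m h / l s) / l s - (m h / l s) ^+ 2 / l s =
    - (m h / l s) ^+ 3 * (l (s + h))^-1.
    have l0 := lN0 _ sd; have := lN0 _ sh; rewrite h3 => l1.
    by field; rewrite l0 l1.
  rewrite [K * _]mulrC; apply: mulle; last exact: lK.
  by rewrite normcN normcX; apply: lerXn2r; rewrite ?nnegrE ?normc_ge0 ?mK.
Qed.

End Jets.

(** * Real powers of n + 1 as weights *)

Section Weights.
Variable R : realType.
Implicit Types (rho x y : R).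

(** This is (n + 1)^(-rho); the shift makes it 1 at n = 0. *)
Definition W rho (n : nat) : R := expR (- (rho * ln n.+1%:R)).

Lemma W_gt0 rho n : 0 < W rho n.
Proof. exact: expR_gt0. Qed.

Lemma W_ge0 rho n : 0 <= W rho n.
Proof. exact/ltW/W_gt0. Qed.

Lemma W0 rho : W rho 0 = 1.
Proof. by rewrite /W ln1 mulr0 oppr0 expR0. Qed.

Lemma WD rho rho' n : W (rho + rho') n = W rho n * W rho' n.
Proof. by rewrite /W -expRD mulrDl opprD. Qed.

Lemma W_le rho rho' n : rho <= rho' -> W rho' n <= W rho n.
Proof.
by move=> h; rewrite ler_expR lerN2 ler_wpM2r // ln_ge0 // ler1n.
Qed.

Lemma W_nat (J : nat) n : W J%:R n = n.+1%:R ^- J.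
Proof.
rewrite /W expRN mulr_natl -lnXn ?ltr0Sn // lnK //.
by rewrite posrE exprn_gt0.
Qed.

Lemma W_cmp rho x y c : 0 < x -> 0 < y -> `|ln x - ln y| <= c ->
  expR (- (rho * ln x)) <= expR (`|rho| * c) * expR (- (rho * ln y)).
Proof.
move=> x0 y0 xy; rewrite -expRD ler_expR.
have : - (rho * (ln x - ln y)) <= `|rho| * c.
  rewrite -mulrN; apply: le_trans (ler_norm _) _; rewrite normrM normrN.
  by apply: ler_wpM2l.
lra.
Qed.

Lemma ln_cmp x y (c : R) : 0 < x -> 0 < y -> 1 <= c -> x <= c * y -> y <= c * x ->
  `|ln x - ln y| <= ln c.
Proof.
move=> x0 y0 c1 xy yx; have c0 : 0 < c by exact: lt_le_trans c1.
have : ln x <= ln c + ln y.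
  by rewrite -lnM // ler_ln // posrE mulr_gt0.
have : ln y <= ln c + ln x.
  by rewrite -lnM // ler_ln // posrE mulr_gt0.
by rewrite ler_norml => h1 h2; apply/andP; split; lra.
Qed.

(** Meant for x = n + 1 + a with 0 <= a <= 1, whose logarithm exceeds that of n + 1 by at most ln
    2. *)
Lemma W_cmp_nat rho x n : n.+1%:R <= x <= 2 * n.+1%:R ->
  expR (- (rho * ln x)) <= expR (`|rho| * ln 2) * W rho n.
Proof.
move=> /andP[h1 h2]; have n0 : 0 < n.+1%:R :> R by rewrite ltr0Sn.
have x0 : 0 < x by exact: lt_le_trans h1.
apply: W_cmp => //; apply: ln_cmp => //; first by rewrite ler1n.
lra.
Qed.

Lemma W_succ rho n : W rho n.+1 <= expR (`|rho| * ln 2) * W rho n.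
Proof.
apply: W_cmp_nat; rewrite ler_nat leqnSn -natrM ler_nat /=; lia.
Qed.

Lemma ln_succ_ge n : n.+2%:R^-1 <= ln n.+2%:R - ln n.+1%:R :> R.
Proof.
have p1 : 0 < n.+1%:R :> R by rewrite ltr0Sn.
have p2 : 0 < n.+2%:R :> R by rewrite ltr0Sn.
rewrite -[leRHS]opprK opprB -ln_div // lerNr.
have : 1 + (n.+1%:R / n.+2%:R - 1) = n.+1%:R / n.+2%:R :> R by rewrite addrC subrK.
have r0 : 0 < n.+1%:R / n.+2%:R :> R by rewrite divr_gt0.
move=> e; rewrite -e; apply: le_trans (le_ln1Dx _) _.
  by move: r0; set t := _ / _ => r0; lra.
rewrite le_eqVlt; apply/orP; left; apply/eqP.
have e1 : n.+1%:R = n.+2%:R - 1 :> R by rewrite -[n.+2%:R]natr1 addrK.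
by rewrite e1; field; rewrite gt_eqF.
Qed.

(** Comparison with a telescoping sum; the summand 1 accounts for the first term m = n. *)
Lemma W_tail rho n K : 1 < rho ->
  \sum_(n <= m < K) W rho m <= (1 + (rho - 1)^-1) * W (rho - 1) n.
Proof.
move=> r1; have r0 : 0 < rho - 1 by lra.
(* From exp t >= 1 + t at t = (rho - 1)(ln(m + 2) - ln(m + 1)), which is at least (rho - 1)/(m +
   2). *)
have step m : W rho m.+1 <= (rho - 1)^-1 * (W (rho - 1) m - W (rho - 1) m.+1).
  rewrite ler_pdivlMl //.
  have -> : W rho m.+1 = W (rho - 1) m.+1 * m.+2%:R^-1.
    rewrite -[in LHS](subrK 1 rho) [LHS]WD; congr (_ * _); exact: (W_nat 1 m.+1).
  have -> : W (rho - 1) m = W (rho - 1) m.+1 * expR ((rho - 1) * (ln m.+2%:R - ln m.+1%:R)).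
    by rewrite -expRD; congr expR; ring.
  have := expR_ge1Dx ((rho - 1) * (ln m.+2%:R - ln m.+1%:R)).
  have := ler_wpM2l (ltW r0) (ln_succ_ge m).
  have := W_gt0 (rho - 1) m.+1.
  set w := W _ _; set x := expR _; set t := (rho - 1) * (_ - _).
  set i := m.+2%:R^-1; move=> w0 h1 h2.
  by rewrite mulrCA -[X in _ <= _ - X]mulr1 -mulrBr ler_pM2l //; lra.
case: (leqP K n) => nK.
  by rewrite big_geq // mulr_ge0 ?W_ge0 // addr_ge0 // invr_ge0 ltW.
rewrite big_ltn // mulrDl mul1r lerD //; first by apply: W_le; lra.
apply: (@le_trans _ _ ((rho - 1)^-1 * (W (rho - 1) n - W (rho - 1) K.-1))).
  have -> : K = K.-1.+1 by lia.
  rewrite /= big_add1 /=.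
  have : (n <= K.-1)%N by lia.
  elim: K.-1 => [|k IH] nk.
    by rewrite big_geq //; move: nk; rewrite leqn0 => /eqP ->; rewrite subrr mulr0.
  move: nk; rewrite leq_eqVlt => /predU1P[<-|nk]; first by rewrite big_geq // subrr mulr0.
  rewrite big_nat_recr //=; have := IH nk; have := step k.
  have : 0 < (rho - 1)^-1 by rewrite invr_gt0.
  by set t := (rho - 1)^-1 => t0; lra.
apply: ler_wpM2l; first by rewrite invr_ge0 ltW.
by rewrite gerBl W_ge0.
Qed.

End Weights.

(** * Families of holomorphic functions with uniform decay *)

Section Families.
Variables (R : realType) (r : nat).
Local Notation C := (Cplx R).
Local Notation V := 'rV[C]_r.
Implicit Types (p s : V) (f g l : V -> C) (F G : nat -> V -> C) (rho : R).

Definition holo p f : Prop := exists d M, 0 < d /\ jet p d M f.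

(** Ball and constant are common to all [n], so that sums over [n] are again holomorphic on that
    ball. *)
Definition hfam p rho F : Prop :=
  exists d M, [/\ 0 < d, 0 <= M & forall n, jet p d (M * W rho n) (F n)].

Lemma holo_ext p f g e : 0 < e -> (forall s, vn (s - p) < e -> f s = g s) ->
  holo p f -> holo p g.
Proof.
move=> e0 fg [d [M [d0 jf]]].
have m0 : 0 < Num.min d e by rewrite lt_min d0.
exists (Num.min d e), M; split=> //; apply: jet_ext (jet_shrink (d' := Num.min d e) _ jf).
  by move=> s; rewrite lt_min => /andP[_ /fg].
by rewrite m0 ge_min lexx.
Qed.

Lemma hfam_ext p rho F G e : 0 < e -> (forall n s, vn (s - p) < e -> F n s = G n s) ->
  hfam p rho F -> hfam p rho G.
Proof.
move=> e0 fg [d [M [d0 M0 jf]]].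
have m0 : 0 < Num.min d e by rewrite lt_min d0.
exists (Num.min d e), M; split=> // n; apply: jet_ext (jet_shrink (d' := Num.min d e) _ (jf n)).
  by move=> s; rewrite lt_min => /andP[_ /fg].
by rewrite m0 ge_min lexx.
Qed.

Lemma holo_cst p (c : C) : holo p (fun=> c).
Proof. by exists 1, (normc c); split=> //; apply: jet_cst. Qed.

Lemma holo_affine p l : affine l -> holo p l.
Proof. by move=> al; have [M jl] := jet_affine_bnd p ltr01 al; exists 1, M. Qed.

Lemma holo_inv p l : affine l -> l p != 0 -> holo p (fun s => (l s)^-1).
Proof. by move=> al lp; have [d [M h]] := jet_inv al lp; exists d, M. Qed.

Let min2 (d d' : R) : 0 < d -> 0 < d' ->
  [/\ 0 < Num.min d d', 0 < Num.min d d' <= d & 0 < Num.min d d' <= d'].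
Proof.
move=> d0 d0'; have m0 : 0 < Num.min d d' by rewrite lt_min d0.
by rewrite m0 !ge_min !lexx orbT.
Qed.

Lemma holoD p f g : holo p f -> holo p g -> holo p (fun s => f s + g s).
Proof.
move=> [d [M [d0 jf]]] [d' [M' [d0' jg]]]; have [m0 m1 m2] := min2 d0 d0'.
exists (Num.min d d'), (M + M'); split=> //.
exact: jetD (jet_shrink m1 jf) (jet_shrink m2 jg).
Qed.

Lemma holoM p f g : holo p f -> holo p g -> holo p (fun s => f s * g s).
Proof.
move=> [d [M [d0 jf]]] [d' [M' [d0' jg]]]; have [m0 m1 m2] := min2 d0 d0'.
exists (Num.min d d'), (12 * (M * M')); split=> //.
exact: jetM m0 (jet_shrink m1 jf) (jet_shrink m2 jg).
Qed.

Lemma holoZ p (c : C) f : holo p f -> holo p (fun s => c * f s).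
Proof. exact/holoM/holo_cst. Qed.

Lemma holo_sum (I : Type) (t : seq I) (P : pred I) (F : I -> V -> C) p :
  (forall i, P i -> holo p (F i)) -> holo p (fun s => \sum_(i <- t | P i) F i s).
Proof.
move=> hF; elim: t => [|i t IH].
  by apply: (@holo_ext _ _ _ 1) (holo_cst p 0) => // s _; rewrite big_nil.
case Pi: (P i); last by apply: (@holo_ext _ _ _ 1) IH => // s _; rewrite big_cons Pi.
by apply: (@holo_ext _ _ _ 1) (holoD (hF _ Pi) IH) => // s _; rewrite big_cons Pi.
Qed.

Lemma holo_prod (I : Type) (t : seq I) (P : pred I) (F : I -> V -> C) p :
  (forall i, P i -> holo p (F i)) -> holo p (fun s => \prod_(i <- t | P i) F i s).
Proof.
move=> hF; elim: t => [|i t IH].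
  by apply: (@holo_ext _ _ _ 1) (holo_cst p 1) => // s _; rewrite big_nil.
case Pi: (P i); last by apply: (@holo_ext _ _ _ 1) IH => // s _; rewrite big_cons Pi.
by apply: (@holo_ext _ _ _ 1) (holoM (hF _ Pi) IH) => // s _; rewrite big_cons Pi.
Qed.

Lemma holo_horner p f (q : {poly C}) : holo p f -> holo p (fun s => q.[f s]).
Proof.
move=> hf; elim/poly_ind: q => [|q c IH].
  by apply: (@holo_ext _ _ _ 1) (holo_cst p 0) => // s _; rewrite horner0.
apply: (@holo_ext _ _ _ 1) (holoD (holoM IH hf) (holo_cst p c)) => // s _.
by rewrite !hornerE.
Qed.

Lemma hfam_le p rho rho' F : rho <= rho' -> hfam p rho' F -> hfam p rho F.
Proof.
move=> rr [d [M [d0 M0 jF]]]; exists d, M; split=> // n.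
by apply: jet_le (jF n) => //; rewrite ler_wpM2l // W_le.
Qed.

Lemma hfamD p rho F G : hfam p rho F -> hfam p rho G ->
  hfam p rho (fun n s => F n s + G n s).
Proof.
move=> [d [M [d0 M0 jf]]] [d' [M' [d0' M0' jg]]]; have [m0 m1 m2] := min2 d0 d0'.
exists (Num.min d d'), (M + M'); split=> //; first exact: addr_ge0.
by move=> n; rewrite mulrDl; apply: jetD (jet_shrink m1 (jf n)) (jet_shrink m2 (jg n)).
Qed.

Lemma hfamM p rho rho' F G : hfam p rho F -> hfam p rho' G ->
  hfam p (rho + rho') (fun n s => F n s * G n s).
Proof.
move=> [d [M [d0 M0 jf]]] [d' [M' [d0' M0' jg]]]; have [m0 m1 m2] := min2 d0 d0'.
exists (Num.min d d'), (12 * (M * M')); split=> //; first by rewrite !mulr_ge0.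
move=> n; have := jetM m0 (jet_shrink m1 (jf n)) (jet_shrink m2 (jg n)).
by apply: jet_le => //; rewrite WD le_eqVlt; apply/orP; left; apply/eqP; ring.
Qed.

Lemma hfam_bounded p f : holo p f -> hfam p 0 (fun=> f).
Proof.
move=> [d [M [d0 jf]]]; exists d, M; split=> //; first exact: jet_ge0 jf.
by move=> n; rewrite /W mul0r oppr0 expR0 mulr1.
Qed.

Lemma hfamMl p rho f F : holo p f -> hfam p rho F -> hfam p rho (fun n s => f s * F n s).
Proof. by move=> /hfam_bounded hf /(hfamM hf); rewrite add0r. Qed.

Lemma hfamN p rho F : hfam p rho F -> hfam p rho (fun n s => - F n s).
Proof.
move=> /(hfamMl (holo_cst p (-1))); apply: (@hfam_ext _ _ _ _ 1) => // n s _.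
by rewrite mulN1r.
Qed.

Lemma hfamB p rho F G : hfam p rho F -> hfam p rho G ->
  hfam p rho (fun n s => F n s - G n s).
Proof. by move=> hF /hfamN; apply: hfamD. Qed.

Lemma hfam0 p rho : hfam p rho (fun _ _ => 0).
Proof.
exists 1, 0; split=> // n; rewrite mul0r -(@normc0 R).
exact: jet_cst.
Qed.

Lemma hfam_sum (I : Type) (t : seq I) (P : pred I) (F : I -> nat -> V -> C) p rho :
  (forall i, P i -> hfam p rho (F i)) ->
  hfam p rho (fun n s => \sum_(i <- t | P i) F i n s).
Proof.
move=> hF; elim: t => [|i t IH].
  by apply: (@hfam_ext _ _ _ _ 1) (hfam0 p rho) => // n s _; rewrite big_nil.
case Pi: (P i); last by apply: (@hfam_ext _ _ _ _ 1) IH => // n s _; rewrite big_cons Pi.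
by apply: (@hfam_ext _ _ _ _ 1) (hfamD (hF _ Pi) IH) => // n s _; rewrite big_cons Pi.
Qed.

Lemma hfam_succ p rho F : hfam p rho F -> hfam p rho (fun n => F n.+1).
Proof.
move=> [d [M [d0 M0 jF]]]; exists d, (M * expR (`|rho| * ln 2)); split=> //.
  by rewrite mulr_ge0 // expR_ge0.
move=> n; apply: jet_le (jF n.+1) => //.
by rewrite -mulrA ler_wpM2l // W_succ.
Qed.

Lemma hfam_at p rho F n : hfam p rho F -> holo p (F n).
Proof. by move=> [d [M [d0 _ jF]]]; exists d, (M * W rho n). Qed.

(** Summing a tail costs one unit of decay, by [W_tail]. *)
Lemma hfam_tail p rho F : 1 < rho -> hfam p rho F ->
  hfam p (rho - 1) (fun n s => clim (fun K => \sum_(n <= m < K) F m s)) /\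
  forall n, exists z, ctends (fun K => \sum_(n <= m < K) F m p) z.
Proof.
move=> r1 [d [M [d0 M0 jF]]].
have bnd n K : \sum_(n <= m < K) M * W rho m <= M * (1 + (rho - 1)^-1) * W (rho - 1) n.
  by rewrite -mulr_sumr -mulrA ler_wpM2l // W_tail.
have key n := jet_series d0 jF (bnd n).
split=> [|n]; last by apply: (proj1 (key n)); rewrite subrr vn0.
exists d, (M * (1 + (rho - 1)^-1)); split=> //.
  by rewrite mulr_ge0 // addr_ge0 // invr_ge0; lra.
by move=> n; exact: (proj2 (key n)).
Qed.

Lemma cpowD x (z w : C) : cpow x (z + w) = cpow x z * cpow x w.
Proof. by rewrite /cpow mulrDl cexpD. Qed.

Lemma cpowN x (z : C) : cpow x (- z) = (cpow x z)^-1.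
Proof. by rewrite /cpow mulNr cexpN. Qed.

Lemma cpow0 (x : R) : cpow x 0 = 1.
Proof. by rewrite /cpow mul0r cexp0. Qed.

Lemma cpow_nat (x : R) n : 0 < x -> cpow x n%:R = (x%:C%C) ^+ n :> C.
Proof.
by move=> x0; rewrite /cpow mulrC cexpMn cexp_real lnK.
Qed.

Lemma normc_cpow (x : R) (z : C) : normc (cpow x z) = expR (complex.Re z * ln x).
Proof. by rewrite normc_cexp; case: z => u v /=; rewrite mulr0 subr0. Qed.

(** The inequality is strict because the exponent varies over the ball; the gap [eta] pays for that
    variation. *)
Lemma hfam_cpow p l a rho : affine l -> 0 <= a <= 1 -> rho < - complex.Re (l p) ->
  hfam p rho (fun m s => cpow (m.+1%:R + a) (l s)).
Proof.
move=> /(@jet_affine _ _ _ p)[B B0 jl] /andP[a0 a1] rl.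
set eta := - complex.Re (l p) - rho.
have eta0 : 0 < eta by rewrite subr_gt0.
have B1 : 0 < 12 * (B + 1) by rewrite mulr_gt0 // ltr_pwDr.
(* The 12 is the one in the bound exp(12 M) of [jet_cexp]. *)
pose d := eta / (12 * (B + 1)).
have d0 : 0 < d by rewrite divr_gt0.
have Bd : 12 * (B * d) <= eta.
  have : d * (12 * (B + 1)) = eta by rewrite divfK // gt_eqF.
  nra.
exists d, (expR (`|rho| * ln 2)); split=> //.
move=> m; set x := m.+1%:R + a.
have x1 : 1 <= x by rewrite -[1]addr0 lerD // ler1n.
have lx : 0 <= ln x by exact: ln_ge0.
have j1 := jetZ (ln x)%:C%C d0 (jl d d0).
have j2 := jetZ (cpow x (l p)) d0 (jet_cexp d0 j1).
have le : normc (cpow x (l p)) * expR (12 * (normc (ln x)%:C%C * (B * d))) <=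
    expR (`|rho| * ln 2) * W rho m.
  rewrite normc_cpow normcC (ger0_norm lx) -expRD.
  apply: (@le_trans _ _ (expR (- (rho * ln x)))).
    rewrite ler_expR; have := ler_wpM2r lx Bd; rewrite /eta; lra.
  apply: W_cmp_nat; rewrite /x lerDl a0 /= mulr2n mulrDl mul1r lerD2l.
  by apply: le_trans a1 _; rewrite ler1n.
apply: jet_ext (jet_le d0 le j2) => s _.
have e : l s = l p + (l s - l p) by rewrite subrKC.
by rewrite [in RHS]e cpowD /cpow [(l s - l p) * _]mulrC.
Qed.

End Families.

(** * Binomial expansion of shifted powers *)

Section BinomialExpansion.
Variables (R : realType) (r : nat).
Local Notation C := (Cplx R).
Local Notation V := 'rV[C]_r.
Implicit Types (p s : V) (l : V -> C).

Definition bin (w : C) (t : nat) : C := (\prod_(i < t) (w - i%:R)) / t`!%:R.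

Definition binp (t : nat) : {poly C} := (t`!%:R)^-1 *: \prod_(i < t) ('X - (i%:R)%:P).

Lemma horner_binp t w : (binp t).[w] = bin w t.
Proof.
rewrite /binp /bin hornerZ horner_prod mulrC; congr (_ * _).
by apply: eq_bigr => i _; rewrite !hornerE.
Qed.

Lemma size_binp t : (size (binp t) <= t.+1)%N.
Proof.
apply: leq_trans (size_scale_leq _ _) _.
by rewrite size_prod_XsubC -[index_enum _]enumT size_enum_ord.
Qed.

Lemma bin_nat (w t : nat) : bin w%:R t = 'C(w, t)%:R.
Proof.
have tf : t`!%:R != 0 :> C by rewrite pnatr_eq0 -lt0n fact_gt0.
apply: (mulIf tf); rewrite /bin divfK // -natrM bin_ffact; elim: t {tf} => [|t IH].
  by rewrite big_ord0 ffactn0.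
rewrite big_ord_recr /= IH ffactnSr natrM.
case: (leqP t w) => tw; first by rewrite natrB.
by rewrite ffact_small ?mul0r.
Qed.

Lemma bin_sum_nat (w J : nat) (u : C) : (w < J)%N ->
  \sum_(0 <= t < J) bin w%:R t * u ^+ t = (1 + u) ^+ w.
Proof.
move=> wJ; rewrite exprDn (@big_cat_nat _ _ _ w.+1) //=.
rewrite [X in _ + X]big_nat_cond [X in _ + X]big1 ?addr0; last first.
  by move=> t /andP[/andP[h _] _]; rewrite bin_nat bin_small ?mul0r.
rewrite big_mkord; apply: eq_bigr => t _.
by rewrite bin_nat expr1n mul1r mulr_natl.
Qed.

(** [jet_exp_tail] for a constant function on a space of dimension 0. *)
Lemma normc_exp_tail J (z : C) :
  normc (exp_tail J z) <= (12 * normc z) ^+ J * expR (12 * normc z).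
Proof.
have j := jet_exp_tail J (@ltr01 R) (jet_cst (r := 0) (p := 0) z (@ltr01 R)).
by apply: (jet_bound j (s := 0)); rewrite subrr vn0.
Qed.

Lemma exp_tail_fam p l J (L : nat -> R) (c : R) : affine l ->
  (forall m, `|L m| <= c / m.+1%:R) ->
  hfam p J%:R (fun m s => exp_tail J (l s * (L m)%:C%C)).
Proof.
move=> al Lc; have [M jl] := jet_affine_bnd p (@ltr01 R) al.
have M0 := jet_ge0 (@ltr01 R) jl.
have c0 : 0 <= c by have := Lc 0%N; rewrite divr1; apply: le_trans.
exists 1, ((12 * (c * M)) ^+ J * expR (12 * (c * M))); split=> //.
  by rewrite mulr_ge0 ?expR_ge0 // exprn_ge0 // !mulr_ge0.
move=> m.
have := jet_exp_tail J (@ltr01 R) (jetZ (L m)%:C%C (@ltr01 R) jl).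
rewrite normcC.
have n0 : 0 < m.+1%:R :> R by rewrite ltr0Sn.
have le1 : `|L m| * M <= c * M / m.+1%:R by rewrite mulrAC ler_wpM2r.
have le2 : c * M / m.+1%:R <= c * M.
  by rewrite ler_pdivrMr // ler_peMr ?mulr_ge0 // ler1n.
move=> j; apply: jet_ext (jet_le (@ltr01 R) _ j).
  by move=> s _; rewrite mulrC.
rewrite W_nat mulrAC; apply: ler_pM; rewrite ?exprn_ge0 ?expR_ge0 ?mulr_ge0 //.
  rewrite -exprVn -exprMn; apply: lerXn2r; rewrite ?nnegrE ?mulr_ge0 ?invr_ge0 //.
  by rewrite -mulrA ler_wpM2l.
by rewrite ler_expR ler_wpM2l // (le_trans le1).
Qed.

(* Both sides are polynomials in w up to the exponential tail; they agree at the
   natural numbers w < J, so Lagrange interpolation bounds their difference. *)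
Lemma bin_expand p l J (L u : nat -> R) (c : R) : affine l -> (0 < J)%N ->
  (forall m, `|L m| <= c / m.+1%:R) ->
  (forall m, (0 < m)%N -> expR (L m) = 1 + u m) ->
  hfam p J%:R (fun m s => cexp (l s * (L m)%:C%C) -
    \sum_(0 <= t < J) bin (l s) t * (u m)%:C%C ^+ t).
Proof.
move=> al J0 Lc Lu.
pose D m : {poly C} := \sum_(0 <= a < J) ((L m)%:C%C ^+ a / a`!%:R) *: 'X^a -
   \sum_(0 <= t < J) ((u m)%:C%C ^+ t) *: binp t.
have DE m (w : C) : (D m).[w] = \sum_(0 <= a < J) (w * (L m)%:C%C) ^+ a / a`!%:R -
    \sum_(0 <= t < J) bin w t * (u m)%:C%C ^+ t.
  rewrite /D hornerD hornerN !horner_sum; congr (_ - _); apply: eq_bigr => a _.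
    by rewrite hornerZ hornerXn exprMn; ring.
  by rewrite hornerZ horner_binp mulrC.
have Dsize m : (size (D m) <= J)%N.
  have sz (F : nat -> {poly C}) : (forall a, (a < J)%N -> (size (F a) <= J)%N) ->
      (size (\sum_(0 <= a < J) F a)%R <= J)%N.
    move=> hF; rewrite big_mkord; apply: leq_trans (size_sum _ _ _) _.
    by apply/bigmax_leqP => a _; exact: hF.
  apply: leq_trans (size_polyD _ _) _; rewrite geq_max size_polyN !sz // => a aJ.
    by apply: leq_trans (size_scale_leq _ _) _; rewrite (leq_trans (size_binp _)).
  by apply: leq_trans (size_scale_leq _ _) _; rewrite size_polyXn.
have inj : injective (fun i : nat => i%:R : C) by move=> i j /eqP; rewrite eqr_nat => /eqP.
have Dval m (w : nat) : (0 < m)%N -> (w < J)%N -> (D m).[w%:R] = - exp_tail J (w%:R * (L m)%:C%C).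
  move=> m0 wJ; rewrite DE bin_sum_nat // /exp_tail opprB; congr (_ - _).
  by rewrite mulrC cexpMn cexp_real Lu // rmorphD rmorph1.
have c0 : 0 <= c by have := Lc 0%N; rewrite divr1; apply: le_trans.
have Dbnd (w : nat) : (w < J)%N -> exists2 K, 0 <= K & forall m, normc (D m).[w%:R] <= K * W J%:R m.
  move=> wJ; exists (normc (D 0%N).[w%:R] + (12 * (w%:R * c)) ^+ J * expR (12 * (w%:R * c))).
    by rewrite addr_ge0 ?normc_ge0 // mulr_ge0 ?expR_ge0 // exprn_ge0 // !mulr_ge0.
  case=> [|m]; first by rewrite W0 mulr1 lerDl mulr_ge0 ?expR_ge0 // exprn_ge0 // !mulr_ge0.
  rewrite Dval // normcN; apply: le_trans (normc_exp_tail _ _) _.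
  rewrite normcM normc_nat normcC W_nat [leRHS]mulrDl.
  apply: ler_wpDl; first by rewrite mulr_ge0 ?normc_ge0 // invr_ge0 exprn_ge0.
  have n0 : 0 < m.+2%:R :> R by rewrite ltr0Sn.
  have le1 : w%:R * `|L m.+1| <= w%:R * c / m.+2%:R by rewrite -mulrA ler_wpM2l.
  have le2 : w%:R * c / m.+2%:R <= w%:R * c.
    by rewrite ler_pdivrMr // ler_peMr ?mulr_ge0 // ler1n.
  rewrite mulrAC; apply: ler_pM; rewrite ?exprn_ge0 ?expR_ge0 ?mulr_ge0 //.
    rewrite -exprVn -exprMn; apply: lerXn2r; rewrite ?nnegrE ?mulr_ge0 ?invr_ge0 //.
    by rewrite -mulrA ler_wpM2l.
  by rewrite ler_expR ler_wpM2l // (le_trans le1).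
pose lag i : {poly C} := tnth (J.-lagrange (fun i => i%:R)) i.
have Dlag m : D m = \sum_(i < J) ((D m).[i%:R])%:P * lag i by exact: lagrange_gen.
apply: (@hfam_ext _ _ _ _ (fun m s => exp_tail J (l s * (L m)%:C%C) +
    \sum_(i < J) (D m).[i%:R] * (lag i).[l s]) _ 1) => //.
  move=> m s _; have -> : \sum_(i < J) (D m).[i%:R] * (lag i).[l s] = (D m).[l s].
    rewrite [in RHS]Dlag horner_sum; apply: eq_bigr => i _.
    by rewrite hornerM hornerC.
  by rewrite DE /exp_tail; ring.
apply: hfamD; first exact: exp_tail_fam Lc.
apply: hfam_sum => i _.
have [K K0 hK] := Dbnd i (ltn_ord i).
have [d [M [d0 jM]]] := holo_horner (lag i) (holo_affine p al).
have M0 := jet_ge0 d0 jM.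
exists d, (K * M); split=> //; first exact: mulr_ge0.
move=> m; apply: jet_le (jetZ (D m).[i%:R] d0 jM) => //.
by rewrite mulrAC ler_wpM2r.
Qed.

Lemma ln_diff_bound (x y : R) : 0 < x -> 0 < y ->
  `|ln y - ln x| <= `|y - x| / Num.min x y.
Proof.
have key (a b : R) : 0 < a -> a <= b -> 0 <= ln b - ln a <= (b - a) / a.
  move=> a0 ab; have b0 : 0 < b by exact: lt_le_trans ab.
  rewrite subr_ge0 ler_ln ?posrE // ab /= -ln_div ?posrE //.
  have e : b / a = 1 + (b - a) / a by rewrite mulrBl divff ?gt_eqF // subrKC.
  rewrite e; apply: le_ln1Dx; rewrite (lt_le_trans (ltrN10 _)) // divr_ge0 ?subr_ge0 //.
  exact: ltW.
move=> x0 y0; case: (lerP x y) => [xy|/ltW yx].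
  have /andP[h1 h2] := key _ _ x0 xy.
  by rewrite ger0_norm // ger0_norm // subr_ge0.
have /andP[h1 h2] := key _ _ y0 yx.
by rewrite distrC ger0_norm // distrC ger0_norm // subr_ge0.
Qed.

Lemma ln_shift_bound (a b : R) : 0 <= a <= 1 -> 0 <= b <= 1 ->
  exists c, forall m, `|ln (m%:R + b) - ln (m.+1%:R + a)| <= c / m.+1%:R.
Proof.
move=> /andP[a0 a1] /andP[b0 b1].
(* For m >= 1 the arguments differ by at most 2 and are at least m, and 2/m <= 4/(m + 1). The last
   summand covers m = 0, where m + b may be 0. *)
exists (4 + `|ln (0%:R + b) - ln (1%:R + a)|).
case=> [|m]; first by rewrite divr1 lerDr.
have p1 : 0 < m.+2%:R :> R by rewrite ltr0Sn.
have p2 : 0 < m.+1%:R :> R by rewrite ltr0Sn.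
have q : 1 <= m.+1%:R :> R by rewrite ler1n.
have e : m.+2%:R = m.+1%:R + 1 :> R by rewrite natr1.
have g1 : 0 < m.+2%:R + a by exact: ltr_wpDr.
have g2 : 0 < m.+1%:R + b by exact: ltr_wpDr.
apply: le_trans (ln_diff_bound g1 g2) _.
have mn : m.+1%:R <= Num.min (m.+2%:R + a) (m.+1%:R + b).
  by rewrite le_min; apply/andP; split; lra.
apply: (@le_trans _ _ (2 / m.+1%:R)).
  apply: ler_pM => //; first by rewrite invr_ge0; apply: le_trans mn; exact: ltW.
    by rewrite ler_norml; apply/andP; split; lra.
  by rewrite lef_pV2 // posrE (lt_le_trans _ mn).
rewrite ler_pdivrMr // mulrAC ler_pdivlMr //.
have := normr_ge0 (ln (0%:R + b) - ln (1%:R + a)); nra.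
Qed.

End BinomialExpansion.

(** * The recursion on the depth *)

Section Step.
Variable R : realType.
Local Notation C := (Cplx R).
Implicit Types (z e lam S : C) (c mu : nat -> C) (a b beta : R) (B : nat -> {poly R}).

Definition poch z (j : nat) : C := \prod_(i < j) (z + i%:R).

Definition bern B beta (j : nat) : R := (B j).[beta] / j`!%:R.

(* [bern B beta] inverts (e^((1-beta)X) - e^(-beta X)) / X as a power series. *)
Definition bern_identity B beta : Prop := bern B beta 0 = 1 /\
  forall q, \sum_(0 <= j < q.+1) bern B beta j *
    (((1 - beta) ^+ (q.+1 - j) - (- beta) ^+ (q.+1 - j)) / (q.+1 - j)`!%:R) = (q == 0)%:R.

(** The Euler-Maclaurin coefficient of order j: up to sign, the Pochhammer symbol is the factor
    produced by j - 1 derivatives of x^(-z). *)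
Definition bern_coef B beta (j : nat) z : C := (bern B beta j)%:C%C * poch z j.-1.

(* Coefficients and remainder of the asymptotic expansion in powers of n + b of
   sum_(m >= n) lam (m+1+a)^-S T (m+1), from those (c, Rr) of T in powers of
   n + a; the expansion of T has leading exponent e0, the new one e = e0 + 1 - S.
   The choice mu l = lam / (l - e) makes the generalised Euler-Maclaurin formula
   hold; keeping mu free allows clearing that denominator. *)
Definition cnext B beta e lam mu c (l : nat) : C :=
  lam * (\sum_(0 <= k < l) c k * bern_coef B beta (l - k) (1 - e + k%:R)) + mu l * c l.

Definition Gsum (N : nat) b e c (n : nat) : C :=
  \sum_(0 <= k < N) c k * cpow (n%:R + b) (e - k%:R).

(** Compares G'(m) - G'(m+1), for the new finite sum G', with the main part of the summand. If Re e
    < N, the boundary term at infinity vanishes and the whole series from n on is G'(n) plus the sum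
    of [Rterm]. *)
Definition Ebr (N : nat) a b e0 e S lam c c' (m : nat) : C :=
  Gsum N b e c' m - Gsum N b e c' m.+1
  - lam * (cpow (m.+1%:R + a) S)^-1 * Gsum N a e0 c m.+1.

Definition Rterm (N : nat) a b e0 e S lam c c' (Rr : nat -> C) (m : nat) : C :=
  lam * (cpow (m.+1%:R + a) S)^-1 * Rr m.+1 - Ebr N a b e0 e S lam c c' m.

Definition Rnext (N : nat) a b e0 e S lam c c' (Rr : nat -> C) (n : nat) : C :=
  clim (fun K => \sum_(n <= m < K) Rterm N a b e0 e S lam c c' Rr m).

Lemma pochD z i j : poch z (i + j) = poch z i * poch (z + i%:R) j.
Proof.
rewrite /poch big_split_ord /=; congr (_ * _).
by apply: eq_bigr => k _; rewrite natrD addrA.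
Qed.

Lemma bin_poch z t : bin (- z) t = (-1) ^+ t * poch z t / t`!%:R.
Proof.
rewrite /bin /poch; congr (_ / _).
rewrite -[in (-1) ^+ t](card_ord t) -prodr_const -big_split /=.
by apply: eq_bigr => i _; ring.
Qed.

Let delta beta t : C := ((beta - 1) ^+ t - beta ^+ t)%:C%C.

Lemma bern_identityC B beta q : bern_identity B beta ->
  \sum_(0 <= j < q.+1) (bern B beta j)%:C%C *
    ((-1) ^+ (q.+1 - j) * delta beta (q.+1 - j) / (q.+1 - j)`!%:R) = (q == 0)%:R.
Proof.
move=> [_ /(_ q)/(congr1 (real_complex R))].
rewrite rmorph_nat => <-; rewrite rmorph_sum; apply: eq_bigr => j _.
rewrite [RHS]rmorphM; congr (_ * _).
rewrite [RHS]rmorphM fmorphV rmorph_nat; congr (_ / _).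
rewrite /delta -[-1 in LHS](rmorphN1 (real_complex R)) -rmorphXn -rmorphM; congr (_%:C%C).
by rewrite mulrBr -!exprMn !mulN1r opprB.
Qed.

(** The coefficient of x^(e - v - 1), x = m + 1 + a, in the telescoping relation. With binomials
    written as Pochhammer symbols and terms grouped by the index k of [c], the inner sum is the one
    in [bern_identity], which leaves only k = v. *)
Lemma coef_identity B beta e lam mu c (N v : nat) : bern_identity B beta ->
  (forall l, (l < N)%N -> mu l * (l%:R - e) * c l = lam * c l) -> (v < N)%N ->
  \sum_(0 <= l < v.+1) cnext B beta e lam mu c l *
     (bin (e - l%:R) (v.+1 - l) * delta beta (v.+1 - l)) = lam * c v.
Proof.
move=> bid mul vN.
have b0 : bern B beta 0 = 1 by case: bid.
pose z k : C := 1 - e + k%:R.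
pose D t : C := (-1) ^+ t * delta beta t / t`!%:R.
(* The [mu] part becomes the missing summand j = 0: the binomial coefficient contains the factor e -
   l, which the relation between [mu] and [lam] absorbs. *)
have A l : (l <= v)%N -> mu l * c l * (bin (e - l%:R) (v.+1 - l) * delta beta (v.+1 - l)) =
    lam * c l * poch (z l) (v - l) * ((bern B beta 0)%:C%C * D (v - l).+1).
  move=> lv; rewrite b0 rmorph1 mul1r.
  have -> : e - l%:R = - (l%:R - e) by rewrite opprB.
  rewrite bin_poch subSn // -add1n pochD /D {1}/poch big_ord1 addr0.
  have -> : l%:R - e + 1%:R = z l by rewrite /z; ring.
  have <- := mul l (leq_ltn_trans lv vN); rewrite add1n.
  by ring.
(* The two Pochhammer symbols concatenate into one that no longer depends on l. *)
have Bt k l : (k < l)%N -> (l <= v)%N ->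
    c k * bern_coef B beta (l - k) (1 - e + k%:R) *
      (bin (e - l%:R) (v.+1 - l) * delta beta (v.+1 - l)) =
    c k * poch (z k) (v - k) * ((bern B beta (l - k))%:C%C * D (v - k - (l - k)).+1).
  move=> kl lv; rewrite /bern_coef -/(z k).
  have -> : e - l%:R = - (z k + (l - k).-1%:R).
    rewrite /z -subn1 !natrB ?subn_gt0 ?(ltnW kl) //; ring.
  rewrite bin_poch /D.
  have -> : (v - k - (l - k)).+1 = (v.+1 - l)%N by lia.
  have -> : poch (z k) (v - k) = poch (z k) (l - k).-1 * poch (z k + (l - k).-1%:R) (v.+1 - l).
    by rewrite -pochD; congr poch; lia.
  by ring.
rewrite /cnext.
under eq_bigr do rewrite mulrDl.
rewrite big_split /=.
have -> : \sum_(0 <= l < v.+1) lam *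
    (\sum_(0 <= k < l) c k * bern_coef B beta (l - k) (1 - e + k%:R)) *
    (bin (e - l%:R) (v.+1 - l) * delta beta (v.+1 - l)) =
  \sum_(0 <= k < v.+1) lam * (c k * poch (z k) (v - k)) *
     \sum_(1 <= j < (v - k).+1) (bern B beta j)%:C%C * D (v - k - j).+1.
  transitivity (\sum_(0 <= l < v.+1) \sum_(0 <= k < v.+1 | (k < l)%N)
     lam * (c k * poch (z k) (v - k) * ((bern B beta (l - k))%:C%C * D (v - k - (l - k)).+1))).
    apply: eq_big_nat => l /andP[_ lv].
    rewrite -mulrA mulr_suml mulr_sumr (big_nat_widen _ _ v.+1) //=; last exact: leqW.
    rewrite big_nat_cond [RHS]big_nat_cond; apply: eq_bigr => k /andP[_ kl].
    by rewrite Bt.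
  rewrite (exchange_big_dep_nat xpredT) //=; apply: eq_big_nat => k /andP[_ kv].
  rewrite mulr_sumr (@big_cat_nat _ _ _ k.+1) //= big_nat_cond big1 ?add0r; last first.
    by move=> i /andP[]; lia.
  rewrite -[k.+1]add1n big_addn subSn // big_nat_cond [RHS]big_nat_cond.
  apply: eq_big => [i|i _]; first by lia.
  by rewrite addnK; ring.
rewrite -big_split /=.
transitivity (\sum_(0 <= k < v.+1) lam * (c k * poch (z k) (v - k)) * ((v - k)%N == 0)%:R).
  apply: eq_big_nat => k /andP[_ kv]; rewrite A //.
  rewrite -(bern_identityC (v - k) bid) [in RHS]big_ltn // subn0 mulrDr addrC.
  rewrite -/(D _) mulrA; congr (_ + _); congr (_ * _).
  by apply: eq_big_nat => j /andP[_ jv]; rewrite /D subSn.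
rewrite big_nat_recr //= subnn eqxx mulr1 [poch _ 0]/poch big_ord0 mulr1.
rewrite big_nat_cond big1 ?add0r // => k /andP[/andP[_ kv] _].
by rewrite subn_eq0 leqNgt kv mulr0.
Qed.

(** All main terms cancel by [coef_identity]. The truncation order N - l + 1 depends on l so that
    every product of x^(e - l) with its [rem] is of order x^(e - N - 1). *)
Lemma Ebr_expand (N : nat) B a b e0 e S lam mu c (m : nat) :
  bern_identity B (b - a) -> 0 <= a -> e0 = e - 1 + S ->
  (forall l, (l < N)%N -> mu l * (l%:R - e) * c l = lam * c l) ->
  let c' := cnext B (b - a) e lam mu c in
  let x := m.+1%:R + a in
  let rem (w : C) (J : nat) (y beta : R) := cexp (w * (ln y - ln x)%:C%C) -
     \sum_(0 <= t < J) bin w t * (beta / x)%:C%C ^+ t in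
  Ebr N a b e0 e S lam c c' m =
  \sum_(0 <= l < N) c' l * cpow x (e - l%:R) *
    (rem (e - l%:R) (N - l).+1 (m%:R + b) (b - a - 1) -
     rem (e - l%:R) (N - l).+1 (m.+1%:R + b) (b - a)).
Proof.
move=> bid a0 e0E mul c' x rem.
have x0 : 0 < x by rewrite ltr_pwDl.
have cx w (y : R) : cpow y w = cpow x w * cexp (w * (ln y - ln x)%:C%C).
  by rewrite /cpow -cexpD -mulrDr -rmorphD subrKC.
have xt w t : cpow x w * (x^-1)%:C%C ^+ t = cpow x (w - t%:R).
  by rewrite cpowD cpowN cpow_nat // -exprVn fmorphV.
rewrite /Ebr /Gsum -/x -sumrB.
suff -> : lam * (cpow x S)^-1 * (\sum_(0 <= k < N) c k * cpow x (e0 - k%:R)) =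
   \sum_(0 <= l < N) c' l * cpow x (e - l%:R) *
      (\sum_(0 <= t < (N - l).+1) bin (e - l%:R) t * ((b - a - 1) / x)%:C%C ^+ t -
       \sum_(0 <= t < (N - l).+1) bin (e - l%:R) t * ((b - a) / x)%:C%C ^+ t).
  rewrite -sumrB; apply: eq_bigr => l _.
  by rewrite /rem (cx _ (m%:R + b)) (cx _ (m.+1%:R + b)); ring.
have -> : lam * (cpow x S)^-1 * (\sum_(0 <= k < N) c k * cpow x (e0 - k%:R)) =
   \sum_(0 <= v < N) cpow x (e - v.+1%:R) * (lam * c v).
  rewrite mulr_sumr; apply: eq_bigr => k _.
  have -> : e0 - k%:R = (e - k.+1%:R) + S by rewrite e0E -natr1; ring.
  by rewrite cpowD; field; exact: cexp_neq0.
(* Rearranged by the total order v + 1 = l + t; the terms t = 0 cancel between the two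
   expansions. *)
transitivity (\sum_(0 <= v < N) \sum_(0 <= l < N | (l <= v)%N)
    cpow x (e - v.+1%:R) * (c' l * (bin (e - l%:R) (v.+1 - l) * delta (b - a) (v.+1 - l)))).
  apply: eq_big_nat => v /andP[_ vN].
  rewrite -(coef_identity bid mul vN) mulr_sumr (big_nat_widen _ _ N) //.
rewrite (exchange_big_dep_nat xpredT) //=; apply: eq_big_nat => l /andP[_ lN].
rewrite (@big_cat_nat _ _ _ l) ?(ltnW lN) //= big_nat_cond big1 ?add0r; last first.
  by move=> i /andP[]; lia.
rewrite -sumrB big_ltn // !expr0 subrr add0r mulr_sumr.
rewrite -[l in \sum_(l <= _ < _ | _) _]add0n big_addn [RHS]big_add1 /=.
rewrite big_nat_cond [RHS]big_nat_cond; apply: eq_big => [i|i _]; first by lia.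
have -> : ((i + l).+1 - l)%N = i.+1 by lia.
have -> : e - (i + l).+1%:R = e - l%:R - i.+1%:R by rewrite -addnS addnC natrD -natr1; ring.
rewrite -xt /delta !rmorphM !exprMn rmorphB !rmorphXn.
by ring.
Qed.

End Step.

(** * Holomorphy and decay of one step *)

Section StepHolo.
Variables (R : realType) (r : nat).
Local Notation C := (Cplx R).
Local Notation V := 'rV[C]_r.
Implicit Types (p s : V) (B : nat -> {poly R}).

Lemma Re_natB (z : C) n : complex.Re (z - n%:R) = complex.Re z - n%:R.
Proof. by rewrite -(rmorph_nat (real_complex R)); case: z. Qed.

Lemma holo_cnext p B beta (e lam : V -> C) (mu c : nat -> V -> C) l N : affine e ->
  holo p lam -> (forall k, (k < N)%N -> holo p (mu k)) ->
  (forall k, (k < N)%N -> holo p (c k)) -> (l < N)%N ->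
  holo p (fun s => cnext B beta (e s) (lam s) (mu^~ s) (c^~ s) l).
Proof.
move=> ae hlam hmu hc lN; rewrite /cnext.
apply: holoD; last by apply: holoM; [exact: hmu|exact: hc].
apply: holoM => //.
apply: (@holo_ext _ _ _ _ _ 1 ltr01 (fun s _ => esym (big_nat _ _ _ _ _))).
apply: holo_sum => k /andP[_ kl].
apply: holoM; first by apply: hc; exact: ltn_trans lN.
apply: holoZ; rewrite /poch; apply: holo_prod => i _; apply: holo_affine.
apply: affineD (affine_cst _ _); apply: affineD (affine_cst _ _).
exact: affineB (affine_cst _ _) ae.
Qed.

Lemma hfam_Ebr p B N a b (e0 e S lam : V -> C) (mu c : nat -> V -> C) d rho :
  bern_identity B (b - a) -> 0 <= a <= 1 -> 0 <= b <= 1 ->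
  affine e -> (forall s, e0 s = e s - 1 + S s) -> holo p lam ->
  (forall k, (k < N)%N -> holo p (mu k)) ->
  (forall k, (k < N)%N -> holo p (c k)) ->
  0 < d -> (forall s l, vn (s - p) < d -> (l < N)%N ->
     mu l s * (l%:R - e s) * c l s = lam s * c l s) ->
  rho < N%:R + 1 - complex.Re (e p) ->
  hfam p rho (fun m s => Ebr N a b (e0 s) (e s) (S s) (lam s) (c^~ s)
     (cnext B (b - a) (e s) (lam s) (mu^~ s) (c^~ s)) m).
Proof.
move=> bid a01 b01 ae e0E hlam hmu hc d0 mul rN.
have /andP[a0 a1] := a01; have /andP[b0 b1] := b01.
have [k1 hk1] := ln_shift_bound a01 b01.
have k2 m : `|ln (m.+1%:R + b) - ln (m.+1%:R + a)| <= 1 / m.+1%:R.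
  have p1 : 0 < m.+1%:R :> R by rewrite ltr0Sn.
  have g1 : 0 < m.+1%:R + a by exact: ltr_wpDr.
  have g2 : 0 < m.+1%:R + b by exact: ltr_wpDr.
  apply: le_trans (ln_diff_bound g1 g2) _.
  have mn : m.+1%:R <= Num.min (m.+1%:R + a) (m.+1%:R + b).
    by rewrite le_min; apply/andP; split; lra.
  apply: ler_pM => //; first by rewrite invr_ge0; apply: le_trans mn; exact: ltW.
    by rewrite ler_norml; apply/andP; split; lra.
  by rewrite lef_pV2 // posrE (lt_le_trans _ mn).
pose x (m : nat) := m.+1%:R + a.
have x0 m : 0 < x m by rewrite ltr_pwDl.
pose rem (w : C) (J : nat) (y beta x : R) := cexp (w * (ln y - ln x)%:C%C) -
     \sum_(0 <= t < J) bin w t * (beta / x)%:C%C ^+ t.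
apply: (@hfam_ext _ _ _ _ (fun m s => \sum_(0 <= l < N | (0 <= l < N)%N)
    cnext B (b - a) (e s) (lam s) (mu^~ s) (c^~ s) l * (cpow (x m) (e s - l%:R) *
    (rem (e s - l%:R) (N - l).+1 (m%:R + b) (b - a - 1) (x m) -
     rem (e s - l%:R) (N - l).+1 (m.+1%:R + b) (b - a) (x m)))) _ d d0).
  move=> m s sd; rewrite (@Ebr_expand _ N B a b (e0 s) (e s) (S s) (lam s) (mu^~ s) (c^~ s) m) //; last first.
    by move=> l lN; apply: mul.
  by rewrite -big_nat; apply: eq_bigr => l _; rewrite mulrA.
apply: hfam_sum => l /andP[_ lN].
have ael : affine (fun s => e s - l%:R) by apply: affineB ae (affine_cst _ _).
apply: hfamMl; first exact: (@holo_cnext _ _ _ _ _ _ _ _ N).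
have -> : rho = (rho - (N - l).+1%:R) + (N - l).+1%:R by rewrite subrK.
apply: hfamM.
  apply: hfam_cpow => //; rewrite Re_natB -natr1 natrB ?(ltnW lN) //.
  by move: rN; lra.
apply: hfamB.
  apply: (@bin_expand _ _ _ _ _ (fun m => ln (m%:R + b) - ln (x m)) (fun m => (b - a - 1) / x m) k1) => // m m0.
  have g1 : 0 < m%:R + b by rewrite ltr_wpDr // ltr0n.
  rewrite expRB !lnK ?posrE //.
  by apply: (mulIf (lt0r_neq0 (x0 m))); rewrite [RHS]mulrDl !divfK ?lt0r_neq0 // /x -natr1; ring.
apply: (@bin_expand _ _ _ _ _ (fun m => ln (m.+1%:R + b) - ln (x m)) (fun m => (b - a) / x m) 1) => // m m0.
have g1 : 0 < m.+1%:R + b by rewrite ltr_wpDr.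
rewrite expRB !lnK ?posrE //.
by apply: (mulIf (lt0r_neq0 (x0 m))); rewrite [RHS]mulrDl !divfK ?lt0r_neq0 // /x; ring.
Qed.

Lemma hfam_Rnext p B N a b (e0 e S lam : V -> C) (mu c Rr : nat -> V -> C) d :
  bern_identity B (b - a) -> 0 <= a <= 1 -> 0 <= b <= 1 ->
  affine e -> affine S -> (forall s, e0 s = e s - 1 + S s) -> holo p lam ->
  (forall k, (k < N)%N -> holo p (mu k)) ->
  (forall k, (k < N)%N -> holo p (c k)) ->
  0 < d -> (forall s l, vn (s - p) < d -> (l < N)%N ->
     mu l s * (l%:R - e s) * c l s = lam s * c l s) ->
  (forall rho, rho < N%:R - complex.Re (e0 p) -> hfam p rho Rr) ->
  complex.Re (e p) < N%:R ->
  let c' s := cnext B (b - a) (e s) (lam s) (mu^~ s) (c^~ s) in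
  (forall rho, rho < N%:R - complex.Re (e p) -> hfam p rho (fun n s =>
    Rnext N a b (e0 s) (e s) (S s) (lam s) (c^~ s) (c' s) (Rr^~ s) n)) /\
  (forall n, exists z, ctends (fun K => \sum_(n <= m < K)
     Rterm N a b (e0 p) (e p) (S p) (lam p) (c^~ p) (c' p) (Rr^~ p) m) z).
Proof.
move=> bid a01 b01 ae aS e0E hlam hmu hc d0 mul hR eN c'.
have hT rho : rho < N%:R + 1 - complex.Re (e p) ->
    hfam p rho (fun m s => Rterm N a b (e0 s) (e s) (S s) (lam s) (c^~ s) (c' s) (Rr^~ s) m).
  move=> rN; apply: hfamB; last exact: hfam_Ebr mul rN.
  (* The slack is shared between the two factors, each of whose decay is known up to an arbitrarily
     small loss. *)
  pose eta := (N%:R + 1 - complex.Re (e p) - rho) / 2.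
  have eta0 : 0 < eta by rewrite divr_gt0 // subr_gt0.
  have Re0 : complex.Re (e0 p) = complex.Re (e p) - 1 + complex.Re (S p).
    by rewrite e0E; case: (e p) => ? ?; case: (S p) => ? ?; rewrite /= .
  have -> : rho = (complex.Re (S p) - eta) + (N%:R - complex.Re (e0 p) - eta).
    by rewrite Re0 /eta; field.
  apply: (@hfam_ext _ _ _ _ (fun m s => lam s * (cpow (m.+1%:R + a) (- S s) * Rr m.+1 s)) _ 1) => //.
    by move=> m s _; rewrite cpowN mulrA.
  apply: hfamMl => //; apply: hfamM; last first.
    by apply: hfam_succ; apply: hR; rewrite ltrBlDr ltrDl.
  apply: hfam_cpow => //; first exact: affineN.
  have -> : complex.Re (- S p) = - complex.Re (S p) by case: (S p).
  by rewrite opprK ltrBlDr ltrDl.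
(* A decay exponent above 1 exists because Re e < N; this is where the remainder series
   converges. *)
have [r0 [r1 r2]] : exists r0, 1 < r0 /\ r0 < N%:R + 1 - complex.Re (e p).
  exists (1 + (N%:R - complex.Re (e p)) / 2); split; lra.
split; last by apply: (proj2 (hfam_tail r1 (hT _ r2))).
move=> rho rN.
pose rho' := Num.max (rho + 1) r0.
have h1 : 1 < rho' by rewrite lt_max r1 orbT.
have h2 : rho' < N%:R + 1 - complex.Re (e p) by rewrite gt_max r2 andbT; lra.
apply: hfam_le (proj1 (hfam_tail h1 (hT _ h2))).
by rewrite lerBrDr le_max lexx.
Qed.

End StepHolo.

(** * Coefficients and remainders at all depths *)

Section System.
Variables (R : realType).
Local Notation C := (Cplx R).
Variables (B : nat -> {poly R}) (a : nat -> R).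

(* The state after summing over the first i indices: the inner sums are
   T_i(n) = sum_(k < N) cc i k (n + a i)^(ee i - k) + RR i n, independently of N
   when lam = 1 and mu i l = 1 / (l - ee i.+1). *)
Definition ee (s : nat -> C) (i : nat) : C := i%:R - \sum_(0 <= j < i) s j.

Fixpoint cc (lam : nat -> C) (mu : nat -> nat -> C) (s : nat -> C) (i : nat) : nat -> C :=
  if i is i'.+1 then
    cnext B (a i - a i') (ee s i) (lam i') (mu i') (cc lam mu s i')
  else fun k => (k == 0%N)%:R.

(** At depth 0 the constant 1 is the term k = 0 of the finite sum if N > 0; for N = 0 that sum is
    empty and the remainder has to be 1. *)
Fixpoint RR (N : nat) (lam : nat -> C) (mu : nat -> nat -> C) (s : nat -> C) (i : nat) : nat -> C :=
  if i is i'.+1 then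
    Rnext N (a i') (a i) (ee s i') (ee s i) (s i') (lam i') (cc lam mu s i')
      (cc lam mu s i) (RR N lam mu s i')
  else fun=> (N == 0%N)%:R.

Definition TT N lam mu s i n : C :=
  Gsum N (a i) (ee s i) (cc lam mu s i) n + RR N lam mu s i n.

Lemma eeS s i : ee s i = ee s i.+1 - 1 + s i.
Proof. by rewrite /ee big_nat_recr //= -natr1; ring. Qed.

Hypothesis a01 : forall i, 0 <= a i <= 1.
Hypothesis bid : forall i, bern_identity B (a i.+1 - a i).

Variables (r : nat).
Local Notation V := 'rV[C]_r.
Variables (S : V -> nat -> C).
Hypothesis affS : forall j, affine (S^~ j).

Lemma affine_ee i : affine (fun s => ee (S s) i).
Proof. by apply: affineB (affine_cst _ _) _; apply: affine_sum. Qed.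

(** The relation mu (l - e) c = lam c has no denominator and makes sense on the hyperplane e = l
    itself, so regularised parameters qualify at a pole. *)
Lemma system_holo (p : V) (N m : nat) (lam : V -> nat -> C) (mu : V -> nat -> nat -> C) d :
  (forall i, (i < m)%N -> holo p (lam^~ i)) ->
  (forall i k, (i < m)%N -> (k < N)%N -> holo p (fun s => mu s i k)) ->
  0 < d -> (forall s i l, vn (s - p) < d -> (i < m)%N -> (l < N)%N ->
    mu s i l * (l%:R - ee (S s) i.+1) * cc (lam s) (mu s) (S s) i l =
      lam s i * cc (lam s) (mu s) (S s) i l) ->
  (forall i, (i < m)%N -> complex.Re (ee (S p) i.+1) < N%:R) ->
  forall i, (i <= m)%N ->
  (forall k, (k < N)%N -> holo p (fun s => cc (lam s) (mu s) (S s) i k)) /\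
  (forall rho, rho < N%:R - complex.Re (ee (S p) i) ->
     hfam p rho (fun n s => RR N (lam s) (mu s) (S s) i n)).
Proof.
move=> hlam hmu d0 mul hN; elim=> [_|i IH im].
  split=> [k _|rho]; first exact: holo_cst.
  rewrite /ee big_geq // subr0 -(rmorph_nat (real_complex R)) /= subr0.
  case: N {hN mul hmu} => [|N] rN /=; last exact: hfam0.
  by apply: hfam_le (hfam_bounded (holo_cst _ _)); exact: ltW.
have [hc hR] := IH (ltnW im); split=> [k kN|].
  by apply: (@holo_cnext _ _ _ _ _ _ _ _ _ _ N) => //; [exact: affine_ee|exact: hlam|move=> l; exact: hmu].
apply: (proj1 (@hfam_Rnext _ _ p B N (a i) (a i.+1) (fun s => ee (S s) i)
  (fun s => ee (S s) i.+1) (S^~ i) (lam^~ i) (fun k s => mu s i k)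
  (fun k s => cc (lam s) (mu s) (S s) i k) (fun n s => RR N (lam s) (mu s) (S s) i n) d _ _ _ _ _ _ _ _ _ _ _ _ _)) => //.
- exact: affine_ee.
- by move=> s; exact: eeS.
- exact: hlam.
- by move=> k; exact: hmu.
- by move=> s l sd lN; exact: mul.
- exact: hN.
Qed.

Lemma system_cvg (p : V) (N m : nat) (lam : V -> nat -> C) (mu : V -> nat -> nat -> C) d :
  (forall i, (i < m)%N -> holo p (lam^~ i)) ->
  (forall i k, (i < m)%N -> (k < N)%N -> holo p (fun s => mu s i k)) ->
  0 < d -> (forall s i l, vn (s - p) < d -> (i < m)%N -> (l < N)%N ->
    mu s i l * (l%:R - ee (S s) i.+1) * cc (lam s) (mu s) (S s) i l =
      lam s i * cc (lam s) (mu s) (S s) i l) ->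
  (forall i, (i < m)%N -> complex.Re (ee (S p) i.+1) < N%:R) ->
  forall i n, (i < m)%N -> ctends (fun K => \sum_(n <= j < K)
    Rterm N (a i) (a i.+1) (ee (S p) i) (ee (S p) i.+1) (S p i) (lam p i)
      (cc (lam p) (mu p) (S p) i) (cc (lam p) (mu p) (S p) i.+1)
      (RR N (lam p) (mu p) (S p) i) j) (RR N (lam p) (mu p) (S p) i.+1 n).
Proof.
move=> hlam hmu d0 mul hN i n im.
have [hc hR] := system_holo hlam hmu d0 mul hN (ltnW im).
have [z hz] := proj2 (@hfam_Rnext _ _ p B N (a i) (a i.+1) (fun s => ee (S s) i)
  (fun s => ee (S s) i.+1) (S^~ i) (lam^~ i) (fun k s => mu s i k)
  (fun k s => cc (lam s) (mu s) (S s) i k) (fun n s => RR N (lam s) (mu s) (S s) i n) d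
  (bid i) (a01 i) (a01 i.+1) (affine_ee _) (affS i) (fun s => eeS _ _) (hlam i im)
  (fun k => hmu i k im) hc d0 (fun s l sd => mul s i l sd im) hR (hN i im)) n.
by rewrite /= /Rnext (climE hz).
Qed.

End System.

(** * Bernoulli polynomials *)

Section AsymptoticSeries.
Variable R : realType.
Implicit Types (F G : R -> R) (u v : nat -> R) (P : R -> Prop).

Definition near0 P : Prop := exists2 d : R, 0 < d & forall x, x != 0 -> `|x| < d -> P x.

Lemma near0_and P Q : near0 P -> near0 Q -> near0 (fun x => P x /\ Q x).
Proof.
move=> [d d0 hP] [e e0 hQ]; exists (Num.min d e); first by rewrite lt_min d0.
by move=> x x0; rewrite lt_min => /andP[h1 h2]; split; [exact: hP|exact: hQ].
Qed.

Lemma near0_imp P Q : (forall x, x != 0 -> P x -> Q x) -> near0 P -> near0 Q.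
Proof. by move=> PQ [d d0 hP]; exists d => // x x0 xd; apply/PQ/hP. Qed.

(* F x = u 0 + u 1 x + ... + O(x^N) at 0, in a form suited to induction on N. *)
Fixpoint asyN (N : nat) F u : Prop :=
  if N is N'.+1 then exists G, near0 (fun x => F x = u 0%N + x * G x) /\ asyN N' G (fun n => u n.+1)
  else exists K, near0 (fun x => `|F x| <= K).

Definition asy F u : Prop := forall N, asyN N F u.

Lemma asyN_ext N F G u : near0 (fun x => F x = G x) -> asyN N F u -> asyN N G u.
Proof.
move=> FG; case: N => [|N] /=.
  by move=> [K hK]; exists K; apply: near0_imp (near0_and FG hK) => x _ [->].
move=> [H [h1 h2]]; exists H; split=> //.
by apply: near0_imp (near0_and FG h1) => x _ [->].
Qed.

Lemma asyN_exts N F u v : u =1 v -> asyN N F u -> asyN N F v.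
Proof. by move=> /funext ->. Qed.

Lemma asyN_bound N F u : asyN N F u -> asyN 0 F u.
Proof.
elim: N F u => [//|N IH] F u /= [G [hF /IH /= [K hK]]].
exists (`|u 0%N| + K); have [d d0 h] := near0_and hF hK.
exists (Num.min d 1); first by rewrite lt_min d0 ltr01.
move=> x x0; rewrite lt_min => /andP[xd x1]; have [-> GK] := h x x0 xd.
apply: le_trans (ler_normD _ _) _; rewrite lerD2l normrM.
by apply: le_trans GK; rewrite ler_piMl // ltW.
Qed.

Lemma asyN_pred N F u : asyN N.+1 F u -> asyN N F u.
Proof.
elim: N F u => [|N IH] F u; first exact: asyN_bound.
by move=> [G [hF hG]]; exists G; split=> //; exact: IH.
Qed.

Lemma asyN_D N F G u v : asyN N F u -> asyN N G v ->
  asyN N (fun x => F x + G x) (fun n => u n + v n).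
Proof.
elim: N F G u v => [|N IH] F G u v /=.
  move=> [K hK] [L hL]; exists (K + L); apply: near0_imp (near0_and hK hL) => x _ [h1 h2].
  by apply: le_trans (ler_normD _ _) _; exact: lerD.
move=> [F1 [h1 h2]] [G1 [k1 k2]]; exists (fun x => F1 x + G1 x); split; last exact: IH.
by apply: near0_imp (near0_and h1 k1) => x _ [-> ->]; ring.
Qed.

Lemma asyN_Z N c F u : asyN N F u -> asyN N (fun x => c * F x) (fun n => c * u n).
Proof.
elim: N F u => [|N IH] F u /=.
  move=> [K hK]; exists (`|c| * K); apply: near0_imp hK => x _ h.
  by rewrite normrM ler_wpM2l.
move=> [F1 [h1 h2]]; exists (fun x => c * F1 x); split; last exact: IH.
by apply: near0_imp h1 => x _ ->; ring.
Qed.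

Definition conv u v (n : nat) : R := \sum_(0 <= i < n.+1) u i * v (n - i)%N.

Lemma convS u v n : conv u v n.+1 = u 0%N * v n.+1 + conv (fun n => u n.+1) v n.
Proof. by rewrite /conv big_nat_recl // subn0. Qed.

(** Induction through F G = u_0 v_0 + x (u_0 G_1 + F_1 G), where G keeps its own expansion to one
    order less. *)
Lemma asyN_M N F G u v : asyN N F u -> asyN N G v ->
  asyN N (fun x => F x * G x) (conv u v).
Proof.
elim: N F G u v => [|N IH] F G u v.
  move=> [K hK] [L hL]; exists (K * L); apply: near0_imp (near0_and hK hL) => x _ [h1 h2].
  by rewrite normrM; apply: ler_pM.
move=> [F1 [h1 h2]] hG; have hG' := asyN_pred hG; move: hG => [G1 [k1 k2]].
exists (fun x => u 0%N * G1 x + F1 x * G x); split.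
  apply: near0_imp (near0_and h1 k1) => x _ [-> Gx].
  by rewrite /conv big_nat1 subn0 Gx; ring.
apply: asyN_exts (asyN_D (asyN_Z (u 0%N) k2) (IH _ _ _ _ h2 hG')) => n.
by rewrite convS.
Qed.

Lemma asyN_opp N F u : asyN N F u -> asyN N (fun x => F (- x)) (fun n => (-1) ^+ n * u n).
Proof.
have near0N P : near0 P -> near0 (fun x => P (- x)).
  by move=> [d d0 h]; exists d => // x x0 xd; apply: h; rewrite ?oppr_eq0 ?normrN.
elim: N F u => [|N IH] F u /=.
  by move=> [K hK]; exists K; exact: (near0N (fun x => `|F x| <= K)).
move=> [F1 [h1 h2]]; exists (fun x => (-1) * F1 (- x)); split.
  by apply: near0_imp (near0N (fun x => F x = u 0%N + x * F1 x) h1) => x _ ->; rewrite expr0 mul1r; ring.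
apply: asyN_exts (asyN_Z (-1) (IH _ _ h2)) => n.
by rewrite exprS mulrA.
Qed.

Lemma asyN1_uniq F u v : asyN 1 F u -> asyN 1 F v -> u 0%N = v 0%N.
Proof.
move=> [G [h1 [K hK]]] [H [k1 [L hL]]].
apply/eqP; rewrite -subr_eq0 -normr_le0; apply/ler_addgt0Pr => e e0; rewrite add0r.
have [d d0 h] := near0_and (near0_and h1 hK) (near0_and k1 hL).
have KL : 0 < `|K| + `|L| + 1 by rewrite ltr_wpDl ?addr_ge0.
pose x := Num.min (d / 2) (e / (`|K| + `|L| + 1)).
have x0 : 0 < x by rewrite lt_min !divr_gt0.
have xd : `|x| < d.
  by rewrite gtr0_norm // (@le_lt_trans _ _ (d / 2)) // ?ge_min ?lexx //; lra.
have xe : x * (`|K| + `|L| + 1) <= e.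
  by rewrite -ler_pdivlMr // ge_min lexx orbT.
have [[a1 a2] [b1 b2]] := h x (lt0r_neq0 x0) xd.
have -> : u 0%N - v 0%N = x * (H x - G x).
  by move: a1; rewrite b1 => a1; rewrite mulrBr; lra.
rewrite normrM gtr0_norm //; apply: le_trans xe; apply: ler_wpM2l; first exact: ltW.
apply: le_trans (ler_normB _ _) _.
have := ler_norm K; have := ler_norm L; lra.
Qed.

(** Turns identities between functions near 0 into identities between coefficients; the algebraic
    properties of the Bernoulli polynomials come from their generating function in this way. *)
Lemma asy_uniq F u v : asy F u -> asy F v -> u =1 v.
Proof.
move=> hu hv n; elim: n F u v {hu hv} (hu n.+1) (hv n.+1) => [|n IH] F u v.
  exact: asyN1_uniq.
move=> [G [h1 h2]] [H [k1 k2]].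
have e0 : u 0%N = v 0%N.
  apply: (@asyN1_uniq F).
    by exists G; split; [exact: h1 | exact: (@asyN_bound n.+1 _ (fun n => u n.+1) h2)].
  by exists H; split; [exact: k1 | exact: (@asyN_bound n.+1 _ (fun n => v n.+1) k2)].
apply: (IH G (fun n => u n.+1) (fun n => v n.+1) h2).
apply: (@asyN_ext n.+1 _ _ (fun n => v n.+1) _ k2); apply: near0_imp (near0_and h1 k1) => x x0 [-> ].
by rewrite e0 => /addrI/(mulfI x0).
Qed.

(** For N = 0, the terms at x0 = d/2 are bounded, so a geometric series of ratio 1/2 dominates for
    |x| < x0/2. For larger N, (F x - u 0)/x is the sum of the shifted series. *)
Lemma asy_series F u :
  near0 (fun x => series (fun n => u n * x ^+ n) @ \oo --> F x) -> asy F u.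
Proof.
move=> hF N; elim: N F u hF => [|N IH] F u hF.
  move: hF => [d d0 hF].
  pose x0 := d / 2; have x00 : 0 < x0 by rewrite divr_gt0.
  have x0d : `|x0| < d by rewrite gtr0_norm // /x0; lra.
  have /cvg_series_cvg_0 c0 : cvgn (series (fun n => u n * x0 ^+ n)).
    by apply/cvg_ex; exists (F x0); apply: hF; rewrite ?lt0r_neq0.
  have /cvg_seq_bounded [M [_ hM]] : cvgn (fun n => u n * x0 ^+ n).
    by apply/cvg_ex; exists 0.
  pose K := M + 1.
  have uK n : `|u n * x0 ^+ n| <= K by apply: hM => //; rewrite /K; lra.
  have K0 : 0 <= K by apply: le_trans (uK 0%N); exact: normr_ge0.
  exists (K * 2); exists (x0 / 2); first by rewrite divr_gt0.
  move=> x xn xd.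
  have xdd : `|x| < d by apply: lt_trans xd _; rewrite /x0; lra.
  have hx := hF x xn xdd.
  have geo m : \sum_(0 <= k < m) 2^-1 ^+ k = 2 - 2 * 2^-1 ^+ m :> R.
    elim: m => [|m IHm]; first by rewrite big_geq // expr0; lra.
    by rewrite big_nat_recr //= IHm exprS; field.
  apply: (cvgr_to_le (cvg_norm hx)).
  near=> n; rewrite /series /=.
  apply: le_trans (ler_norm_sum _ _ _) _.
  apply: (@le_trans _ _ (\sum_(0 <= k < n) K * (2^-1) ^+ k)).
    apply: ler_sum => k _.
    have -> : u k * x ^+ k = (u k * x0 ^+ k) * (x / x0) ^+ k.
      by rewrite -mulrA -exprMn [x0 * _]mulrCA divff ?lt0r_neq0 // mulr1.
    rewrite normrM; apply: ler_pM => //.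
    rewrite normrX; apply: lerXn2r; rewrite ?nnegrE //.
    by rewrite normrM normfV (gtr0_norm x00) ler_pdivrMr // mulrC ltW.
  rewrite -mulr_sumr ler_wpM2l //.
  rewrite geo.
  by rewrite gerBl mulr_ge0 // exprn_ge0.
exists (fun x => (F x - u 0%N) / x); split.
  exists 1 => // x x0 _; field; exact: x0.
apply: IH; move: hF => [d d0 hF]; exists d => // x x0 /(hF x x0) {}hF.
have -> : series (fun n => u n.+1 * x ^+ n) =
    (fun n => (series (fun n => u n * x ^+ n) n.+1 - u 0%N) * x^-1).
  apply/funext => n; rewrite /series /= big_nat_recl //= expr0 mulr1 addrAC subrr add0r mulr_suml.
  by apply: eq_bigr => k _; rewrite exprS; field.
apply: cvgM (cvg_cst x^-1); apply: cvgB (cvg_cst (u 0%N)).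
by move: hF; rewrite -cvg_shiftS.
Unshelve. all: by end_near. Qed.

Lemma asy_exp c : asy (fun x => expR (c * x)) (fun n => c ^+ n / n`!%:R).
Proof.
apply: asy_series; exists 1 => // x _ _.
have -> : (fun n => c ^+ n / n`!%:R * x ^+ n) = exp_coeff (c * x).
  by apply/funext => n; rewrite /exp_coeff /= exprMn mulrAC.
exact: is_cvg_series_exp_coeff.
Qed.

End AsymptoticSeries.

(** * Identities and zeros of Bernoulli polynomials *)

Section BernoulliFacts.
Variable R : realType.
Variable B : nat -> {poly R}.
Hypothesis hB : bernoulli_polynomials B.
Implicit Types (t x y beta : R).

Let F t x := x * expR (t * x) / (expR x - 1).

Let expB1 x : x != 0 -> expR x - 1 != 0.
Proof. by move=> x0; rewrite subr_eq0 -[1]expR0 (inj_eq (@expR_inj R)). Qed.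

Lemma asy_bern t : asy (F t) (bern B t).
Proof.
apply: asy_series; have := hB t.
rewrite /dnbhs near_withinE => /nbhs_ballP[d /= d0 h].
exists d => // x x0 xd.
have := h x; rewrite /ball /= sub0r normrN => /(_ xd x0).
suff -> : series (fun n => bern B t n * x ^+ n) =
  series (fun n => (B n).[t] * (x ^+ n / n`!%:R)) by [].
congr series; apply/funext => n; rewrite /bern; ring.
Qed.

Let asy_eq G H u : (forall x, x != 0 -> G x = H x) -> asy G u -> asy H u.
Proof. by move=> GH hG N; apply: asyN_ext (hG N); exists 1 => // x x0 _; exact: GH. Qed.

Let asy_X : asy (fun x : R => x) (fun n => (n == 1)%:R).
Proof.
apply: asy_series; exists 1 => // x _ _.
have key n : (1 < n)%N -> series (fun n => (n == 1%N)%:R * x ^+ n) n = x.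
  case: n => [|[|n]] // _; rewrite /series /= big_ltn // big_ltn // big_nat_cond big1.
    by rewrite /= expr1 mul0r mul1r add0r addr0.
  by move=> [|[|i]] // _; rewrite mul0r.
by apply: cvg_near_cst; exists 2%N => // n /= /key.
Qed.

(** From x = F(beta, x) (e^((1 - beta) x) - e^(-beta x)), where F is the generating function. *)
Lemma bern_bid beta : bern_identity B beta.
Proof.
have h : asy (fun x : R => x) (conv (bern B beta)
    (fun n => (1 - beta) ^+ n / n`!%:R + -1 * ((- beta) ^+ n / n`!%:R))).
  apply: (@asy_eq (fun x => F beta x * (expR ((1 - beta) * x) + -1 * expR (- beta * x)))).
    move=> x x0; have d0 := expB1 x0.
    have e1 : expR ((1 - beta) * x) = expR x * expR (- beta * x).
      by rewrite -expRD; congr expR; ring.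
    have e2 : expR (beta * x) * expR (- beta * x) = 1.
      by rewrite -expRD mulNr subrr expR0.
    rewrite e1 /F; transitivity (x * (expR (beta * x) * expR (- beta * x))).
      by field.
    by rewrite e2 mulr1.
  by move=> N; apply: asyN_M (asy_bern _ N) (asyN_D (asy_exp _ N) (asyN_Z _ (asy_exp _ N))).
have key q : \sum_(0 <= j < q.+1) bern B beta j *
    (((1 - beta) ^+ (q.+1 - j) - (- beta) ^+ (q.+1 - j)) / (q.+1 - j)`!%:R) = (q == 0%N)%:R.
  have := asy_uniq h asy_X q.+1; rewrite /conv eqSS => <-.
  rewrite [RHS]big_nat_recr //= subnn !expr0.
  have -> : 1 / 0`!%:R + -1 * (1 / 0`!%:R) = 0 :> R by ring.
  rewrite mulr0 addr0; apply: eq_big_nat => i _; ring.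
split=> //; have := key 0%N; rewrite big_nat1 subn0 !expr1.
move=> h0; transitivity (bern B beta 0 * ((1 - beta - - beta) / 1%:R)); last exact: h0.
by rewrite invr1 mulr1; ring.
Qed.

Lemma bern0 t : bern B t 0 = 1.
Proof. by case: (bern_bid t). Qed.

Lemma bern_add t y n :
  bern B (t + y) n = \sum_(0 <= i < n.+1) bern B t i * (y ^+ (n - i) / (n - i)`!%:R).
Proof.
apply: (asy_uniq (asy_bern _) (_ : asy _ (conv (bern B t) (fun n => y ^+ n / n`!%:R)))).
apply: (@asy_eq (fun x => F t x * expR (y * x))).
  by move=> x _; rewrite /F mulrDl expRD; ring.
by move=> N; apply: asyN_M (asy_bern _ N) (asy_exp _ N).
Qed.

(** From F(1 - t, x) = F(t, -x). *)
Lemma bern_refl t n : bern B (1 - t) n = (-1) ^+ n * bern B t n.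
Proof.
apply: (asy_uniq (asy_bern _) (_ : asy _ (fun n => (-1) ^+ n * bern B t n))).
apply: (@asy_eq (fun x => F t (- x))).
  move=> x x0; rewrite /F mulrBl mul1r expRD.
  have d0 := expB1 x0; have e0 : expR x != 0 by rewrite gt_eqF ?expR_gt0.
  rewrite !mulrN !expRN.
  have e1 : expR (t * x) != 0 by rewrite gt_eqF ?expR_gt0.
  have d1 : (expR x)^-1 - 1 != 0.
    by rewrite subr_eq0 -[1]invr1 (inj_eq invr_inj) -subr_eq0.
  by field; rewrite e1 e0 d0 /= mulN1r -oppr_eq0 opprB d0.
by move=> N; apply: asyN_opp (asy_bern _ N).
Qed.

(** From F(t + 1, x) - F(t, x) = x e^(t x). *)
Lemma bern_diff t n : bern B (t + 1) n.+1 = bern B t n.+1 + t ^+ n / n`!%:R.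
Proof.
have h : asy (fun x => x * expR (t * x)) (conv (fun n => (n == 1)%:R) (fun n => t ^+ n / n`!%:R)).
  by move=> N; apply: asyN_M (asy_X N) (asy_exp _ N).
have k : asy (fun x => x * expR (t * x)) (fun n => bern B (t + 1) n + -1 * bern B t n).
  apply: (@asy_eq (fun x => F (t + 1) x + -1 * F t x)).
    move=> x x0; rewrite /F mulrDl mul1r expRD; field; exact: expB1.
  by move=> N; apply: asyN_D (asy_bern _ N) (asyN_Z _ (asy_bern _ N)).
have := asy_uniq k h n.+1; rewrite /conv big_ltn // big_ltn // big_nat_cond big1.
  rewrite mul0r add0r eqxx mul1r addr0 subn1 /= => <-; ring.
by move=> [|[|i]] // _; rewrite mul0r.
Qed.

Lemma poly_inf_roots (K : idomainType) (p : {poly K}) (v : nat -> K) :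
  injective v -> (forall n, root p (v n)) -> p = 0.
Proof.
move=> vi hv; apply/eqP; apply: contraT => p0.
have := max_poly_roots (rs := map v (iota 0 (size p))) p0.
rewrite map_inj_uniq // iota_uniq size_map size_iota ltnn => -> //.
by apply/allP => _ /mapP[n _ ->].
Qed.

Let pb n : {poly R} := (n`!%:R)^-1 *: B n.

Let pbE n t : (pb n).[t] = bern B t n.
Proof. by rewrite /pb hornerZ mulrC. Qed.

(** [bern_add] at the natural numbers identifies the translate by t with an explicit polynomial
    whose linear coefficient is [bern B t n]. *)
Lemma bern_deriv n t : (pb n.+1)^`().[t] = bern B t n.
Proof.
pose q : {poly R} := \sum_(0 <= i < n.+2) (bern B t i / (n.+1 - i)`!%:R) *: 'X^(n.+1 - i).
have e : pb n.+1 \Po ('X + t%:P) - q = 0.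
  apply: (@poly_inf_roots _ _ (fun m : nat => m%:R)).
    by move=> i j /eqP; rewrite eqr_nat => /eqP.
  move=> m; rewrite rootE hornerD hornerN horner_comp [('X + _).[_]]hornerD hornerX hornerC pbE.
  rewrite [m%:R + t]addrC bern_add horner_sum subr_eq0; apply/eqP.
  by apply: eq_bigr => i _; rewrite hornerZ hornerXn; ring.
move/eqP: e; rewrite subr_eq0 => /eqP e.
have := congr1 (fun p => (deriv p).[0]) e.
rewrite /= deriv_comp hornerM horner_comp !hornerE derivD derivX derivC !hornerE => ->.
rewrite /q raddf_sum horner_sum /= big_nat_recr //= big_nat_recr //=.
rewrite subnn subSnn !derivZ !derivXn !hornerE.
rewrite big_nat_cond big1 ?add0r.
  by rewrite divr1.
move=> i /andP[/andP[_ ni] _].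
rewrite derivZ derivXn hornerZ hornerMn hornerXn.
have -> : (n.+1 - i).-1 = (n - i).-1.+1 by lia.
by rewrite exprS mul0r mul0rn mulr0.
Qed.

Let mvt n x y : x < y -> exists2 c, x < c < y & bern B y n.+1 - bern B x n.+1 = bern B c n * (y - x).
Proof.
move=> /(@poly_mvt _ _ _ (pb n.+1))[c]; rewrite in_itv /= => hc.
by rewrite !pbE bern_deriv => e; exists c.
Qed.

Lemma bern_odd0 n : odd n -> (1 < n)%N -> bern B 0 n = 0.
Proof.
case: n => [|[|n]] // on _.
have := bern_refl 0 n.+2; rewrite subr0 -signr_odd on expr1 mulN1r.
have := bern_diff 0 n.+1; rewrite add0r expr0n mul0r addr0 => ->.
lra.
Qed.

Lemma bern_odd_half n : odd n -> bern B 2^-1 n = 0.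
Proof.
move=> on; have := bern_refl 2^-1 n; rewrite -signr_odd on expr1 mulN1r.
have -> : 1 - 2^-1 = 2^-1 :> R by lra.
lra.
Qed.

Let f0 : 0`!%:R = 1 :> R. Proof. by []. Qed.
Let f1 : 1`!%:R = 1 :> R. Proof. by []. Qed.
Let f2 : 2`!%:R = 2 :> R. Proof. by []. Qed.
Let f3 : 3`!%:R = 6 :> R. Proof. by []. Qed.

Lemma bern1 t : bern B t 1 = t - 2^-1.
Proof.
have b1 : bern B 0 1 = - 2^-1.
  have h1 := bern_diff 0 1; have h2 := bern_add 0 1 2.
  move: h1 h2; rewrite add0r => ->; rewrite !big_nat_recr //= big_geq // bern0 !expr1n.
  rewrite ?expr0n ?subSS ?subn0 ?subnn /= ?f0 ?f1 ?f2 add0r mul1r.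
  by move=> h; lra.
have := bern_add 0 t 1; rewrite add0r => ->.
rewrite !big_nat_recr //= big_geq // bern0 b1 ?subSS ?subn0 ?subnn ?f0 ?f1 expr1 expr0 add0r.
by field.
Qed.

(** Induction on k. In odd degree above 1 the values at 0 and 1/2 vanish, so a wrong sign at x
    gives, by the mean value theorem, opposite weak signs of the even polynomial below at points on
    either side of x, and between these a point violating the sign of the preceding odd one. *)
Lemma bern_sign k x : 0 < x < 2^-1 -> 0 < (-1) ^+ k.+1 * bern B x k.*2.+1.
Proof.
elim: k x => [|k IH] x /andP[x0 x1]; first by rewrite bern1 expr1; lra.
rewrite ltNge; apply/negP => gx.
have [c1 /andP[c10 c11]] := mvt k.+1.*2 x0.
have [c2 /andP[c20 c21]] := mvt k.+1.*2 x1.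
have o3 : odd k.+1.*2.+1 by rewrite /= odd_double.
rewrite (bern_odd_half o3) (bern_odd0 o3) // subr0 sub0r => e2 e1.
have [c3 /andP[c30 c31]] := mvt k.*2.+1 (lt_trans c11 c20).
rewrite -doubleS => e3.
have := IH c3; have -> : 0 < c3 < 2^-1 by apply/andP; split; lra.
move=> /(_ isT); move: gx e1 e2 e3; rewrite [(-1) ^+ k.+2]exprS.
have [->|->] : (-1) ^+ k.+1 = 1 :> R \/ (-1) ^+ k.+1 = -1 :> R.
  by rewrite -signr_odd; case: (odd _); [right|left].
- set u := bern B x _; set v1 := bern B c1 _; set v2 := bern B c2 _; set w := bern B c3 _.
  move=> gx e1 e2 e3 hw.
  have p1 : 0 <= v1 by rewrite -(pmulr_lge0 _ x0); lra.
  have p2 : v2 <= 0 by have : 0 < 2^-1 - x by [lra]; nra.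
  have : 0 < w * (c2 - c1) by rewrite mulr_gt0 //; lra.
  lra.
set u := bern B x _; set v1 := bern B c1 _; set v2 := bern B c2 _; set w := bern B c3 _.
move=> gx e1 e2 e3 hw.
have p1 : v1 <= 0 by nra.
have p2 : 0 <= v2 by have : 0 < 2^-1 - x by [lra]; nra.
have : w * (c2 - c1) < 0 by rewrite nmulr_rlt0 //; lra.
lra.
Qed.

Lemma bern_odd_neq0 n x : odd n -> 0 < x < 2^-1 -> bern B x n != 0.
Proof.
move=> on /(bern_sign n./2); have -> : n./2.*2.+1 = n by rewrite -[in RHS](odd_double_half n) on.
by apply: contraTneq => ->; rewrite mulr0 ltxx.
Qed.

(** The odd polynomial of the next degree vanishes at 0 and 1/2, so the even one has a zero between.
    A further zero at 0 or 1/2 would give the preceding odd one a zero inside (0, 1/2). *)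
Lemma bern_even_neq0 m : ~~ odd m -> bern B 0 m != 0 /\ bern B 2^-1 m != 0.
Proof.
case: m => [|[|m]] // em; first by rewrite !bern0 oner_eq0.
have om : odd m.+1 by move: em; rewrite /= negbK.
have h0 : (0 : R) < 2^-1 by lra.
have [c /andP[c0 c1]] := mvt m.+2 h0.
have o3 : odd m.+3 by rewrite -addn2 oddD om.
rewrite (bern_odd_half o3) (bern_odd0 o3) // subrr => /esym/eqP.
rewrite mulf_eq0 => /orP[/eqP bc|]; last by lra.
have [c2 /andP[c20 c21] e2] := mvt m.+1 c0.
have [c3 /andP[c30 c31] e3] := mvt m.+1 c1.
have n2 : bern B c2 m.+1 != 0 by apply: bern_odd_neq0 => //; apply/andP; split; lra.
have n3 : bern B c3 m.+1 != 0 by apply: bern_odd_neq0 => //; apply/andP; split; lra.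
split; apply: contra_neq n2 => b0 || apply: contra_neq n3 => b0.
  by apply: (mulIf (lt0r_neq0 c0)); move: e2; rewrite bc b0 !subr0 mul0r.
have : bern B c3 m.+1 * (2^-1 - c) = 0 by rewrite -e3 bc b0 subrr.
by move/eqP; rewrite mulf_eq0 (negPf n3) /= subr_eq0 gt_eqF.
Qed.

(** On [0, 1) roots in odd degree can only be 0 and 1/2, where even degrees do not vanish. *)
Lemma bern_odd_root n m x : 0 <= x < 1 -> odd n -> bern B x n = 0 -> ~~ odd m ->
  bern B x m != 0.
Proof.
move=> /andP[x0 x1] on bx em; have [b0 b1] := bern_even_neq0 em.
have [->//|xn0] := eqVneq x 0; have [->//|xn2] := eqVneq x 2^-1.
have xp : 0 < x by rewrite lt0r xn0.
case: (ltgtP x 2^-1) xn2 => // hx _.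
  by have := bern_odd_neq0 on (_ : 0 < x < 2^-1); rewrite bx eqxx xp hx => /(_ isT).
have hx' : 0 < 1 - x < 2^-1 by apply/andP; split; lra.
by have := bern_odd_neq0 on hx'; rewrite bern_refl bx mulr0 eqxx.
Qed.

(** The cases k = l and k = 0 make both values in degree l vanish. As b2 lies in [0, 1) and l, l - 1
    have opposite parities, the value at b2 in degree l - 1 is nonzero, and k = 1 forces B_1(b1) =
    0. *)
Let half_of_prod b1 b2 l : 0 <= b2 < 1 ->
  (forall k, (k <= l)%N -> bern B b1 k * bern B b2 (l - k) = 0) -> b1 = 2^-1.
Proof.
move=> b2i H.
have z1 : bern B b1 l = 0 by have := H l (leqnn l); rewrite subnn bern0 mulr1.
have z2 : bern B b2 l = 0 by have := H 0%N isT; rewrite subn0 bern0 mul1r.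
have l0 : (0 < l)%N by case: (l) z1 => // /eqP; rewrite bern0 oner_eq0.
suff : bern B b2 (l - 1) != 0.
  move=> n2; have := H 1%N l0 => /eqP; rewrite mulf_eq0 (negPf n2) orbF bern1.
  by rewrite subr_eq0 => /eqP.
case ol : (odd l).
  by apply: (bern_odd_root b2i ol z2); rewrite oddB // ol.
apply/eqP => z; have := bern_odd_root b2i (_ : odd (l - 1)) z (_ : ~~ odd l).
by rewrite z2 eqxx oddB // ol => /(_ isT isT).
Qed.

Let bern_neg123 y : 0 < y -> [/\ bern B (- y) 1 != 0, bern B (- y) 2 != 0 & bern B (- y) 3 != 0].
Proof.
move=> y0.
have b1 : bern B 0 1 = - 2^-1 by rewrite bern1 sub0r.
have b2 : bern B 0 2 = 12^-1.
  have h1 := bern_diff 0 2; have h2 := bern_add 0 1 3.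
  move: h1 h2; rewrite add0r => ->; rewrite !big_nat_recr //= big_geq // bern0 b1 !expr1n.
  rewrite ?expr0n ?subSS ?subn0 ?subnn /= ?f0 ?f1 ?f2 ?f3 add0r ?mul0r.
  by move=> h; lra.
have b3 : bern B 0 3 = 0 by exact: bern_odd0.
split.
- by rewrite bern1 ltr0_neq0 //; lra.
- have := bern_add 0 (- y) 2; rewrite add0r !big_nat_recr //= big_geq // => ->.
  rewrite bern0 b1 b2 ?subSS ?subn0 ?subnn /= ?f0 ?f1 ?f2 expr2 expr1 expr0 add0r.
  by rewrite gt_eqF //; nra.
have := bern_add 0 (- y) 3; rewrite add0r !big_nat_recr //= big_geq // => ->.
rewrite bern0 b1 b2 b3 ?subSS ?subn0 ?subnn /= ?f0 ?f1 ?f2 ?f3 !exprS expr0 add0r.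
rewrite lt_eqF //.
have : 0 < y * y by rewrite mulr_gt0.
have : 0 < y * (y * y) by rewrite !mulr_gt0.
by move=> h1 h2; lra.
Qed.

(* If beta < 0, the four consecutive values at l, .., l - 3 would all vanish, so
   that B_n(-beta) < 0 for two consecutive odd n, contradicting the alternation
   of signs of the odd Bernoulli polynomials. *)
Lemma bern_nonvanish a1 a2 a3 l : 0 <= a1 < 1 -> 0 <= a2 < 1 -> 0 <= a3 < 1 ->
  exists2 k, (k <= l)%N & bern B (a2 - a1) k * bern B (a3 - a2) (l - k) != 0.
Proof.
move=> /andP[a10 a11] /andP[a20 a21] /andP[a30 a31]; apply: contrapT => H0.
set b1 := a2 - a1 in H0; set b2 := a3 - a2 in H0.
have H k : (k <= l)%N -> bern B b1 k * bern B b2 (l - k) = 0.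
  by move=> kl; apply/eqP; apply: contrapT => /negP n; apply: H0; exists k.
have H' k : (k <= l)%N -> bern B b2 k * bern B b1 (l - k) = 0.
  by move=> kl; have := H (l - k)%N (leq_subr _ _); rewrite subKn // mulrC.
(* If b2 >= 0, then b1 = b2 = 1/2, whence a3 - a1 = 1, which is excluded. *)
case: (lerP 0 b2) => hb2.
  have e1 : b1 = 2^-1 by apply: (half_of_prod _ H); rewrite /b2 in hb2 *; lra.
  have e2 : b2 = 2^-1 by apply: (half_of_prod _ H'); rewrite e1; lra.
  by move: e1 e2; rewrite /b1 /b2; lra.
(* If b1 >= 0, then b2 = 1/2, against b2 < 0. *)
case: (lerP 0 b1) => hb1.
  have e2 : b2 = 2^-1 by apply: (half_of_prod _ H'); rewrite /b1 in hb1 *; lra.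
  by move: hb2; rewrite e2; lra.
pose y := - b1; have y0 : 0 < y by rewrite oppr_gt0.
have y1 : y < 1 by rewrite /y /b1; lra.
have [u1 u2 u3] := bern_neg123 y0.
have y20 : 0 < - b2 by rewrite oppr_gt0.
have [v1 v2 v3] := bern_neg123 y20; rewrite opprK in v1 v2 v3.
rewrite /y opprK in u1 u2 u3.
have z0 : bern B b1 l = 0 by have := H l (leqnn l); rewrite subnn bern0 mulr1.
have l4 : (3 < l)%N.
  case: l z0 {H H' H0} => [|[|[|[|]]]] // /eqP; first by rewrite bern0 oner_eq0.
  - by rewrite (negPf u1).
  - by rewrite (negPf u2).
  - by rewrite (negPf u3).
have z j : (j <= 3)%N -> bern B b1 (l - j) = 0.
  move=> j3; have := H (l - j)%N (leq_subr _ _); rewrite subKn ?(leq_trans j3) ?(ltnW l4) //.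
  case: j j3 => [|[|[|[|]]]] // _; rewrite ?subn0 ?z0 //; move/eqP.
  - by rewrite mulf_eq0 (negPf v1) orbF => /eqP.
  - by rewrite mulf_eq0 (negPf v2) orbF => /eqP.
  - by rewrite mulf_eq0 (negPf v3) orbF => /eqP.
(* As -y = 1 - (y + 1), reflection moves the zero to y + 1, and the difference equation gives B_n(y)
   = -n y^(n-1) for n = l - j. *)
have neg j : (j <= 3)%N -> odd (l - j) -> bern B y (l - j) < 0.
  move=> j3 oj; have := z _ j3; have -> : b1 = 1 - (y + 1) by rewrite /y; ring.
  have lj : (0 < l - j)%N by rewrite subn_gt0 (leq_ltn_trans j3).
  rewrite bern_refl; case: (l - j)%N lj => // i _.
  rewrite bern_diff => /eqP; rewrite mulf_eq0 signr_eq0 /= addr_eq0 => /eqP ->.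
  by rewrite oppr_lt0 divr_gt0 ?exprn_gt0 // ltr0n fact_gt0.
(* Among l, l - 1, l - 2, l - 3 there are two consecutive odd numbers. *)
have [k [n1 n2]] : exists k, bern B y k.*2.+1 < 0 /\ bern B y k.+1.*2.+1 < 0.
  case ol : (odd l).
    exists (l - 2)./2.
    have e : (l - 2)./2.*2.+1 = (l - 2)%N.
      by rewrite -[RHS](odd_double_half (l - 2)) oddB ?(ltnW (ltnW l4)) // ol.
    have e' : ((l - 2)./2.+1.*2.+1 = l - 0)%N.
      by rewrite doubleS e subn0; case: (l) l4 => [|[|?]] //; rewrite !subSS subn0.
    by rewrite e' e; split; apply: neg; rewrite ?subn0 // oddB ?(ltnW (ltnW l4)) // ol.
  exists (l - 3)./2.
  have e : (l - 3)./2.*2.+1 = (l - 3)%N.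
    by rewrite -[RHS](odd_double_half (l - 3)) oddB ?(ltnW l4) // ol.
  have e' : ((l - 3)./2.+1.*2.+1 = l - 1)%N.
    by rewrite doubleS e; case: (l) l4 => [|[|[|?]]] //; rewrite !subSS !subn0.
  have l1 : (1 <= l)%N by exact: leq_trans l4.
  have o1 : odd (l - 1) by rewrite oddB // ol.
  have o3 : odd (l - 3) by rewrite oddB ?(ltnW l4) // ol.
  by rewrite e' e; split; apply: neg.
have sg x : 0 < x < 2^-1 -> bern B x k.*2.+1 * bern B x k.+1.*2.+1 < 0.
  move=> hx; have := bern_sign k hx; have := bern_sign k.+1 hx.
  rewrite [(-1) ^+ k.+2]exprS.
  have [->|->] : (-1) ^+ k.+1 = 1 :> R \/ (-1) ^+ k.+1 = -1 :> R.
    by rewrite -signr_odd; case: (odd _); [right|left].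
  - rewrite mulr1 mul1r mulN1r oppr_gt0 => h1 h2; by rewrite pmulr_rlt0.
  - rewrite mulrNN !mul1r mulN1r oppr_gt0 => h1 h2; by rewrite nmulr_rlt0.
have ok : odd k.*2.+1 by rewrite /= odd_double.
have ok' : odd k.+1.*2.+1 by rewrite /= odd_double.
case: (ltgtP y 2^-1) => hy.
- by have := sg y; rewrite y0 hy => /(_ isT); rewrite nmulr_rlt0 // ltNge ltW.
- have := sg (1 - y); have -> : 0 < 1 - y < 2^-1 by apply/andP; split; lra.
  have ro n : odd n -> bern B (1 - y) n = - bern B y n.
    by move=> on; rewrite bern_refl -signr_odd on expr1 mulN1r.
  move=> /(_ isT); rewrite (ro _ ok) (ro _ ok') mulrNN.
  by rewrite nmulr_rlt0 // ltNge ltW.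
by move: n1; rewrite hy bern_odd_half // ltxx.
Qed.

End BernoulliFacts.

(** * Continuation by regularised states *)

Section PointwiseSystem.
Variable R : realType.
Local Notation C := (Cplx R).
Implicit Types (B : nat -> {poly R}) (a : nat -> R) (s lam : nat -> C) (mu : nat -> nat -> C).

Lemma climZ (k : C) (u : nat -> C) : k != 0 -> clim (fun n => k * u n) = k * clim u.
Proof.
move=> k0; rewrite {2}/clim; case: xgetP => [z _ /= uz|nu]; first exact/climE/ctendsZ.
rewrite mulr0 /clim; case: xgetP => [z _ /= uz|//].
case: (nu (k^-1 * z)) => /=.
by apply: ctends_ext (ctendsZ k^-1 uz) => n; rewrite mulKf.
Qed.

Lemma clim_eq0 (u : nat -> C) : (forall n, u n = 0) -> clim u = 0.
Proof. by move=> u0; apply: climE; apply: ctends_ext (ctends_cst 0) => n; rewrite u0. Qed.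

Lemma cpow_lim0 (b : R) (z : C) : complex.Re z < 0 -> 0 <= b ->
  ctends (fun n => cpow (n%:R + b) z) 0.
Proof.
move=> z0 b0; apply/(ctends_shift _ _ 1) => e e0.
set rho := - complex.Re z; have r0 : 0 < rho by rewrite oppr_gt0.
pose M := Num.truncn (expR (- ln e / rho)).
exists M.+1 => n nM; rewrite subr0 normc_cpow -[ltRHS]lnK ?posrE // ltr_expR.
have n0 : (0 < n + 1)%N by rewrite addn1.
have x0 : 0 < (n + 1)%:R + b by rewrite ltr_wpDr // ltr0n.
have : - ln e / rho < ln ((n + 1)%:R + b).
  rewrite -[ltLHS]expRK ltr_ln ?posrE ?expR_gt0 //.
  apply: (@lt_le_trans _ _ M.+1%:R); first exact: truncnS_gt.
  by apply: ler_wpDr => //; rewrite ler_nat; lia.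
rewrite ltr_pdivrMr // /rho; lra.
Qed.

Definition lam1 : nat -> C := fun=> 1.
Definition mu1 (s : nat -> C) (i l : nat) : C := (l%:R - ee s i.+1)^-1.

Lemma Gsum_scale N b (e : C) (c c' : nat -> C) (k : C) n :
  (forall j, (j < N)%N -> c j = k * c' j) -> Gsum N b e c n = k * Gsum N b e c' n.
Proof.
move=> cc'; rewrite /Gsum mulr_sumr; apply: eq_big_nat => j /andP[_ jN].
by rewrite cc' // mulrA.
Qed.

Lemma cnext_scale B beta (e lam : C) (mu mu' c c' : nat -> C) (k : C) N l : (l < N)%N ->
  (forall j, (j < N)%N -> c j = k * c' j) -> mu l * c' l = lam * (mu' l * c' l) ->
  cnext B beta e lam mu c l = k * lam * cnext B beta e 1 mu' c' l.
Proof.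
move=> lN cc' mul; rewrite /cnext mul1r cc' // mulrCA mul mulrDr -mulrA; congr (_ + _); last by ring.
rewrite mulrCA; congr (_ * _); rewrite mulr_sumr; apply: eq_big_nat => j /andP[_ jl].
by rewrite cc' ?mulrA // (ltn_trans jl).
Qed.

Lemma RRS B a N lam mu s i n : RR B a N lam mu s i.+1 n = clim (fun K => \sum_(n <= j < K)
  Rterm N (a i) (a i.+1) (ee s i) (ee s i.+1) (s i) (lam i) (cc B a lam mu s i)
     (cc B a lam mu s i.+1) (RR B a N lam mu s i) j).
Proof. by []. Qed.

Lemma ccS B a lam mu s i l : cc B a lam mu s i.+1 l =
  cnext B (a i.+1 - a i) (ee s i.+1) (lam i) (mu i) (cc B a lam mu s i) l.
Proof. by []. Qed.

(** The recursion is homogeneous, so a level scales by the product of the factors before it. The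
    condition on [mu] is weighted by the coefficient, hence void wherever the coefficient
    vanishes. *)
Lemma system_scale B a N m s lam mu :
  (forall i, (i < m)%N -> lam i != 0) ->
  (forall i l, (i < m)%N -> (l < N)%N ->
    mu i l * cc B a lam1 (mu1 s) s i l = lam i * (mu1 s i l * cc B a lam1 (mu1 s) s i l)) ->
  forall i, (i <= m)%N ->
  (forall l, (l < N)%N -> cc B a lam mu s i l =
      (\prod_(0 <= j < i) lam j) * cc B a lam1 (mu1 s) s i l) /\
  (forall n, RR B a N lam mu s i n =
      (\prod_(0 <= j < i) lam j) * RR B a N lam1 (mu1 s) s i n).
Proof.
move=> lam0 mul; elim=> [_|i IH im].
  by rewrite big_geq //; split=> *; rewrite mul1r.
have [hc hR] := IH (ltnW im).
have p0 : \prod_(0 <= j < i.+1) lam j != 0.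
  rewrite prodf_seq_neq0; apply/allP => j; rewrite mem_index_iota => /andP[_ ji] /=.
  by apply/lam0/(leq_trans ji).
have E : \prod_(0 <= j < i.+1) lam j = (\prod_(0 <= j < i) lam j) * lam i.
  by rewrite big_nat_recr.
have hc' l : (l < N)%N -> cc B a lam mu s i.+1 l =
    \prod_(0 <= j < i.+1) lam j * cc B a lam1 (mu1 s) s i.+1 l.
  by move=> lN; rewrite E; exact: (cnext_scale _ _ _ lN hc (mul _ _ im lN)).
split=> // n; rewrite RRS.
transitivity (clim (fun K => \prod_(0 <= j < i.+1) lam j * \sum_(n <= j < K)
    Rterm N (a i) (a i.+1) (ee s i) (ee s i.+1) (s i) 1 (cc B a lam1 (mu1 s) s i)
     (cc B a lam1 (mu1 s) s i.+1) (RR B a N lam1 (mu1 s) s i) j)); last exact: climZ.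
apply: clim_ext => K; rewrite mulr_sumr; apply: eq_bigr => j _.
rewrite /Rterm /Ebr (Gsum_scale _ _ _ hc) !(Gsum_scale _ _ _ hc') hR E.
by ring.
Qed.

Lemma TT_scale B a N m s lam mu :
  (forall i, (i < m)%N -> lam i != 0) ->
  (forall i l, (i < m)%N -> (l < N)%N ->
    mu i l * cc B a lam1 (mu1 s) s i l = lam i * (mu1 s i l * cc B a lam1 (mu1 s) s i l)) ->
  forall n, TT B a N lam mu s m n = (\prod_(0 <= j < m) lam j) * TT B a N lam1 (mu1 s) s m n.
Proof.
move=> lam0 mul n; have [hc hR] := system_scale lam0 mul (leqnn m).
by rewrite /TT (Gsum_scale _ _ _ hc) hR mulrDr.
Qed.

Lemma Gsum_recr N b (e : C) (c : nat -> C) n :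
  Gsum N.+1 b e c n = Gsum N b e c n + c N * cpow (n%:R + b) (e - N%:R).
Proof. by rewrite /Gsum big_nat_recr. Qed.

Lemma Rterm_sum B a N s i n K : (n <= K)%N ->
  \sum_(n <= j < K) Rterm N (a i) (a i.+1) (ee s i) (ee s i.+1) (s i) 1
     (cc B a lam1 (mu1 s) s i) (cc B a lam1 (mu1 s) s i.+1) (RR B a N lam1 (mu1 s) s i) j =
  \sum_(n <= j < K) (cpow (j.+1%:R + a i) (s i))^-1 * TT B a N lam1 (mu1 s) s i j.+1
   - Gsum N (a i.+1) (ee s i.+1) (cc B a lam1 (mu1 s) s i.+1) n
   + Gsum N (a i.+1) (ee s i.+1) (cc B a lam1 (mu1 s) s i.+1) K.
Proof.
elim: K => [|K IH] nK.
  by move: nK; rewrite leqn0 => /eqP ->; rewrite !big_geq //; ring.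
move: nK; rewrite leq_eqVlt => /predU1P[->|nK]; first by rewrite !big_geq //; ring.
rewrite !big_nat_recr //= IH // /Rterm /Ebr /TT.
by ring.
Qed.

Lemma TT0 B a N s n : TT B a N lam1 (mu1 s) s 0 n = 1.
Proof.
rewrite /TT /=; case: N => [|N]; first by rewrite /Gsum big_geq // add0r.
rewrite addr0 /Gsum big_ltn // big_nat_cond big1 => [|[|k]] //; last by rewrite mul0r.
by rewrite /ee big_geq // !subr0 cpow0 mul1r addr0.
Qed.

(** Raising N moves the term of index N from the remainder to the finite sum; its boundary value at
    infinity is 0 because Re e < N. *)
Lemma TT_succN B a N m s : (forall i, 0 <= a i) ->
  (forall i n, (i < m)%N -> exists z, ctends (fun K => \sum_(n <= j < K)
    Rterm N (a i) (a i.+1) (ee s i) (ee s i.+1) (s i) 1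
     (cc B a lam1 (mu1 s) s i) (cc B a lam1 (mu1 s) s i.+1) (RR B a N lam1 (mu1 s) s i) j) z) ->
  (forall i, (i < m)%N -> complex.Re (ee s i.+1) < N%:R) ->
  forall i, (i <= m)%N -> forall n,
    TT B a N.+1 lam1 (mu1 s) s i n = TT B a N lam1 (mu1 s) s i n.
Proof.
move=> a0 hcv hN; elim=> [_ n|i IH im n]; first by rewrite !TT0.
have [z hz] := hcv i n im.
have RN : RR B a N lam1 (mu1 s) s i.+1 n = z by rewrite RRS; exact: climE.
set g := fun n => cc B a lam1 (mu1 s) s i.+1 N * cpow (n%:R + a i.+1) (ee s i.+1 - N%:R).
have RN1 : RR B a N.+1 lam1 (mu1 s) s i.+1 n = z - g n.
  rewrite RRS; apply: climE.
  have g0 : ctends g 0.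
    rewrite -(mulr0 (cc B a lam1 (mu1 s) s i.+1 N)).
    by apply/ctendsZ/cpow_lim0 => //; rewrite Re_natB subr_lt0; exact: hN.
  have := ctendsD (ctendsD hz (ctends_cst (- g n))) g0; rewrite addr0.
  apply: (@ctends_near _ _ _ _ n) => K nK; rewrite !Rterm_sum // !Gsum_recr -/(g K) -/(g n).
  under [in RHS]eq_bigr do rewrite IH ?(ltnW im) //.
  by ring.
by rewrite /TT RN RN1 Gsum_recr -/(g n); ring.
Qed.

Lemma sum_drop (F : nat -> C) l N : (l <= N)%N -> (forall k, (k < l)%N -> F k = 0) ->
  \sum_(0 <= k < N) F k = \sum_(0 <= k < N - l) F (k + l)%N.
Proof.
move=> lN F0; rewrite (@big_cat_nat _ _ _ l) //= big_nat_cond big1 ?add0r.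
  by rewrite -{1}[l]add0n big_addn.
by move=> k /andP[/andP[_ kl] _]; exact: F0.
Qed.

Lemma ee_shift s i d : ee s (i + d) = ee s i + ee (fun j => s (i + j)%N) d.
Proof.
rewrite /ee (@big_cat_nat _ _ _ i) ?leq_addr //= natrD.
have -> : \sum_(i <= j < i + d) s j = \sum_(0 <= j < d) s (i + j)%N.
  rewrite -{1}(add0n i) big_addn addKn; apply: eq_bigr => j _; congr s; exact: addnC.
by ring.
Qed.

(* On the hyperplane ee s i0.+1 = l, the regularised state at level i0.+1 is the
   initial state scaled by cc i0 l, with coefficient indices shifted by l. *)
Lemma system_residue B a N s lam mu i0 l m :
  ee s i0.+1 = l%:R -> (l < N)%N -> lam i0 = 0 ->
  (forall k, (k < N)%N -> mu i0 k = (k == l)%:R) ->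
  (forall i, (i0 < i < m)%N -> lam i = 1) ->
  (forall i k, (i0 < i < m)%N -> (k < N)%N -> mu i k = mu1 s i k) ->
  cc B a lam mu s i0 l != 0 ->
  let a' j := a (i0.+1 + j)%N in let s' j := s (i0.+1 + j)%N in
  forall d, (i0.+1 + d <= m)%N ->
  (forall k, (k < N)%N -> cc B a lam mu s (i0.+1 + d) k =
     if (l <= k)%N then cc B a lam mu s i0 l * cc B a' lam1 (mu1 s') s' d (k - l) else 0) /\
  (forall n, RR B a N lam mu s (i0.+1 + d) n =
     cc B a lam mu s i0 l * RR B a' (N - l) lam1 (mu1 s') s' d n).
Proof.
move=> el lN lam0 mu0 lam1' mu1' c0 a' s'; set c := cc B a lam mu s i0 l.
have ed d : ee s (i0.+1 + d) = l%:R + ee s' d by rewrite ee_shift el.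
have Gs d n : (forall k, (k < N)%N -> cc B a lam mu s (i0.+1 + d) k =
     if (l <= k)%N then c * cc B a' lam1 (mu1 s') s' d (k - l) else 0) ->
   Gsum N (a (i0.+1 + d)%N) (ee s (i0.+1 + d)) (cc B a lam mu s (i0.+1 + d)) n =
   c * Gsum (N - l) (a' d) (ee s' d) (cc B a' lam1 (mu1 s') s' d) n.
  move=> hc; rewrite /Gsum (sum_drop (ltnW lN)); last first.
    by move=> k kl; rewrite hc ?(ltn_trans kl) // leqNgt kl mul0r.
  rewrite mulr_sumr; apply: eq_big_nat => k /andP[_ kN]; rewrite hc; last by lia.
  rewrite leq_addl addnK ed natrD -mulrA; congr (_ * (_ * cpow _ _)); ring.
elim=> [_|d IH dm].
  (* At the initial level lam = 0 kills the sum over lower coefficients and [mu] selects the index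
     l. *)
  rewrite addn0; have hc k : (k < N)%N -> cc B a lam mu s i0.+1 k =
      if (l <= k)%N then c * cc B a' lam1 (mu1 s') s' 0 (k - l) else 0.
    move=> kN; rewrite ccS /cnext lam0 mul0r add0r mu0 //.
    have [->|kl] := eqVneq k l; first by rewrite leqnn subnn mul1r mulr1.
    rewrite mul0r; case: leqP => // lk.
    by rewrite [cc B a' _ _ _ 0 _]/= subn_eq0 leqNgt ltn_neqAle eq_sym kl lk mulr0.
  split=> // n; rewrite RRS [RR _ _ _ _ _ _ 0]/= subn_eq0 leqNgt lN mulr0.
  apply: clim_eq0 => K; rewrite big1 // => j _.
  rewrite /Rterm /Ebr lam0 !mul0r !subr0 sub0r.
  (* With e = l the finite sum is the constant c, so its differences vanish and the remainder is
     0. *)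
  have Gs0 n' : Gsum N (a i0.+1) (ee s i0.+1) (cc B a lam mu s i0.+1) n' = c.
    have := Gs 0%N n'; rewrite !addn0 => -> //.
    rewrite /Gsum big_ltn ?subn_gt0 // big_nat_cond big1 => [|[|k]] //; last by rewrite mul0r.
    by rewrite /ee big_geq // !subr0 cpow0 mul1r addr0 mulr1.
  by rewrite !Gs0 subrr oppr0.
have dm' : (i0.+1 + d <= m)%N by rewrite (leq_trans _ dm) // addnS leqW.
have [hc hR] := IH dm'.
have ilt : (i0 < i0.+1 + d < m)%N by rewrite addSn ltnS leq_addr /= -addSn -addnS.
have hc' k : (k < N)%N -> cc B a lam mu s (i0.+1 + d).+1 k =
     if (l <= k)%N then c * cc B a' lam1 (mu1 s') s' d.+1 (k - l) else 0.
  move=> kN; rewrite ccS /cnext lam1' // mul1r mu1' // hc //.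
  have E : 1 - ee s (i0.+1 + d).+1 = 1 - ee s' d.+1 - l%:R by rewrite -addnS ed; ring.
  case: leqP => lk; last first.
    rewrite mulr0 addr0 big_nat_cond big1 // => j /andP[/andP[_ jk] _].
    by rewrite hc ?(ltn_trans jk) // leqNgt (ltn_trans jk) // mul0r.
  rewrite ccS /cnext mulrDr mul1r; congr (_ + _); last first.
    rewrite mulrCA; congr (_ * (_ * _)); rewrite /mu1 -addnS ed natrB //; congr (_^-1); ring.
  rewrite (sum_drop lk); last first.
    by move=> j jl; rewrite hc ?(ltn_trans jl) // leqNgt jl mul0r.
  rewrite mulr_sumr; apply: eq_big_nat => j /andP[_ jk]; rewrite hc; last by rewrite (leq_trans _ kN) //; lia.
  rewrite leq_addl addnK -mulrA; congr (_ * (_ * _)).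
  have -> : (k - (j + l))%N = (k - l - j)%N by lia.
  rewrite E natrD; congr (bern_coef _ _ _ _); first by rewrite /a' addnS.
  by ring.
rewrite addnS; split=> // n; rewrite RRS.
transitivity (clim (fun K => c * \sum_(n <= j < K)
    Rterm (N - l) (a' d) (a' d.+1) (ee s' d) (ee s' d.+1) (s' d) 1 (cc B a' lam1 (mu1 s') s' d)
     (cc B a' lam1 (mu1 s') s' d.+1) (RR B a' (N - l) lam1 (mu1 s') s' d) j)); last exact: climZ.
apply: clim_ext => K; rewrite mulr_sumr; apply: eq_bigr => j _.
rewrite /Rterm /Ebr lam1' // hR (Gs _ _ hc).
have Gs' n' := Gs d.+1 n'; rewrite addnS in Gs'; rewrite !Gs' //.
rewrite /a' /s' addnS; ring.
Qed.

Lemma TT_residue B a N s lam mu i0 l m :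
  ee s i0.+1 = l%:R -> (l < N)%N -> lam i0 = 0 ->
  (forall k, (k < N)%N -> mu i0 k = (k == l)%:R) ->
  (forall i, (i0 < i < m)%N -> lam i = 1) ->
  (forall i k, (i0 < i < m)%N -> (k < N)%N -> mu i k = mu1 s i k) ->
  cc B a lam mu s i0 l != 0 -> (i0 < m)%N ->
  let a' j := a (i0.+1 + j)%N in let s' j := s (i0.+1 + j)%N in
  forall n, TT B a N lam mu s m n =
    cc B a lam mu s i0 l * TT B a' (N - l) lam1 (mu1 s') s' (m - i0.+1) n.
Proof.
move=> el lN lam0 mu0 lam1' mu1' c0 im a' s' n.
have [] := system_residue el lN lam0 mu0 lam1' mu1' c0 (d := (m - i0.+1)%N).
  by rewrite subnKC.
rewrite subnKC // => hc hR; rewrite /TT hR mulrDr; congr (_ + _).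
rewrite /Gsum (sum_drop (ltnW lN)); last first.
  by move=> k kl; rewrite hc ?(ltn_trans kl) // leqNgt kl mul0r.
rewrite mulr_sumr; apply: eq_big_nat => k /andP[_ kN]; rewrite hc; last by lia.
have -> : ee s m = l%:R + ee s' (m - i0.+1) by rewrite -el -ee_shift subnKC.
rewrite leq_addl addnK natrD -mulrA /a' subnKC //; congr (_ * (_ * cpow _ _)); ring.
Qed.

End PointwiseSystem.

(** * Local regularisation and the global function *)

Section Regularised.
Variables (R : realType) (r : nat).
Local Notation C := (Cplx R).
Local Notation V := 'rV[C]_r.
Variables (B : nat -> {poly R}) (a : nat -> R).
Hypothesis a01 : forall i, 0 <= a i <= 1.
Hypothesis bid : forall i, bern_identity B (a i.+1 - a i).
Variable (S : V -> nat -> C).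
Hypothesis affS : forall j, affine (S^~ j).
Variables (m : nat) (pol : nat -> nat -> bool).
Hypothesis npol : forall lam mu s i l, (i < m)%N -> ~~ pol i l -> cc B a lam mu s i l = 0.
Implicit Types (p s : V) (N : nat).

(** Only pairs in [pol] are avoided. At another pair [mu1] may be the inverse of 0, that is 0, but
    it multiplies a coefficient that vanishes. *)
Definition good s : Prop :=
  forall i l, (i < m)%N -> pol i l -> l%:R != ee (S s) i.+1.

(** The region where remainders of order N converge; these regions grow with N and cover the
    space. *)
Definition Om N s : Prop := forall i, (i < m)%N -> complex.Re (ee (S s) i.+1) < N%:R.

Definition sing p N i : bool :=
  has (fun l => pol i l && (l%:R == ee (S p) i.+1)) (iota 0 N).

(* Near p, level i is rescaled by the affine form vanishing on the hyperplane
   through p on which its coefficients are singular, if there is one. *)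
Definition lamp p N s i : C := if sing p N i then ee (S p) i.+1 - ee (S s) i.+1 else 1.

(** If l is the value of [ee] at [p] and the pair is polar, the quotient of [lamp] by l - ee is
    identically 1 where it is defined but reads 0/0 on the hyperplane; hence the case
    distinction. *)
Definition mup p N s i l : C :=
  if l%:R == ee (S p) i.+1 then 1 else lamp p N s i * (l%:R - ee (S s) i.+1)^-1.

Lemma fin_ball (n : nat) (P : nat -> R -> Prop) :
  (forall i d d', P i d -> 0 < d' <= d -> P i d') ->
  (forall i, (i < n)%N -> exists2 d, 0 < d & P i d) ->
  exists2 d, 0 < d & forall i, (i < n)%N -> P i d.
Proof.
move=> Pd; elim: n => [|n IH] h; first by exists 1.
have [|d d0 hd] := IH; first by move=> i /leqW; exact: h.
have [e e0 he] := h n (ltnSn n).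
have m0 : 0 < Num.min d e by rewrite lt_min d0.
exists (Num.min d e) => // i; rewrite ltnS leq_eqVlt => /predU1P[->|/hd hi].
  by apply: Pd he _; rewrite m0 ge_min lexx orbT.
by apply: Pd hi _; rewrite m0 ge_min lexx.
Qed.

Lemma affine_near (l : V -> C) p (e : R) : affine l -> 0 < e -> exists2 d, 0 < d &
  forall s, vn (s - p) < d -> normc (l s - l p) < e.
Proof.
move=> /affine_dist[K K0 hK] e0; have K1 : 0 < K + 1 by rewrite ltr_pwDr.
exists (e / (K + 1)); first by rewrite divr_gt0.
move=> s; rewrite ltr_pdivlMr // => h; apply: le_lt_trans (hK _ _) _.
have := vn_ge0 (s - p); nra.
Qed.

Lemma reg_ball p N : exists2 d, 0 < d & forall s, vn (s - p) < d ->
  forall i l, (i < m)%N -> (l < N)%N -> l%:R != ee (S p) i.+1 -> l%:R != ee (S s) i.+1.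
Proof.
have [|i im|d d0 hd] := @fin_ball m (fun i d => forall s, vn (s - p) < d ->
   forall l, (l < N)%N -> l%:R != ee (S p) i.+1 -> l%:R != ee (S s) i.+1).
- by move=> i d d' h /andP[_ dd] s sd; apply: h; exact: lt_le_trans dd.
- have [|l lN|d d0 hd] := @fin_ball N (fun l d => forall s, vn (s - p) < d ->
     l%:R != ee (S p) i.+1 -> l%:R != ee (S s) i.+1).
  + by move=> l d d' h /andP[_ dd] s sd; apply: h; exact: lt_le_trans dd.
  + have [e|ne] := eqVneq (l%:R) (ee (S p) i.+1).
      by exists 1 => // s _; rewrite e eqxx.
    have e0 : 0 < normc (l%:R - ee (S p) i.+1) by rewrite normc_gt0 subr_eq0.
    have [d d0 hd] := affine_near p (affine_ee affS i.+1) e0.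
    exists d => // s /hd h _; apply/eqP => e; by move: h; rewrite e ltxx.
  by exists d => // s sd l lN; exact: hd.
by exists d => // s sd i l im lN; exact: hd.
Qed.

Lemma Om_near p N : Om N p -> exists2 d, 0 < d & forall s, vn (s - p) < d -> Om N s.
Proof.
move=> hN; have [|i im|d d0 hd] := @fin_ball m (fun i d => forall s, vn (s - p) < d ->
    complex.Re (ee (S s) i.+1) < N%:R).
- by move=> i d d' h /andP[_ dd] s sd; apply: h; exact: lt_le_trans dd.
- have e0 : 0 < N%:R - complex.Re (ee (S p) i.+1) by rewrite subr_gt0 hN.
  have [d d0 hd] := affine_near p (affine_ee affS i.+1) e0.
  exists d => // s /hd; move: (Re_le_normc (ee (S s) i.+1 - ee (S p) i.+1)).
  have -> : complex.Re (ee (S s) i.+1 - ee (S p) i.+1) =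
      complex.Re (ee (S s) i.+1) - complex.Re (ee (S p) i.+1).
    by case: (ee (S s) _) => ? ?; case: (ee (S p) _).
  by move=> h1 h2; have := le_lt_trans (le_trans (ler_norm _) h1) h2; lra.
by exists d => // s sd i im; exact: hd.
Qed.

Lemma Om_le N N' s : (N <= N')%N -> Om N s -> Om N' s.
Proof. by move=> NN hN i /hN h; apply: lt_le_trans h _; rewrite ler_nat. Qed.

Lemma Om_exists s : exists N, Om N s.
Proof.
suff [N hN] : exists N : nat, forall i, (i < m)%N -> complex.Re (ee (S s) i.+1) < N%:R by exists N.
elim: m => [|n [N IH]]; first by exists 0%N.
exists (maxn N (Num.truncn (complex.Re (ee (S s) n.+1))).+1) => i.
rewrite ltnS leq_eqVlt => /predU1P[->|/IH h].
  by apply: lt_le_trans (truncnS_gt _) _; rewrite ler_nat leq_maxr.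
by apply: lt_le_trans h _; rewrite ler_nat leq_maxl.
Qed.

Lemma lamp_holo p N i q : holo q (fun s => lamp p N s i).
Proof.
rewrite /lamp; case: (sing p N i); last exact: holo_cst.
by apply: holo_affine; apply: affineB (affine_cst _ _) (affine_ee affS _).
Qed.

Lemma mup_holo p N i l : holo p (fun s => mup p N s i l).
Proof.
rewrite /mup; case: eqP => [_|/eqP ne]; first exact: holo_cst.
apply: holoM; first exact: lamp_holo.
apply: holo_inv; first exact: affineB (affine_cst _ _) (affine_ee affS _).
by rewrite subr_eq0.
Qed.

(** This includes points on the polar hyperplanes, so the regularised system is holomorphic at [p]
    even if [p] is a pole. *)
Lemma reg_cond p N : exists2 d, 0 < d & forall s i l, vn (s - p) < d -> (i < m)%N -> (l < N)%N ->
  mup p N s i l * (l%:R - ee (S s) i.+1) * cc B a (lamp p N s) (mup p N s) (S s) i l =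
  lamp p N s i * cc B a (lamp p N s) (mup p N s) (S s) i l.
Proof.
have [d d0 hd] := reg_ball p N; exists d => // s i l sd im lN.
rewrite /mup; case: eqP => [e|/eqP ne]; last first.
  by rewrite divfK // subr_eq0; exact: hd ne.
case pl : (pol i l); last by rewrite npol ?pl // !mulr0.
rewrite mul1r /lamp; have -> : sing p N i; last by rewrite e.
by apply/hasP; exists l; rewrite ?mem_iota // pl e eqxx.
Qed.

Lemma holo_cpow p x (l : V -> C) : affine l -> holo p (fun s => cpow x (l s)).
Proof.
move=> al; have [M jl] := jet_affine_bnd p (@ltr01 R) al.
have := jet_cexp (@ltr01 R) (jetZ (ln x)%:C%C (@ltr01 R) jl).
move=> j; eexists 1, _; split=> //; apply: jet_ext j => s _.
by rewrite /cpow mulrC.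
Qed.

Lemma reg_holo p N n : Om N p ->
  holo p (fun s => TT B a N (lamp p N s) (mup p N s) (S s) m n).
Proof.
move=> hN; have [d d0 hd] := reg_cond p N.
have [hc hR] := system_holo a01 bid affS (fun i _ => lamp_holo p N i p)
  (fun i l _ _ => mup_holo p N i l) d0 hd hN (leqnn m).
apply: holoD.
  apply: (@holo_ext _ _ _ _ _ 1 ltr01 (fun s _ => esym (big_nat _ _ _ _ _))).
  apply: holo_sum => k /andP[_ kN]; apply: holoM; first exact: hc.
  by apply: holo_cpow; apply: affineB (affine_ee affS _) (affine_cst _ _).
have rN : N%:R - complex.Re (ee (S p) m) - 1 < N%:R - complex.Re (ee (S p) m) by lra.
exact: hfam_at (hR _ rN).
Qed.

Lemma lamp_neq0 p N s : good s -> forall i, (i < m)%N -> lamp p N s i != 0.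
Proof.
move=> gs i im; rewrite /lamp; case: ifP => [|_]; last exact: oner_neq0.
by move=> /hasP[l _ /andP[pl /eqP <-]]; rewrite subr_eq0; exact: gs.
Qed.

Lemma reg_scale p N : exists2 d, 0 < d & forall s, vn (s - p) < d -> good s ->
  forall i l, (i < m)%N -> (l < N)%N ->
    mup p N s i l * cc B a (@lam1 R) (mu1 (S s)) (S s) i l =
    lamp p N s i * (mu1 (S s) i l * cc B a (@lam1 R) (mu1 (S s)) (S s) i l).
Proof.
have [d d0 hd] := reg_ball p N; exists d => // s sd gs i l im lN.
rewrite mulrA /mup; case: eqP => [e|/eqP ne]; last by [].
case pl : (pol i l); last by rewrite npol ?pl // !mulr0.
rewrite /lamp /mu1; have -> : sing p N i.
  by apply/hasP; exists l; rewrite ?mem_iota // pl e eqxx.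
by rewrite -e divff // subr_eq0; exact: gs.
Qed.

Lemma reg_eq p N : exists2 d, 0 < d & forall s, vn (s - p) < d -> good s -> forall n,
  TT B a N (lamp p N s) (mup p N s) (S s) m n =
  (\prod_(0 <= j < m) lamp p N s j) * TT B a N (@lam1 R) (mu1 (S s)) (S s) m n.
Proof.
have [d d0 hd] := reg_scale p N; exists d => // s sd gs n.
by apply: TT_scale; [exact: lamp_neq0|exact: hd].
Qed.

Lemma lamp_self s N i : good s -> (i < m)%N -> lamp s N s i = 1.
Proof.
move=> gs im; rewrite /lamp; case: ifP => // /hasP[l _ /andP[pl]].
by rewrite (negPf (gs _ _ im pl)).
Qed.

(** Comes from the system regularised at [s] itself: at a good point all its factors are 1, so it
    agrees with the standard system. *)
Lemma std_cvg s N i n : good s -> Om N s -> (i < m)%N -> ctends (fun K => \sum_(n <= j < K)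
    Rterm N (a i) (a i.+1) (ee (S s) i) (ee (S s) i.+1) (S s i) 1
      (cc B a (@lam1 R) (mu1 (S s)) (S s) i) (cc B a (@lam1 R) (mu1 (S s)) (S s) i.+1)
      (RR B a N (@lam1 R) (mu1 (S s)) (S s) i) j) (RR B a N (@lam1 R) (mu1 (S s)) (S s) i.+1 n).
Proof.
move=> gs hN im; have [d d0 hd] := reg_cond s N.
have cv := @system_cvg _ B a a01 bid _ S affS s N m _ _ d (fun i _ => lamp_holo s N i s)
  (fun i l _ _ => mup_holo s N i l) d0 hd hN i n im.
have [e e0 he] := reg_scale s N.
have se : vn (s - s) < e by rewrite subrr vn0.
have {}he := he s se gs.
have p1 j : (j <= m)%N -> \prod_(0 <= k < j) lamp s N s k = 1.
  by move=> jm; rewrite big_nat_cond big1 // => k /andP[/andP[_ kj] _]; rewrite lamp_self // (leq_trans kj).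
have sc j (jm : (j <= m)%N) := system_scale (lamp_neq0 s N gs) he jm.
have [hc hR] := sc _ (ltnW im); have [hc' hR'] := sc _ im.
rewrite p1 // in hR'; have := hR' n; rewrite mul1r => <-.
apply: ctends_ext cv => K; apply: eq_bigr => j _.
rewrite /Rterm /Ebr (Gsum_scale _ _ _ hc) !(Gsum_scale _ _ _ hc') hR.
by rewrite !p1 ?(ltnW im) // lamp_self // !mul1r.
Qed.

Lemma TT_addN s N k n : good s -> Om N s ->
  TT B a (N + k) (@lam1 R) (mu1 (S s)) (S s) m n = TT B a N (@lam1 R) (mu1 (S s)) (S s) m n.
Proof.
move=> gs hN; elim: k => [|k IH]; first by rewrite addn0.
have hNk : Om (N + k) s by apply: Om_le hN; exact: leq_addr.
rewrite addnS -IH; apply: (TT_succN (m := m)) => //.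
- by move=> i; case/andP: (a01 i).
- by move=> i n' im; eexists; exact: std_cvg.
Qed.

(** No single N serves all points. At good points every admissible N gives the same value by
    [TT_addN], so the choice of [xget] is immaterial. *)
Definition Tval n s : C :=
  xget 0 [set y | exists N, Om N s /\ y = TT B a N (@lam1 R) (mu1 (S s)) (S s) m n].

Lemma TvalE s N n : good s -> Om N s -> Tval n s = TT B a N (@lam1 R) (mu1 (S s)) (S s) m n.
Proof.
move=> gs hN; rewrite /Tval; case: xgetP => [y _ [N' [hN' ->]]|/(_ (TT B a N (@lam1 R) (mu1 (S s)) (S s) m n))]; last first.
  by case; exists N.
by rewrite -(TT_addN N' n gs hN) addnC TT_addN.
Qed.

Definition regfactor p N s : C := \prod_(0 <= j < m) lamp p N s j.

Lemma regfactor_neq0 p N s : good s -> regfactor p N s != 0.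
Proof.
move=> gs; rewrite prodf_seq_neq0; apply/allP => j; rewrite mem_index_iota => /andP[_ jm] /=.
exact: lamp_neq0.
Qed.

Lemma regfactor_holo p N q : holo q (regfactor p N).
Proof. by apply: holo_prod => j _; exact: lamp_holo. Qed.

Lemma Tval_local p N n : Om N p -> exists2 d, 0 < d & forall s, vn (s - p) < d -> good s ->
  regfactor p N s * Tval n s = TT B a N (lamp p N s) (mup p N s) (S s) m n.
Proof.
move=> hN; have [d d0 hd] := reg_eq p N; have [e e0 he] := Om_near hN.
exists (Num.min d e); first by rewrite lt_min d0.
by move=> s; rewrite lt_min => /andP[sd /he se] gs; rewrite (TvalE n gs se) hd.
Qed.

(** Local finiteness: where Re ee < N, the hyperplanes with l >= N are absent and finitely many
    remain. *)
Lemma good_near p : good p -> exists2 d, 0 < d & forall s, vn (s - p) < d -> good s.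
Proof.
move=> gp; have [N hN] := Om_exists p.
have [d d0 hd] := reg_ball p N; have [e e0 he] := Om_near hN.
exists (Num.min d e); first by rewrite lt_min d0.
move=> s; rewrite lt_min => /andP[/hd sd /he se] i l im pl.
case: (ltnP l N) => lN; first by apply: sd => //; exact: gp.
apply/eqP => E; have := se i im; rewrite -E -(rmorph_nat (real_complex R)) /= ltNge ler_nat lN.
by [].
Qed.

Lemma Tval_holo p n : good p -> holo p (Tval n).
Proof.
move=> gp; have [N hN] := Om_exists p.
have [d d0 hd] := Tval_local n hN; have [e e0 he] := good_near gp.
have m0 : 0 < Num.min d e by rewrite lt_min d0.
apply: (holo_ext m0 _ (reg_holo n hN)) => s; rewrite lt_min => /andP[sd /he gs].
rewrite -hd // /regfactor big_nat_cond big1 ?mul1r // => j /andP[/andP[_ jm] _].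
rewrite /lamp; case: ifP => // /hasP[l _ /andP[pl]].
by rewrite (negPf (gp _ _ jm pl)).
Qed.

End Regularised.

(** * Identity theorem *)

Section MaximumPrinciple.
Variable R : realType.
Local Notation C := (Cplx R).
Implicit Types (f g : C -> C) (z h : C).

Definition jet1 g z : Prop := exists (L Q : C) (K d : R), [/\ 0 < d, 0 <= K &
  forall h, normc h < d -> normc (g (z + h) - g z - L * h - Q * h ^+ 2) <= K * normc h ^+ 3].

Lemma jet1_near f g z d : 0 < d -> (forall h, normc h < d -> f (z + h) = g (z + h)) ->
  jet1 f z -> jet1 g z.
Proof.
move=> d0 fg [L [Q [K [e [e0 K0 he]]]]]; exists L, Q, K, (Num.min d e); split=> //.
  by rewrite lt_min d0.
have gz : g z = f z by have := fg 0; rewrite addr0 normc0 => /(_ d0).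
by move=> h; rewrite lt_min => /andP[hd hee]; rewrite -fg // gz; exact: he.
Qed.

Lemma jet1_cst (c : C) z : jet1 (fun=> c) z.
Proof.
exists 0, 0, 0, 1; split=> // h _.
by rewrite !mul0r !subr0 subrr normc0.
Qed.

Lemma jet1M f g z : jet1 f z -> jet1 g z -> jet1 (fun w => f w * g w) z.
Proof.
move=> [L [Q [K [d [d0 K0 hf]]]]] [L' [Q' [K' [d' [d0' K0' hg]]]]].
pose nf := normc (f z); pose ng := normc (g z).
exists (f z * L' + g z * L), (f z * Q' + g z * Q + L * L').
exists (nf * K' + normc L * (normc Q' + K') + normc Q * (normc L' + (normc Q' + K')) +
   K * (ng + (normc L' + (normc Q' + K')))), (Num.min 1 (Num.min d d')).
have nn := @normc_ge0 R.
split; [by rewrite !lt_min ltr01 d0|by rewrite !addr_ge0 ?mulr_ge0 ?addr_ge0 ?nn|].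
move=> h; rewrite !lt_min => /and3P[h1 hd hd'].
have {}hf := hf h hd; have {}hg := hg h hd'.
set rf := f (z + h) - _ - _ - _ in hf; set rg := g (z + h) - _ - _ - _ in hg.
have x0 := nn h; set x := normc h in x0 h1 hf hg *.
have xx : x ^+ 2 <= x by rewrite expr2 ler_piMl // ltW.
have xxx : x ^+ 3 <= x ^+ 2 by rewrite exprS ler_piMl ?exprn_ge0 // ltW.
have b1 : normc (Q' * h ^+ 2 + rg) <= (normc Q' + K') * x ^+ 2.
  apply: le_trans (le_normcD _ _) _; rewrite normcM normcX -/x mulrDl lerD2l.
  by apply: le_trans hg _; rewrite ler_wpM2l.
have b2 : normc (L' * h + (Q' * h ^+ 2 + rg)) <= (normc L' + (normc Q' + K')) * x.
  apply: le_trans (le_normcD _ _) _; rewrite normcM -/x [leRHS]mulrDl lerD2l.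
  by apply: le_trans b1 _; rewrite ler_wpM2l // addr_ge0.
have b3 : normc (g (z + h)) <= ng + (normc L' + (normc Q' + K')).
  have -> : g (z + h) = g z + (L' * h + (Q' * h ^+ 2 + rg)) by rewrite /rg; ring.
  apply: le_trans (le_normcD _ _) _; rewrite lerD2l; apply: le_trans b2 _.
  by rewrite ler_piMr ?addr_ge0 // ltW.
have -> : f (z + h) * g (z + h) - f z * g z - (f z * L' + g z * L) * h -
   (f z * Q' + g z * Q + L * L') * h ^+ 2 =
   f z * rg + (L * h) * (Q' * h ^+ 2 + rg) + (Q * h ^+ 2) * (L' * h + (Q' * h ^+ 2 + rg)) + rf * g (z + h).
  by rewrite /rf /rg; ring.
have c1 : normc (f z * rg) <= nf * K' * x ^+ 3.
  by rewrite normcM -mulrA ler_wpM2l.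
have c2 : normc ((L * h) * (Q' * h ^+ 2 + rg)) <= normc L * (normc Q' + K') * x ^+ 3.
  rewrite normcM [normc (L * h)]normcM -/x.
  have -> : normc L * (normc Q' + K') * x ^+ 3 = normc L * x * ((normc Q' + K') * x ^+ 2) by ring.
  by rewrite ler_wpM2l // mulr_ge0.
have c3 : normc ((Q * h ^+ 2) * (L' * h + (Q' * h ^+ 2 + rg))) <=
    normc Q * (normc L' + (normc Q' + K')) * x ^+ 3.
  rewrite normcM [normc (Q * _)]normcM normcX -/x.
  have -> : normc Q * (normc L' + (normc Q' + K')) * x ^+ 3 =
     normc Q * x ^+ 2 * ((normc L' + (normc Q' + K')) * x) by ring.
  by rewrite ler_wpM2l // mulr_ge0 // exprn_ge0.
have c4 : normc (rf * g (z + h)) <= K * (ng + (normc L' + (normc Q' + K'))) * x ^+ 3.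
  rewrite normcM mulrAC; apply: ler_pM => //; exact: nn.
apply: le_trans (le_normcD _ _) _; rewrite [leRHS]mulrDl lerD //.
apply: le_trans (le_normcD _ _) _; rewrite [leRHS]mulrDl lerD //.
by apply: le_trans (le_normcD _ _) _; rewrite [leRHS]mulrDl lerD.
Qed.

Lemma jet1_inv z : z != 0 -> jet1 (fun w => w^-1) z.
Proof.
move=> z0; have nz : 0 < normc z by rewrite normc_gt0.
exists (- z ^- 2), (z ^- 3), (2 / normc z ^+ 4), (normc z / 2).
split; [by rewrite divr_gt0|by rewrite divr_ge0 // exprn_ge0 // ltW|].
move=> h hz.
have zh : normc z / 2 <= normc (z + h).
  have := le_normcB (z + h) h; rewrite addrK; lra.
have zh0 : z + h != 0 by rewrite -normc_gt0 (lt_le_trans _ zh) // divr_gt0.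
have -> : (z + h)^-1 - z^-1 - - z ^- 2 * h - z ^- 3 * h ^+ 2 = - (h ^+ 3 / (z ^+ 3 * (z + h))).
  by field; rewrite z0 zh0.
rewrite normcN (normcM (h ^+ 3)) normcV (normcM (z ^+ 3)) !normcX mulrC ler_wpM2r ?exprn_ge0 ?normc_ge0 //.
have zh1 : 0 < normc (z + h) by rewrite normc_gt0.
have -> : 2 / normc z ^+ 4 = (normc z ^+ 3 * (normc z / 2))^-1 by field; rewrite gt_eqF.
rewrite lef_pV2 ?posrE ?mulr_gt0 ?exprn_gt0 ?divr_gt0 //.
by rewrite ler_wpM2l // exprn_ge0 // ltW.
Qed.

Lemma jet1X f z n : jet1 f z -> jet1 (fun w => f w ^+ n) z.
Proof.
move=> jf; elim: n => [|n IH].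
  by apply: (@jet1_near (fun=> 1) _ _ 1) (jet1_cst _ _) => // h _; rewrite expr0.
by apply: (@jet1_near (fun w => f w * f w ^+ n) _ _ 1) (jet1M jf IH) => // h _; rewrite exprS.
Qed.

Lemma jet1_cont g z : jet1 g z -> forall e : R, 0 < e -> exists2 d : R, 0 < d &
  forall h, normc h < d -> normc (g (z + h) - g z) < e.
Proof.
move=> [L [Q [K [d [d0 K0 hd]]]]] e e0.
have nn := @normc_ge0 R.
pose T := normc L + normc Q + K + 1.
have T0 : 0 < T by rewrite ltr_pwDr // !addr_ge0.
exists (Num.min (Num.min 1 d) (e / T)); first by rewrite !lt_min ltr01 d0 divr_gt0.
move=> h; rewrite !lt_min => /andP[/andP[h1 /hd {}hd]]; rewrite ltr_pdivlMr //.
set r := g (z + h) - _ - _ - _ in hd.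
have -> : g (z + h) - g z = L * h + (Q * h ^+ 2 + r) by rewrite /r; ring.
have x0 := nn h; set x := normc h in x0 h1 hd *.
have xx : x ^+ 2 <= x by rewrite expr2 ler_piMl // ltW.
have xxx : x ^+ 3 <= x.
  by apply: le_trans xx; rewrite exprS ler_piMl ?exprn_ge0 // ltW.
apply: le_lt_trans; apply: le_trans (le_normcD _ _) _.
apply: le_trans (lerD (lexx _) (le_normcD _ _)) _.
rewrite (normcM L) (normcM Q) normcX -/x /T.
have := ler_wpM2l (nn Q) xx; have := ler_wpM2l K0 xxx; lra.
Qed.

(** A square is compact as a product of intervals. At an interior maximum of Re g + eta (x^2 + y^2),
    add the values at the increments t, -t, it, -it: linear parts cancel, quadratic parts cancel
    since i^2 = -1, and eta t^2 <= K t^3 remains, absurd for small t. *)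
Lemma max_principle g (rho M : R) : 0 < rho ->
  (forall x y, `|x| <= rho -> `|y| <= rho -> jet1 g (Complex x y)) ->
  (forall x y, `|x| <= rho -> `|y| <= rho -> `|x| = rho \/ `|y| = rho ->
     complex.Re (g (Complex x y)) <= M) ->
  forall x y, `|x| <= rho -> `|y| <= rho -> complex.Re (g (Complex x y)) <= M.
Proof.
move=> r0 jg bM x1 y1 hx1 hy1; apply/ler_addgt0Pr => e e0.
(* On the square the perturbation is then at most e. *)
pose eta := e / (2 * rho ^+ 2); have eta0 : 0 < eta by rewrite divr_gt0 // mulr_gt0 ?exprn_gt0.
pose u (w : R * R) : R := complex.Re (g (Complex w.1 w.2)) + eta * (w.1 ^+ 2 + w.2 ^+ 2).
pose A : set (R * R) := `[- rho, rho]%classic `*` `[- rho, rho]%classic.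
have inA x y : A (x, y) <-> `|x| <= rho /\ `|y| <= rho.
  by rewrite /A /= !in_itv /= !ler_norml; split=> [[->]|[-> ->]].
have cA : compact A by apply: compact_setX; exact: segment_compact.
have A0 : A !=set0 by exists (0, 0); apply/inA; rewrite normr0 ltW.
have cu : {within A, continuous u}.
  apply: continuous_in_subspaceT => -[x y]; rewrite inE => /inA[hx hy].
  have c1 : {for (x, y), continuous (fun w : R * R => complex.Re (g (Complex w.1 w.2)))}.
    apply/cvgrPdist_lt => d d0.
    have [d' d0' hd] := jet1_cont (jg x y hx hy) d0.
    apply/(@nbhs_ballP R (R * R)%type); exists (d' / 2) => [|w [/= w1 w2]]; first by rewrite /= divr_gt0.
    have exy : (Complex x y : C) + Complex (w.1 - x) (w.2 - y) = Complex w.1 w.2.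
      by simpc; congr Complex; rewrite subrKC.
    have := hd (Complex (w.1 - x) (w.2 - y)); rewrite exy distrC => h.
    have -> : complex.Re (g (Complex w.1 w.2)) - complex.Re (g (Complex x y)) =
       complex.Re (g (Complex w.1 w.2) - g (Complex x y)).
      by case: (g (Complex w.1 w.2)) => ? ?; case: (g (Complex x y)).
    apply: le_lt_trans (Re_le_normc _) _; apply: h.
    apply: le_lt_trans (normc_le_ReIm _) _ => /=.
    move: w1 w2; rewrite /ball /= [`|x - _|]distrC [`|y - _|]distrC; lra.
  have c2 : {for (x, y), continuous (fun w : R * R => eta * (w.1 ^+ 2 + w.2 ^+ 2))}.
    apply: cvgM; first exact: cvg_cst.
    apply: cvgD; rewrite !expr2; apply: cvgM; exact: cvg_fst || exact: cvg_snd.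
  exact: cvgD c1 c2.
have [c cA' cmax] := compact_EVT_max A0 cA cu.
have {}cmax w : A w -> u w <= u c by move=> Aw; apply: cmax; rewrite inE.
case: c cA' cmax => x0 y0; rewrite inE => /inA[hx0 hy0] cmax.
have sq x : `|x| <= rho -> x ^+ 2 <= rho ^+ 2.
  by move=> hx; rewrite -(real_normK (num_real x)); apply: lerXn2r; rewrite ?nnegrE // ltW.
have ee : eta * (2 * rho ^+ 2) = e by rewrite /eta divfK // gt_eqF // mulr_gt0 ?exprn_gt0.
suff bnd : complex.Re (g (Complex x0 y0)) <= M.
  have := cmax (x1, y1) ((inA _ _).2 (conj hx1 hy1)); rewrite /u /=.
  have h1 : eta * (x0 ^+ 2 + y0 ^+ 2) <= e.
    by rewrite -ee ler_wpM2l ?(ltW eta0) //; have := sq _ hx0; have := sq _ hy0; lra.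
  have h2 : 0 <= eta * (x1 ^+ 2 + y1 ^+ 2) by rewrite mulr_ge0 ?addr_ge0 ?sqr_ge0 // ltW.
  lra.
have [bx|nbx] := eqVneq `|x0| rho; first by apply: bM => //; left.
have [by_|nby] := eqVneq `|y0| rho; first by apply: bM => //; right.
exfalso.
have lx : `|x0| < rho by rewrite lt_neqAle nbx.
have ly : `|y0| < rho by rewrite lt_neqAle nby.
have [L [Q [K [d [d0 K0 hd]]]]] := jg x0 y0 hx0 hy0.
(* Keeps the four points in the square and in the range of the expansion, with t (K + 1) < eta. *)
pose t := Num.min (Num.min (d / 2) (eta / (K + 1) / 2)) (Num.min (rho - `|x0|) (rho - `|y0|)).
have K1 : 0 < K + 1 by rewrite ltr_pwDr.
have t0 : 0 < t.
  have t1 : 0 < d / 2 by exact: divr_gt0.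
  have t2 : 0 < eta / (K + 1) / 2 by apply: divr_gt0 => //; exact: divr_gt0.
  by rewrite !lt_min t1 t2 !subr_gt0 lx.
have td : t < d.
  have : t <= d / 2 by rewrite !ge_min lexx.
  lra.
have tK : t * (K + 1) < eta.
  have : t <= eta / (K + 1) / 2 by rewrite !ge_min lexx orbT.
  have := ler_wpM2r (ltW K1); move=> h /h; rewrite mulrAC divfK ?gt_eqF //; lra.
have tx : `|x0| + t <= rho.
  have : t <= rho - `|x0| by rewrite !ge_min lexx !orbT.
  lra.
have ty : `|y0| + t <= rho.
  have : t <= rho - `|y0| by rewrite !ge_min lexx !orbT.
  lra.
have At (x y : R) : `|x| + `|y| <= t -> u (x0 + x, y0 + y) <= u (x0, y0).
  move=> xy; apply: cmax; apply/inA; split.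
    apply: le_trans (ler_normD _ _) _; have := normr_ge0 y; lra.
  apply: le_trans (ler_normD _ _) _; have := normr_ge0 x; lra.
have nt : `|t| = t by exact: gtr0_norm.
have h1 := At t 0; rewrite normr0 addr0 nt lexx addr0 in h1; have {}h1 := h1 isT.
have h2 := At (- t) 0; rewrite normr0 addr0 normrN nt lexx addr0 in h2; have {}h2 := h2 isT.
have h3 := At 0 t; rewrite normr0 add0r nt lexx addr0 in h3; have {}h3 := h3 isT.
have h4 := At 0 (- t); rewrite normr0 add0r normrN nt lexx addr0 in h4; have {}h4 := h4 isT.
pose z : C := Complex x0 y0.
have hd' (w : C) : normc w = t ->
    complex.Re (g z) + complex.Re (L * w) + complex.Re (Q * w ^+ 2) - K * t ^+ 3 <= complex.Re (g (z + w)).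
  move=> wt; have := hd w; rewrite wt => /(_ td).
  set rr := g (z + w) - g z - L * w - Q * w ^+ 2 => hr.
  have := le_trans (Re_le_normc rr) hr.
  have -> : complex.Re rr = complex.Re (g (z + w)) - complex.Re (g z) - complex.Re (L * w) - complex.Re (Q * w ^+ 2).
    by rewrite /rr; case: (g (z + w)) => ? ?; case: (g z) => ? ?; case: (L * w) => ? ?; case: (Q * _).
  by rewrite ler_norml => /andP[]; lra.
have nr : normc (t%:C%C : C) = t by rewrite normcC nt.
have k1 := hd' t%:C%C nr.
have k2 := hd' (- t%:C%C); rewrite normcN in k2; have {}k2 := k2 nr.
have ni : normc ('i%C * t%:C%C : C) = t.
  by rewrite normcM nr /normc /= expr0n expr1n add0r sqrtr1 mul1r.
have k3 := hd' _ ni.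
have k4 := hd' (- ('i%C * t%:C%C)); rewrite normcN in k4; have {}k4 := k4 ni.
have e1 : z + t%:C%C = Complex (x0 + t) y0 by rewrite /z; simpc.
have e2 : z + - t%:C%C = Complex (x0 - t) y0 by rewrite /z; simpc.
have e3 : z + 'i%C * t%:C%C = Complex x0 (y0 + t) by rewrite /z; simpc.
have e4 : z + - ('i%C * t%:C%C) = Complex x0 (y0 - t) by rewrite /z; simpc.
rewrite e1 in k1; rewrite e2 in k2; rewrite e3 in k3; rewrite e4 in k4.
rewrite !sqrrN in k2 k4.
have q3 : Q * ('i%C * t%:C%C) ^+ 2 = - (Q * t%:C%C ^+ 2) by rewrite exprMn sqr_i; ring.
rewrite q3 in k3 k4.
have ReN (w : C) : complex.Re (- w) = - complex.Re w by case: w.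
rewrite !mulrN !ReN in k2 k3 k4.
move: h1 h2 h3 h4; rewrite /u /= -/z => h1 h2 h3 h4.
have h5 : eta * (t * t) <= K * t ^+ 3 by rewrite exprS expr2; lra.
have tt : 0 < t * t by rewrite mulr_gt0.
have e5 : K * t ^+ 3 = (K * t) * (t * t) by ring.
move: h5; rewrite e5 ler_pM2r // => h5.
by move: tK; rewrite mulrDr mulr1 mulrC; lra.
Qed.

(** The maximum principle for g(w)/w^n on the square of half-side rho, whose boundary has |w| >= rho
    and which lies in the disc of radius 2 rho, bounds |g z| by 2 M (|z|/rho)^n; let n grow. The
    quotient vanishes near w = 0 because g does. *)
Lemma vanish_1d g (rho M e : R) : 0 < rho -> 0 < e ->
  (forall z, normc z <= 2 * rho -> jet1 g z /\ normc (g z) <= M) ->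
  (forall z, normc z < e -> g z = 0) ->
  forall z, normc z < rho -> g z = 0.
Proof.
move=> r0 e0 hg gz z zr.
have M0 : 0 <= M.
  by apply: le_trans (proj2 (hg 0 _)); rewrite ?normc_ge0 // normc0 mulr_ge0 // ltW.
have [->|zn0] := eqVneq z 0; first by apply: gz; rewrite normc0.
pose gn n w := g w * (w^-1) ^+ n.
have jgn n w : normc w <= 2 * rho -> jet1 (gn n) w.
  move=> wr; have [w0|w0] := eqVneq w 0; last first.
    by apply: jet1M (proj1 (hg w wr)) _; apply/jet1X/jet1_inv.
  apply: (@jet1_near (fun=> 0) _ _ e) (jet1_cst _ _) => // h he.
  by rewrite /gn w0 add0r gz // mul0r.
(* Taking k = 1, -1, i, -i will bound the real and imaginary parts from both sides. *)
have bnd n (k : C) : normc k = 1 -> complex.Re (k * gn n z) <= M / rho ^+ n.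
  move=> k1; have /andP[zx zy] : (`|complex.Re z| <= rho) && (`|complex.Im z| <= rho).
    by rewrite (le_trans (Re_le_normc z) (ltW zr)) (le_trans (Im_le_normc z) (ltW zr)).
  have sm x y : `|x| <= rho -> `|y| <= rho -> normc (Complex x y : C) <= 2 * rho.
    by move=> hx hy; apply: le_trans (normc_le_ReIm _) _ => /=; lra.
  have ez : z = Complex (complex.Re z) (complex.Im z) by case: (z).
  rewrite ez; move: zx zy.
  move: (complex.Re z) (complex.Im z); apply: (@max_principle (fun w => k * gn n w) rho) => //.
    by move=> x y hx hy; apply: jet1M (jet1_cst _ _) (jgn _ _ (sm _ _ hx hy)).
  move=> x y hx hy bxy; apply: le_trans (ler_norm _) _; apply: le_trans (Re_le_normc _) _.
  rewrite normcM k1 mul1r normcM normcX normcV.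
  have lo : rho <= normc (Complex x y : C).
    by case: bxy => <-; [exact: (Re_le_normc (Complex x y))|exact: (Im_le_normc (Complex x y))].
  apply: ler_pM; rewrite ?normc_ge0 ?exprn_ge0 ?invr_ge0 ?normc_ge0 //.
    exact: (proj2 (hg _ (sm _ _ hx hy))).
  rewrite -exprVn; apply: lerXn2r; rewrite ?nnegrE ?invr_ge0 ?normc_ge0 ?(ltW r0) //.
  by rewrite lef_pV2 ?posrE // (lt_le_trans r0).
have ngn n : normc (gn n z) <= 2 * (M / rho ^+ n).
  have ReN (w : C) : complex.Re (- w) = - complex.Re w by case: w.
  have n1 : normc (1 : C) = 1 by exact: normc1.
  have ni : normc ('i%C : C) = 1.
    by rewrite /normc /= expr0n expr1n add0r sqrtr1.
  have k1 := bnd n 1 n1; have k2 := bnd n (-1); rewrite normcN in k2; have {}k2 := k2 n1.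
  have k3 := bnd n 'i%C ni; have k4 := bnd n (- 'i%C); rewrite normcN in k4; have {}k4 := k4 ni.
  apply: le_trans (normc_le_ReIm _) _.
  have Rei (w : C) : complex.Re ('i%C * w) = - complex.Im w by case: w => ? ?; simpc.
  rewrite mul1r in k1; rewrite mulN1r ReN in k2; rewrite Rei in k3; rewrite mulNr ReN Rei opprK in k4.
  have : `|complex.Re (gn n z)| <= M / rho ^+ n by rewrite ler_norml; apply/andP; split; lra.
  have : `|complex.Im (gn n z)| <= M / rho ^+ n by rewrite ler_norml; apply/andP; split; lra.
  lra.
apply/eqP; rewrite -normc_eq0; apply/eqP/le_anti; rewrite normc_ge0 andbT.
have q0 : 0 <= normc z / rho by rewrite divr_ge0 ?normc_ge0 // ltW.
have q1 : normc z / rho < 1 by rewrite ltr_pdivrMr // mul1r.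
have gle n : normc (g z) <= 2 * M * (normc z / rho) ^+ n.
  have := ngn n; rewrite /gn normcM normcX normcV => h.
  have zp : 0 < normc z ^+ n by rewrite exprn_gt0 // normc_gt0.
  have zn : (normc z)^-1 ^+ n * normc z ^+ n = 1.
    by rewrite -exprMn mulVf ?gt_eqF ?normc_gt0 // expr1n.
  have h2 := ler_wpM2r (ltW zp) h; rewrite -mulrA zn mulr1 in h2.
  apply: le_trans h2 _; rewrite [in leRHS]exprMn exprVn.
  by rewrite le_eqVlt; apply/orP; left; apply/eqP; ring.
have lim : (fun n => 2 * M * (normc z / rho) ^+ n) @ \oo --> (2 * M * 0 : R).
  by apply: cvgM (cvg_cst _) _; apply: cvg_expr; rewrite ger0_norm.
rewrite mulr0 in lim.
by apply: (cvgr_to_ge lim); apply: nearW => n; exact: gle.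
Qed.

End MaximumPrinciple.

(** * Unique continuation in several variables *)

Section IdentityTheorem.
Variables (R : realType) (r : nat).
Local Notation C := (Cplx R).
Local Notation V := 'rV[C]_r.
Implicit Types (p s v : V) (f g : V -> C) (d M : R).

Lemma jet_cont p d M g s : 0 < d -> jet p d M g -> vn (s - p) < d ->
  forall e, 0 < e -> exists2 e', 0 < e' & forall t, vn (t - s) < e' -> normc (g t - g s) < e.
Proof.
move=> d0 jg sd e e0; have M0 := jet_ge0 d0 jg.
have [L [Q [h1 h2 h3 h4 h5 h6]]] := jg s sd.
pose e' := Num.min (d - vn (s - p)) (Num.min d (e / (3 * M + 1) * d)).
have M1 : 0 < 3 * M + 1 by rewrite ltr_pwDr // mulr_ge0.
exists e'.
  by rewrite !lt_min subr_gt0 sd d0 /= mulr_gt0 // divr_gt0.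
move=> t; rewrite !lt_min => /and3P[t1 t2 t3].
set h := t - s in t1 t2 t3 *.
have th : t = s + h by rewrite /h subrKC.
have shd : vn (s + h - p) < d.
  rewrite addrAC; apply: le_lt_trans (vnD _ _) _; lra.
have {}h4 := h4 h; have {}h5 := h5 h; have {}h6 := h6 h shd.
set x := vn h / d in h4 h5 h6.
have x0 : 0 <= x by rewrite divr_ge0 ?vn_ge0 // ltW.
have x1 : x <= 1 by rewrite ler_pdivrMr // mul1r ltW.
have xe : x * (3 * M + 1) < e.
  by move: t3; rewrite -ltr_pdivrMr // -/x ltr_pdivlMr.
have xx : x ^+ 2 <= x by rewrite expr2 ler_piMl.
have xxx : x ^+ 3 <= x by apply: le_trans xx; rewrite exprS ler_piMl ?exprn_ge0.
rewrite th; set rr := g (s + h) - _ - _ - _ in h6.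
have -> : g (s + h) - g s = L h + (Q h + rr) by rewrite /rr; ring.
apply: le_lt_trans (le_normcD _ _) _.
have := le_normcD (Q h) rr.
have := ler_wpM2l M0 xx; have := ler_wpM2l M0 xxx.
lra.
Qed.

Lemma jet_line p d M g s v (z : C) : 0 < d -> jet p d M g ->
  vn (s + z *: v - p) < d -> jet1 (fun w => g (s + w *: v)) z.
Proof.
move=> d0 jg sd; have M0 := jet_ge0 d0 jg.
have [L [Q [h1 h2 h3 h4 h5 h6]]] := jg _ sd.
have v1 : 0 < vn v + 1 by rewrite ltr_pwDr // vn_ge0.
exists (L v), (Q v), (M * (vn v / d) ^+ 3), ((d - vn (s + z *: v - p)) / (vn v + 1)).
split; first by rewrite divr_gt0 // subr_gt0.
  by rewrite mulr_ge0 // exprn_ge0 // divr_ge0 ?vn_ge0 // ltW.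
move=> h; rewrite ltr_pdivlMr // => hd.
have e : s + (z + h) *: v = s + z *: v + h *: v by rewrite scalerDl addrA.
have hv : vn (h *: v) <= normc h * (vn v + 1).
  by rewrite vnZ ler_wpM2l ?normc_ge0 // lerDl.
have := h6 (h *: v); rewrite e => /(_ _)/le_trans H.
have L0 : L 0 = 0.
  by have := h1 1 0 0; rewrite scale1r addr0 mul1r -[LHS]addr0 => /addrI/esym.
have Lh : L (h *: v) = L v * h by have := h1 h v 0; rewrite !addr0 L0 addr0 mulrC.
have Qh : Q (h *: v) = Q v * h ^+ 2 by rewrite h2 mulrC.
rewrite -Lh -Qh; apply: H.
  by rewrite addrAC; apply: le_lt_trans (vnD _ _) _; lra.
rewrite vnZ -mulrA exprMn -mulrA ler_wpM2l //.
by rewrite le_eqVlt; apply/orP; left; apply/eqP; ring.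
Qed.

(** Restriction to the complex line through s1 and s. With rho = 3/2 the point z = 1 is inside, and
    |z| <= 3 keeps the line within d/4 + 3 d/4 of p. *)
Lemma identity_ball p d M g s1 e : 0 < d -> jet p d M g -> vn (s1 - p) < d / 4 -> 0 < e ->
  (forall s, vn (s - s1) < e -> g s = 0) -> forall s, vn (s - s1) < d / 4 -> g s = 0.
Proof.
move=> d0 jg sp e0 g0 s sd; set v := s - s1.
have v1 : 0 < vn v + 1 by rewrite ltr_pwDr // vn_ge0.
have -> : s = s1 + 1 *: v by rewrite scale1r /v subrKC.
apply: (@vanish_1d _ (fun w => g (s1 + w *: v)) (3 / 2) M (e / (vn v + 1))).
- by lra.
- by rewrite divr_gt0.
- move=> z z3; have zd : vn (s1 + z *: v - p) < d.
    rewrite addrAC; apply: le_lt_trans (vnD _ _) _; rewrite vnZ.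
    have : normc z * vn v <= 3 * vn v by rewrite ler_wpM2r ?vn_ge0 //; lra.
    rewrite -/v in sd; lra.
  by split; [exact: (jet_line d0 jg)|exact: (jet_bound jg)].
- move=> z; rewrite ltr_pdivlMr // => ze; apply: g0.
  rewrite addrC addKr vnZ; apply: le_lt_trans ze.
  by rewrite ler_wpM2l ?normc_ge0 // lerDl.
- by rewrite normc1; lra.
Qed.

Variable G : V -> Prop.
Hypothesis denseG : forall s e, 0 < e -> exists2 t, G t & vn (t - s) < e.

Lemma zero_on_dense p d M g s e : 0 < d -> jet p d M g -> vn (s - p) < d -> 0 < e ->
  (forall t, vn (t - s) < e -> G t -> g t = 0) -> g s = 0.
Proof.
move=> d0 jg sd e0 g0; apply/eqP; apply: contraT; rewrite -normc_gt0 => gs.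
have [e' e0' he] := jet_cont d0 jg sd gs.
have m0 : 0 < Num.min e e' by rewrite lt_min e0.
have [t Gt] := denseG s m0; rewrite lt_min => /andP[t1 t2].
by have := he t t2; rewrite g0 // sub0r normcN ltxx.
Qed.

(* Unique continuation of functions that near every point are quotients of
   holomorphic functions, with denominators nonvanishing on G. *)
Lemma identity_theorem f :
  (forall p, exists (d M : R) (g h : V -> C), [/\ 0 < d, jet p d M g &
     forall s, vn (s - p) < d -> G s -> h s * f s = g s /\ h s != 0]) ->
  forall p0 e0, 0 < e0 -> (forall s, vn (s - p0) < e0 -> G s -> f s = 0) ->
  forall p1, exists2 e, 0 < e & forall s, vn (s - p1) < e -> G s -> f s = 0.
Proof.
move=> loc p0 e0 e00 f0 p1.
(* This set is open and closed, which is then exploited along the segment from [p0] to [p1]. *)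
pose A p := exists2 e, 0 < e & forall s, vn (s - p) < e -> G s -> f s = 0.
have Aopen p : A p -> exists2 e, 0 < e & forall q, vn (q - p) < e -> A q.
  move=> [e ep he]; exists (e / 2); first by rewrite divr_gt0.
  move=> q hq; exists (e / 2); first by rewrite divr_gt0.
  move=> s hs Gs; apply: he => //.
  have -> : s - p = (s - q) + (q - p) by rewrite addrA subrK.
  by apply: le_lt_trans (vnD _ _) _; lra.
have Aclosed p : (forall e, 0 < e -> exists2 q, A q & vn (q - p) < e) -> A p.
  move=> hp; have [d [M [g [h [d0 jg hg]]]]] := loc p.
  have d4 : 0 < d / 4 by rewrite divr_gt0.
  have [q [e ep he] qp] := hp _ d4.
  (* The numerator vanishes near q on [G], hence everywhere near q by density and continuity;
     [identity_ball] then reaches p. *)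
  have gq : forall s, vn (s - q) < Num.min (e / 2) (d / 4) -> g s = 0.
    move=> s; rewrite lt_min => /andP[s1 s2].
    have spd : vn (s - p) < d / 2.
      have -> : s - p = (s - q) + (q - p) by rewrite addrA subrK.
      by apply: le_lt_trans (vnD _ _) _; lra.
    apply: (@zero_on_dense p d M g s (Num.min (e / 2) (d / 2))) => //; first by lra.
      by rewrite lt_min !divr_gt0.
    move=> t; rewrite lt_min => /andP[t1 t2] Gt.
    have tp : vn (t - p) < d.
      have -> : t - p = (t - s) + (s - p) by rewrite addrA subrK.
      by apply: le_lt_trans (vnD _ _) _; lra.
    have [<- _] := hg t tp Gt; rewrite he ?mulr0 //.
    have -> : t - q = (t - s) + (s - q) by rewrite addrA subrK.
    by apply: le_lt_trans (vnD _ _) _; lra.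
  have m0 : 0 < Num.min (e / 2) (d / 4) by rewrite lt_min d4 divr_gt0.
  have gz := identity_ball d0 jg qp m0 gq.
  exists (d / 4 - vn (q - p)); first by rewrite subr_gt0.
  move=> s sp Gs.
  have sd : vn (s - p) < d by have := vn_ge0 (q - p); lra.
  have [hf hn] := hg s sd Gs.
  apply: (mulfI hn); rewrite mulr0 hf; apply: gz.
  have -> : s - q = (s - p) - (q - p) by rewrite opprB addrA subrK.
  by apply: le_lt_trans (vnB _ _) _; lra.
pose v := p1 - p0; pose P (x : R) := A (p0 + x%:C%C *: v).
have Pdist x y : vn (p0 + x%:C%C *: v - (p0 + y%:C%C *: v)) = `|x - y| * vn v.
  rewrite opprD addrACA subrr add0r -scalerBl vnZ -rmorphB.
  by rewrite normcC.
have v1 : 0 < vn v + 1 by rewrite ltr_pwDr // vn_ge0.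
(* Connectedness of [0, 1]: the supremum satisfies [P] by closedness and equals 1 by openness. *)
pose E := [set x : R | 0 <= x <= 1 /\ forall u, 0 <= u <= x -> P u].
have E0 : E 0.
  split; first by rewrite lexx ler01.
  by move=> u /le_anti <-; exists e0 => // s; rewrite /P scale0r addr0; exact: f0.
have Eub : ubound E 1 by move=> x [/andP[]].
have hsup : has_sup E by split; [exists 0|exists 1].
pose x := sup E.
have x0 : 0 <= x by exact: sup_upper_bound.
have x1 : x <= 1 by apply: ge_sup => //; exists 0.
have Px : P x.
  apply: Aclosed => e ep.
  have d0 : 0 < e / (vn v + 1) by rewrite divr_gt0.
  have [y [/andP[y0 y1] hy] yx] := sup_adherent d0 hsup.
  exists (p0 + y%:C%C *: v); first by apply: hy; rewrite y0 lexx.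
  rewrite Pdist; have xy : y <= x by apply: sup_upper_bound => //; split=> //; apply/andP.
  rewrite distrC ger0_norm ?subr_ge0 // -/x in yx *.
  have h : (x - y) * (vn v + 1) < e by rewrite -ltr_pdivlMr //; lra.
  by apply: le_lt_trans h; rewrite ler_wpM2l ?subr_ge0 // lerDl.
have [e ep he] := Aopen _ Px.
have near u : `|u - x| * (vn v + 1) < e -> P u.
  move=> h; apply: he; rewrite Pdist; apply: le_lt_trans h.
  by rewrite ler_wpM2l // lerDl.
pose y := Num.min 1 (x + e / (vn v + 1) / 2).
have ee : 0 < e / (vn v + 1) / 2 by rewrite !divr_gt0.
have Ey : E y.
  split; first by rewrite ge_min lexx le_min ler01 /= addr_ge0 // ltW.
  move=> u /andP[u0 uy]; case: (ltP u x) => ux.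
    have xu : 0 < x - u by rewrite subr_gt0.
    have [w [_ hw] uw] := sup_adherent xu hsup.
    by apply: hw; rewrite u0 ltW //; move: uw; rewrite -/x; lra.
  apply: near; rewrite ger0_norm ?subr_ge0 // -ltr_pdivlMr //.
  have : u <= x + e / (vn v + 1) / 2 by apply: le_trans uy _; rewrite ge_min lexx orbT.
  lra.
have xy : y <= x by exact: sup_upper_bound.
have xe1 : x = 1.
  apply/le_anti; rewrite x1 /=; move: xy; rewrite /y minEle; case: ifP => // _; lra.
move: Px; rewrite /P xe1 scale1r.
by have -> : p0 + v = p1 by rewrite /v subrKC.
Qed.

End IdentityTheorem.

Lemma differentiable_of_bound (K : numFieldType) (V W : normedModType K) (f : V -> W)
    (df : {linear V -> W}) (x : V) : continuous df ->
  (forall e, 0 < e -> \forall h \near (0 : V), `|f (h + x) - (f x + df h)| <= e * `|h|) ->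
  differentiable f x.
Proof.
move=> cont h; have E : f \o shift x = cst (f x) + df +o_ 0 id by apply/eqaddoP.
by apply/diff_locallyP; rewrite (diff_unique cont E).
Qed.

(** * Comparison with the ambient topology and differentiability *)

Section TopologyBridge.
Variables (R : realType) (r : nat).
Local Notation C := (Cplx R).
Local Notation V := 'rV[C]_r.
Implicit Types (p s : V) (W : set V) (f : V -> C).

Lemma nbhs_vn p W : nbhs p W <-> exists2 d : R, 0 < d & forall s, vn (s - p) < d -> W s.
Proof.
split=> [/nbhs_ballP[e /= e0 h]|[d d0 h]].
  move: (e0); rewrite ltcE /= => /andP[/eqP ei er].
  exists (complex.Re e) => // s sd; apply: h; split=> [//|i j].
  rewrite /ball /= normr_normc ltcE /= -ei eqxx /= ord1.
  by apply: le_lt_trans sd; rewrite normcB; have := normc_le_vn (s - p) j; rewrite !mxE.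
(* Dividing by r + 1 instead of r is meaningful for r = 0 and makes the final bound strict. *)
apply/nbhs_ballP; exists (d / r.+1%:R)%:C%C.
  by rewrite /= ltcE /= eqxx /= divr_gt0.
move=> s [_ hs]; apply: h.
have hj j : normc ((s - p) 0 j) < d / r.+1%:R.
  have := hs 0 j; rewrite /ball /= normr_normc ltcE /= => /andP[_].
  by rewrite normcB !mxE.
apply: (@le_lt_trans _ _ (\sum_(j < r) d / r.+1%:R)).
  by apply: ler_sum => j _; exact: ltW.
by rewrite sumr_const card_ord -[ltLHS]mulr_natr mulrAC ltr_pdivrMr // ltr_pM2l // ltr_nat.
Qed.

Lemma open_vn W : open W <-> forall p, W p -> exists2 d : R, 0 < d & forall s, vn (s - p) < d -> W s.
Proof.
split=> [oW p Wp|h]; first by apply/nbhs_vn; exact: open_nbhs_nbhs.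
by rewrite openE => p /h/nbhs_vn.
Qed.

Lemma open_vball p (d : R) : open [set s : V | vn (s - p) < d].
Proof.
apply/open_vn => s /= sd; exists (d - vn (s - p)); first by rewrite subr_gt0.
move=> t ts; have -> : t - p = (t - s) + (s - p) by rewrite addrA subrK.
by apply: le_lt_trans (vnD _ _) _; lra.
Qed.

Lemma vn_le_norm (h : V) : (vn h)%:C%C <= r%:R * `|h|.
Proof.
have hj j : `|h 0 j| <= `|h|.
  rewrite [leRHS]/Num.norm /= mx_normE -[leLHS]nngE num_le.
  exact: (le_bigmax _ (fun i : 'I_1 * 'I_r => `|h i.1 i.2|%:nng) (0, j)).
rewrite /vn rmorph_sum mulr_natl -[X in _ *+ X]card_ord -sumr_const.
by apply: ler_sum => j _; have := hj j; rewrite normr_normc.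
Qed.

Lemma jet_differentiable p (d M : R) f s : 0 < d -> jet p d M f -> vn (s - p) < d ->
  differentiable f s.
Proof.
move=> d0 jf sd; have M0 := jet_ge0 d0 jf.
have [L [Q [h1 h2 h3 h4 h5 h6]]] := jf s sd.
have L0 : L 0 = 0.
  by have := h1 1 0 0; rewrite scale1r addr0 mul1r -[LHS]addr0 => /addrI/esym.
have Llin : linear (L : V -> C) by move=> a h k; rewrite h1.
pose LA := GRing.isLinear.Build C V C *:%R L Llin.
pose LL : {linear V -> C} := HB.pack L LA.
have LLE h : LL h = L h by [].
have cont : continuous LL.
  move=> x; apply/(@cvgrPdist_lt _ _ _ (nbhs x)) => e e0.
  move: (e0); rewrite ltcE /= => /andP[/eqP ei er].
  apply/nbhs_vn; exists (complex.Re e * d / (M + 1)).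
    by rewrite divr_gt0 ?mulr_gt0 // ltr_pwDr.
  move=> t; rewrite ltr_pdivlMr ?ltr_pwDr // => ht.
  have -> : LL x - LL t = L (x - t).
    by have := h1 (-1) t x; rewrite scaleN1r mulN1r [- t + x]addrC [- L t + _]addrC => ->.
  rewrite normr_normc ltcE /= ei eqxx /=.
  apply: le_lt_trans (h4 _) _; rewrite -vnN opprB mulrA ltr_pdivrMr //.
  have := vn_ge0 (t - x); lra.
apply: (@differentiable_of_bound C (V : normedModType C) (C : normedModType C) f LL s cont) => e e0.
move: (e0); rewrite ltcE /= => /andP[/eqP ei er].
have eE : e = (complex.Re e)%:C%C by case: (e) ei => ? ? /= ->.
set er' := complex.Re e in er eE *.
(* The division by r + 1 compensates for vn h <= r |h|; the last bound controls the quadratic part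
   and the remainder together. *)
pose d1 := Num.min (d - vn (s - p)) (Num.min d (er' / r.+1%:R * d ^+ 2 / (2 * M + 1))).
have M1 : 0 < 2 * M + 1 by rewrite ltr_pwDr // mulr_ge0.
apply/nbhs_vn; exists d1.
  by rewrite !lt_min subr_gt0 sd d0 /= divr_gt0 // mulr_gt0 ?exprn_gt0 // divr_gt0.
move=> h; rewrite subr0 !lt_min => /and3P[hh1 hh2 hh3].
have hp : vn (s + h - p) < d.
  by rewrite addrAC; apply: le_lt_trans (vnD _ _) _; lra.
have {}h6 := h6 h hp; have {}h5 := h5 h.
set x := vn h / d in h5 h6.
have x0 : 0 <= x by rewrite divr_ge0 ?vn_ge0 // ltW.
have x1 : x <= 1 by rewrite ler_pdivrMr // mul1r ltW.
have xxx : x ^+ 3 <= x ^+ 2 by rewrite exprS ler_piMl ?exprn_ge0.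
have key : normc (f (s + h) - (f s + L h)) <= er' / r.+1%:R * vn h.
  set rr := f (s + h) - f s - L h - Q h in h6.
  have -> : f (s + h) - (f s + L h) = Q h + rr by rewrite /rr; ring.
  apply: le_trans (le_normcD _ _) _.
  have hx : vn h = x * d by rewrite /x divfK // gt_eqF.
  have : x * (2 * M + 1) <= er' / r.+1%:R * d.
    move: hh3; rewrite ltr_pdivlMr // hx => hh3.
    rewrite -(ler_pM2r d0); apply: ltW.
    by move: hh3; rewrite expr2; set A := er' / _; lra.
  move=> hq.
  have := ler_wpM2l M0 xxx; have := ler_wpM2l x0 hq.
  have := exprn_ge0 2 x0; rewrite hx; move: h5 h6; set A := er' / _; lra.
rewrite /= normr_normc [h + s]addrC.
apply: (@le_trans _ _ (er' / r.+1%:R * vn h)%:C%C).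
  by rewrite lecE /= eqxx.
rewrite rmorphM; apply: (@le_trans _ _ ((er' / r.+1%:R)%:C%C * (r%:R * `|h|))).
  by apply: ler_wpM2l (vn_le_norm h); rewrite lecE /= eqxx divr_ge0 // ltW.
rewrite mulrA; apply: ler_wpM2r; first exact: normr_ge0.
rewrite eE -(rmorph_nat (real_complex R)) -rmorphM lecE /= eqxx /=.
by rewrite mulrAC ler_pdivrMr // ler_wpM2l ?ler_nat // ltW.
Qed.

End TopologyBridge.

(** * The domain of convergence *)

Section ConvergenceDomain.
Variable R : realType.
Local Notation C := (Cplx R).
Variables (a : nat -> R) (s : nat -> C).
Hypothesis a01 : forall i, 0 <= a i <= 1.

(** All indices are cut at the same K, as in [zeta_partial], whereas [RR] takes iterated limits. *)
Fixpoint nested_sum (F : nat -> nat -> C) (K i n : nat) : C :=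
  if i is i'.+1 then \sum_(n <= j < K) F i' j.+1 * nested_sum F K i' j.+1 else 1.

Let F i n : C := (cpow (n%:R + a i) (s i))^-1.

(** For N = 0 there is no expansion, and the remainders are the plain iterated series. *)
Lemma RR0S B i n : RR B a 0 (@lam1 R) (mu1 s) s i.+1 n =
  clim (fun K => \sum_(n <= j < K) F i j.+1 * RR B a 0 (@lam1 R) (mu1 s) s i j.+1).
Proof.
rewrite RRS; apply: clim_ext => K; apply: eq_bigr => j _.
by rewrite /Rterm /Ebr /Gsum !big_geq // mulr0 !subr0 /lam1 mul1r.
Qed.

Lemma F_bound i : exists2 c, 0 <= c & forall j, normc (F i j.+1) <= c * W (complex.Re (s i)) j.
Proof.
have /andP[a0 a1] := a01 i.
exists (expR (`|complex.Re (s i)| * ln 2)); first exact: expR_ge0.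
move=> j; rewrite /F normcV normc_cpow -expRN; apply: W_cmp_nat.
rewrite lerDl a0 /= mulr2n mulrDl mul1r lerD2l.
by apply: le_trans a1 _; rewrite ler1n.
Qed.

(** Uniform in K: this is the domination that [tannery] asks for. *)
Lemma nested_sum_bound m : (forall i, (i < m)%N -> complex.Re (ee s i.+1) < 0) ->
  forall i, (i <= m)%N -> exists2 c, 0 <= c & forall K n,
    normc (nested_sum F K i n) <= c * W (- complex.Re (ee s i)) n.
Proof.
move=> hs; elim=> [_|i IH im].
  exists 1 => // K n; rewrite normc1 /ee big_geq // subr0 /W /= oppr0 mul0r oppr0 expR0.
  by rewrite mulr1.
have [c c0 hc] := IH (ltnW im); have [c' c0' hc'] := F_bound i.
set rho := - complex.Re (ee s i).
pose c1 := expR (`|rho| * ln 2).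
have rhoS : - complex.Re (ee s i.+1) = complex.Re (s i) + rho - 1.
  have : complex.Re (ee s i) = complex.Re (ee s i.+1) - 1 + complex.Re (s i).
    by rewrite (eeS s i); case: (ee s i.+1) => ? ?; case: (s i) => ? ?.
  by rewrite /rho; lra.
have r1 : 1 < complex.Re (s i) + rho by have := hs i im; lra.
have t0 : 0 <= 1 + (complex.Re (s i) + rho - 1)^-1.
  by rewrite addr_ge0 // invr_ge0 subr_ge0 ltW.
exists (c' * (c * c1) * (1 + (complex.Re (s i) + rho - 1)^-1)).
  by rewrite !mulr_ge0 // expR_ge0.
move=> K n; rewrite rhoS /=; apply: le_trans (normc_sum _ _ _) _.
rewrite -mulrA; apply: le_trans (ler_wpM2l _ (W_tail n K r1)); last first.
  by rewrite !mulr_ge0 // expR_ge0.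
rewrite mulr_sumr; apply: ler_sum => j _; rewrite normcM WD.
have -> : c' * (c * c1) * (W (complex.Re (s i)) j * W rho j) =
  (c' * W (complex.Re (s i)) j) * (c * (c1 * W rho j)) by ring.
apply: ler_pM; rewrite ?normc_ge0 //.
by apply: le_trans (hc _ _) _; rewrite ler_wpM2l // W_succ.
Qed.

Lemma nested_sum_cvg B m : (forall i, (i < m)%N -> complex.Re (ee s i.+1) < 0) ->
  forall i, (i <= m)%N -> forall n,
    ctends (fun K => nested_sum F K i n) (RR B a 0 (@lam1 R) (mu1 s) s i n).
Proof.
move=> hs; elim=> [_ n|i IH im n]; first exact: ctends_cst.
have [c c0 hc] := nested_sum_bound hs (ltnW im); have [c' c0' hc'] := F_bound i.
set rho := - complex.Re (ee s i) in hc.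
pose c1 := expR (`|rho| * ln 2).
have rhoS : - complex.Re (ee s i.+1) = complex.Re (s i) + rho - 1.
  have : complex.Re (ee s i) = complex.Re (ee s i.+1) - 1 + complex.Re (s i).
    by rewrite (eeS s i); case: (ee s i.+1) => ? ?; case: (s i) => ? ?.
  by rewrite /rho; lra.
have r1 : 1 < complex.Re (s i) + rho by have := hs i im; lra.
pose w j := c' * (c * c1) * W (complex.Re (s i) + rho) j.
have uw K j : normc (F i j.+1 * nested_sum F K i j.+1) <= w j.
  rewrite normcM /w WD.
  have -> : c' * (c * c1) * (W (complex.Re (s i)) j * W rho j) =
    (c' * W (complex.Re (s i)) j) * (c * (c1 * W rho j)) by ring.
  apply: ler_pM; rewrite ?normc_ge0 //.
  by apply: le_trans (hc _ _) _; rewrite ler_wpM2l // W_succ.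
have wB K : \sum_(n <= j < K) w j <=
    c' * (c * c1) * ((1 + (complex.Re (s i) + rho - 1)^-1) * W (complex.Re (s i) + rho - 1) n).
  rewrite -mulr_sumr; apply: ler_wpM2l (W_tail n K r1).
  by rewrite !mulr_ge0 // expR_ge0.
have uv j : ctends (fun K => F i j.+1 * nested_sum F K i j.+1)
    (F i j.+1 * RR B a 0 (@lam1 R) (mu1 s) s i j.+1).
  by apply: ctendsZ; exact: IH (ltnW im) _.
have vw j : normc (F i j.+1 * RR B a 0 (@lam1 R) (mu1 s) s i j.+1) <= w j.
  by apply: (ctends_le (N := 0%N) _ (uv j)) => K _; exact: uw.
have [z hz] : exists z, ctends (fun K => \sum_(n <= j < K)
    F i j.+1 * RR B a 0 (@lam1 R) (mu1 s) s i j.+1) z.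
  by apply: (abs_series_cvg (B := _)) => K; apply: le_trans (wB K); exact: ler_sum.
rewrite RR0S (climE hz).
exact: (tannery uw wB uv hz).
Qed.

Lemma sum_decreasing (G : nat -> nat -> C) (K i n : nat) :
  \sum_(f : {ffun 'I_i -> 'I_K.+1} | [forall k, (n < f k)%N] &&
     [forall k : 'I_i, forall l : 'I_i, (k < l)%N ==> (f l < f k)%N])
    \prod_(k < i) G k (f k) = nested_sum G K i n.
Proof.
elim: i n => [|i IH] n.
  rewrite (big_pred1 [ffun _ => ord0]) => [|f /=]; first by rewrite big_ord0.
  transitivity true; last by apply/esym/eqP/ffunP => -[].
  by apply/andP; split; apply/forallP => -[].
(* Splits off the last entry, which is the smallest; the others form a decreasing tuple above it. *)
pose h (mg : 'I_K.+1 * {ffun 'I_i -> 'I_K.+1}) : {ffun 'I_i.+1 -> 'I_K.+1} :=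
  [ffun k => oapp mg.2 mg.1 (unlift ord_max k)].
have hmax mg : h mg ord_max = mg.1 by rewrite ffunE unlift_none.
have hlift mg k : h mg (lift ord_max k) = mg.2 k by rewrite ffunE liftK.
rewrite (reindex h); last first.
  exists (fun f : {ffun 'I_i.+1 -> 'I_K.+1} => (f ord_max, [ffun k : 'I_i => f (lift ord_max k)] : {ffun 'I_i -> 'I_K.+1})) => [[m g] _|f _].
    by rewrite hmax; congr pair; apply/ffunP => k; rewrite ffunE hlift.
  apply/ffunP => k; rewrite ffunE; case: unliftP => [j ->|->] //=.
  by rewrite ffunE.
transitivity (\sum_(mg : 'I_K.+1 * {ffun 'I_i -> 'I_K.+1} | (n < mg.1)%N &&
    ([forall k, (mg.1 < mg.2 k)%N] && [forall k : 'I_i, forall l : 'I_i, (k < l)%N ==> (mg.2 l < mg.2 k)%N]))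
   G i mg.1 * \prod_(k < i) G k (mg.2 k)).
  apply: eq_big => [mg|mg _].
    apply/idP/idP.
      move=> /andP[/forallP h1 /forallP h2]; apply/and3P; split.
      - by have := h1 ord_max; rewrite hmax.
      - apply/forallP => k; have /forallP/(_ ord_max)/implyP := h2 (lift ord_max k).
        by rewrite hmax hlift; apply; rewrite lift_max.
      apply/forallP => k; apply/forallP => l; apply/implyP => kl.
      have /forallP/(_ (lift ord_max l))/implyP := h2 (lift ord_max k).
      by rewrite !hlift; apply; rewrite !lift_max.
    move=> /and3P[h1 /forallP h2 /forallP h3]; apply/andP; split.
      apply/forallP => k; case: (unliftP ord_max k) => [j ->|->]; last by rewrite hmax.
      by rewrite hlift; exact: ltn_trans (h2 j).
    apply/forallP => k; apply/forallP => l; apply/implyP.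
    case: (unliftP ord_max k) => [j ->|->]; last first.
      by move=> /= kl; have := ltn_ord l; rewrite ltnS leqNgt kl.
    case: (unliftP ord_max l) => [j' ->|->]; last by rewrite hmax hlift.
    rewrite !hlift !lift_max => jj; have /forallP/(_ j')/implyP := h3 j.
    exact.
  rewrite big_ord_recr /= hmax mulrC; congr (_ * _); apply: eq_bigr => k _.
  have -> : widen_ord (leqnSn i) k = lift ord_max k by apply/ord_inj; rewrite lift_max.
  by rewrite hlift.
rewrite -(pair_big_dep (fun m : 'I_K.+1 => (n < m)%N)
   (fun (m : 'I_K.+1) (g : {ffun 'I_i -> 'I_K.+1}) => [forall k, (m < g k)%N] &&
      [forall k : 'I_i, forall l : 'I_i, (k < l)%N ==> (g l < g k)%N])
   (fun m g => G i m * \prod_(k < i) G k (g k))) /=.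
under eq_bigr => m _ do rewrite -mulr_sumr IH.
rewrite -(big_mkord (fun m => (n < m)%N) (fun m => G i m * nested_sum G K i m)).
rewrite big_mkcond big_nat_recl //= add0r -big_mkcond /=.
case: (leqP n K) => nK; last first.
  by rewrite [RHS]big_geq ?(ltnW nK) // big_nat_cond big1 // => j; lia.
rewrite (@big_cat_nat _ _ _ n) //= big_nat_cond big1 ?add0r; last by move=> j; lia.
by rewrite big_nat_cond [RHS]big_nat_cond; apply: eq_bigl => j; lia.
Qed.

End ConvergenceDomain.

(** * Nonvanishing *)

Section GenericPoints.
Variables (R : realType) (r : nat).
Local Notation C := (Cplx R).
Local Notation V := 'rV[C]_r.
Implicit Types (p s v : V).

(** The variables from i0 on, continued by 0; the offset is for the shorter zeta functions that
    appear as residues. *)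
Definition crd (i0 : nat) s (j : nat) : C :=
  if insub (i0 + j)%N is Some k then s 0 k else 0.

Lemma crdE s (j : 'I_r) : crd 0 s j = s 0 j.
Proof. by rewrite /crd add0n valK. Qed.

Lemma affine_crd i0 j : affine (fun s => crd i0 s j).
Proof.
by rewrite /crd; case: insubP => [k _ _|_]; [exact: affine_coord|exact: affine_cst].
Qed.

Lemma crd_shift i0 s j : crd 0 s (i0 + j) = crd i0 s j.
Proof. by []. Qed.

Lemma crdD s h j : crd 0 (s + h) j = crd 0 s j + crd 0 h j.
Proof. by rewrite /crd; case: insubP => [k _ _|_]; rewrite ?mxE ?addr0. Qed.

Lemma crdZ (z : C) h j : crd 0 (z *: h) j = z * crd 0 h j.
Proof. by rewrite /crd; case: insubP => [k _ _|_]; rewrite ?mxE ?mulr0. Qed.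

(* Dense, and disjoint from the possible polar hyperplanes of every tail of the
   multiple sum. *)
Definition D0 s : Prop := forall i j, (i < j <= r)%N ->
  complex.Im (\sum_(i <= k < j) crd 0 s k) != 0.

Lemma ImD (z w : C) : complex.Im (z + w) = complex.Im z + complex.Im w.
Proof. by case: z => ? ?; case: w. Qed.

Lemma ReD (z w : C) : complex.Re (z + w) = complex.Re z + complex.Re w.
Proof. by case: z => ? ?; case: w. Qed.

Lemma ImN (z : C) : complex.Im (- z) = - complex.Im z.
Proof. by case: z. Qed.

Lemma Im_nat n : complex.Im (n%:R : C) = 0.
Proof. by rewrite -(rmorph_nat (real_complex R)). Qed.

Lemma Re_nat n : complex.Re (n%:R : C) = n%:R.
Proof. by rewrite -(rmorph_nat (real_complex R)). Qed.

Lemma D0_dense s (e : R) : 0 < e -> exists2 t, D0 t & vn (t - s) < e.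
Proof.
move=> e0.
pose v : V := \row_j 'i%C.
have vv : 0 < vn v + 1 by rewrite ltr_pwDr // vn_ge0.
pose x n : R := e / (vn v + 1) / n.+2%:R.
pose ims i j := complex.Im (\sum_(i <= k < j) crd 0 s k).
(* Adding x to the imaginary part of every coordinate changes these sums by (j - i) x, so the bad x
   are roots of one nonzero polynomial, and the sequence [x] takes infinitely many values. *)
pose P : {poly R} := \prod_(i < r.+1) \prod_(j < r.+1 | (i < j)%N)
  ((ims i j)%:P + (j - i)%:R *: 'X).
have P0 : P != 0.
  apply/prodf_neq0 => i _; apply/prodf_neq0 => j ij.
  apply: contraTneq ij => /(congr1 (fun q : {poly R} => q`_1)).
  rewrite coefD coefC coefZ coefX /= add0r mulr1 coef0 => /eqP.
  by rewrite pnatr_eq0 subn_eq0 -leqNgt.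
have [n Pn] : exists n, P.[x n] != 0.
  apply: contrapT => /forallNP H; move/eqP: P0; apply.
  apply: (@poly_inf_roots _ _ x) => [n m|n]; last by rewrite rootE; have /negP := H n; rewrite negbK.
  move=> /(mulfI _)/invr_inj/eqP; rewrite eqr_nat => h; apply/eqP; move: h; rewrite !eqSS; apply.
  by rewrite gt_eqF // divr_gt0.
have x0 : 0 < x n by rewrite !divr_gt0.
exists (s + (x n)%:C%C *: v); last first.
  rewrite addrC addKr vnZ normcC gtr0_norm //.
  have h1 : x n * (vn v + 1) = e / n.+2%:R.
    by rewrite /x mulrAC divfK // gt_eqF.
  have h2 : e / n.+2%:R < e by rewrite ltr_pdivrMr // ltr_pMr // ltr1n.
  move: h1 h2 x0; rewrite mulrDr mulr1; move: (x n) (e / n.+2%:R) => y w.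
  by lra.
move=> i j /andP[ij jr].
have -> : complex.Im (\sum_(i <= k < j) crd 0 (s + (x n)%:C%C *: v) k) = ims i j + (j - i)%:R * x n.
  have -> : \sum_(i <= k < j) crd 0 (s + (x n)%:C%C *: v) k =
     \sum_(i <= k < j) crd 0 s k + (j - i)%:R * ((x n)%:C%C * 'i%C).
    rewrite mulr_natl -sumr_const_nat -big_split /=; apply: eq_big_nat => k /andP[_ kj].
    rewrite crdD crdZ; congr (_ + _ * _).
    by rewrite /crd insubT ?(leq_trans kj) // => kr; rewrite mxE.
  rewrite ImD; congr (_ + _).
  by rewrite mulrA -(rmorph_nat (real_complex R)) -(rmorphM (real_complex R)); simpc.
have i1 : (i < r.+1)%N by rewrite ltnS (leq_trans (ltnW ij)).
have j1 : (j < r.+1)%N by rewrite ltnS.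
move: Pn; rewrite /P horner_prod => /prodf_neq0/(_ (Ordinal i1) isT).
rewrite horner_prod => /prodf_neq0/(_ (Ordinal j1) ij) /=.
by rewrite hornerD hornerC hornerZ hornerX.
Qed.

Lemma D0_near s : D0 s -> exists2 d : R, 0 < d & forall t, vn (t - s) < d -> D0 t.
Proof.
move=> hs.
have [|i ir|d d0 hd] := @fin_ball R r (fun i d => forall t, vn (t - s) < d ->
   forall j, (i < j <= r)%N -> complex.Im (\sum_(i <= k < j) crd 0 t k) != 0).
- by move=> i d d' h /andP[_ dd] t td; apply: h; exact: lt_le_trans dd.
- have [|j jr|d d0 hd] := @fin_ball R r.+1 (fun j d => forall t, vn (t - s) < d ->
    (i < j)%N -> complex.Im (\sum_(i <= k < j) crd 0 t k) != 0).
  + by move=> j d d' h /andP[_ dd] t td; apply: h; exact: lt_le_trans dd.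
  + case: (ltnP i j) => ij; last by exists 1.
    have n0 : complex.Im (\sum_(i <= k < j) crd 0 s k) != 0 by apply: hs; rewrite ij.
    have e0 : 0 < `|complex.Im (\sum_(i <= k < j) crd 0 s k)| by rewrite normr_gt0.
    have af : affine (fun t => \sum_(i <= k < j) crd 0 t k).
      by apply: affine_sum => k _; exact: affine_crd.
    have [d d0 hd] := affine_near s af e0.
    exists d => // t /hd h _; apply/eqP => E.
    have := Im_le_normc (\sum_(i <= k < j) crd 0 t k - \sum_(i <= k < j) crd 0 s k).
    by rewrite ImD ImN E sub0r normrN => /le_lt_trans/(_ h); rewrite ltxx.
  by exists d => // t td j /andP[ij jr]; apply: hd.
exists d => // t td i j ij; apply: hd => //.
by case/andP: ij => h1 h2; exact: leq_trans h2.
Qed.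

Lemma ee_Im s i : (0 < i <= r)%N -> D0 s -> complex.Im (ee (crd 0 s) i) != 0.
Proof.
by move=> ir /(_ 0%N i ir); rewrite /ee ImD ImN Im_nat sub0r oppr_eq0.
Qed.

Lemma ee_crd_Im s i0 i : (0 < i)%N -> (i0 + i <= r)%N -> D0 s ->
  complex.Im (ee (crd i0 s) i) != 0.
Proof.
move=> i_gt0 ir /(_ i0 (i0 + i)%N); rewrite ir andbT -{1}[i0]addn0 ltn_add2l => /(_ i_gt0).
rewrite /ee ImD ImN Im_nat sub0r oppr_eq0 -{1}[i0]add0n big_addn addKn.
by under eq_bigr do rewrite addnC crd_shift.
Qed.

Lemma Im_neq0 (z : C) : complex.Im z != 0 -> z != 0.
Proof. by apply: contra_neq => ->. Qed.

Lemma poch_Im_neq0 (z : C) j : complex.Im z != 0 -> poch z j != 0.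
Proof.
move=> hz; apply/prodf_neq0 => i _; apply: Im_neq0.
by rewrite ImD Im_nat addr0.
Qed.

Lemma poly_local_zero (O : V -> Prop) s v (P : {poly C}) :
  (exists2 d : R, 0 < d & forall t, vn (t - s) < d -> O t) ->
  (forall z, O (s + z *: v) -> P.[z] = 0) -> P = 0.
Proof.
move=> [d d0 hd] hP.
have vv : 0 < vn v + 1 by rewrite ltr_pwDr // vn_ge0.
pose x n : R := d / (vn v + 1) / n.+1%:R.
have q0 : 0 < d / (vn v + 1) by rewrite divr_gt0.
apply: (@poly_inf_roots _ _ (fun n => (x n)%:C%C)) => [n m|n].
  move=> /(fmorph_inj (real_complex R))/(mulfI (lt0r_neq0 q0))/invr_inj/eqP.
  by rewrite eqr_nat eqSS => /eqP.
rewrite rootE; apply/eqP/hP/hd; rewrite addrC addKr vnZ normcC.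
have xn0 : 0 <= x n by rewrite divr_ge0 // ltW.
rewrite (ger0_norm xn0).
apply: (@le_lt_trans _ _ (d / (vn v + 1) * vn v)).
  by rewrite ler_wpM2r ?vn_ge0 // ler_pdivrMr // ler_peMr ?(ltW q0) // ler1n.
by rewrite mulrAC ltr_pdivrMr // ltr_pM2l // ltrDl.
Qed.

Variables (B : nat -> {poly R}) (a : nat -> R).
Hypothesis hB : bernoulli_polynomials B.
Hypothesis a01 : forall i, 0 <= a i < 1.
Local Notation cs s i := (cc B a (@lam1 R) (mu1 (crd 0 s)) (crd 0 s) i).

(* The l for which cc i l is not identically zero. *)
Definition pol (i l : nat) : bool :=
  match i with 0%N => l == 0%N | 1%N => bern B (a 1%N - a 0%N) l != 0 | _ => true end.

Lemma cc1 lam mu (s : nat -> C) l : (0 < l)%N ->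
  cc B a lam mu s 1 l = lam 0%N * bern_coef B (a 1%N - a 0%N) l (1 - ee s 1).
Proof.
move=> l0; rewrite ccS /cnext /= gtn_eqF // mulr0 addr0; congr (_ * _).
rewrite big_ltn // big_nat_cond big1 => [|[|k]] //; last by rewrite mul0r.
by rewrite addr0 eqxx mul1r subn0 addr0.
Qed.

Lemma npol lam mu (s : nat -> C) i l : ~~ pol i l -> cc B a lam mu s i l = 0.
Proof.
case: i => [|[|i]] //; first by move=> /negPf /= ->.
rewrite [pol _ _]/= negbK => /eqP bl.
have l0 : (0 < l)%N by case: l bl => // /eqP; rewrite bern0 // oner_eq0.
by rewrite (cc1 _ _ _ l0) /bern_coef bl mul0r mulr0.
Qed.

Lemma cc_ext (lam lam' : nat -> C) mu mu' (s s' : nat -> C) i l :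
  (forall j, (j < i)%N -> [/\ lam j = lam' j, mu j =1 mu' j & s j = s' j]) ->
  cc B a lam mu s i l = cc B a lam' mu' s' i l.
Proof.
elim: i l => [//|i IH] l h.
have eE : ee s i.+1 = ee s' i.+1.
  by rewrite /ee; congr (_ - _); apply: eq_big_nat => j /andP[_ /h[]].
have hc k : cc B a lam mu s i k = cc B a lam' mu' s' i k.
  by apply: IH => j ji; apply: h; exact: leqW.
have [hl hm _] := h i (ltnSn i).
rewrite !ccS /cnext eE hc hl hm; congr (_ * _ + _).
by apply: eq_bigr => k _; rewrite hc.
Qed.

Lemma cc_local (s s' : nat -> C) i l : (forall j, (j < i)%N -> s j = s' j) ->
  cc B a (@lam1 R) (mu1 s) s i l = cc B a (@lam1 R) (mu1 s') s' i l.
Proof.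
move=> h; apply: cc_ext => j ji; split=> //; last exact: h.
move=> k; rewrite /mu1 /ee; congr ((_ - (_ - _))^-1).
by apply: eq_big_nat => n /andP[_ nj]; apply: h; exact: leq_trans ji.
Qed.

Lemma cc1_neq0 s l : (0 < r)%N -> D0 s -> bern B (a 1%N - a 0%N) l != 0 -> cs s 1 l != 0.
Proof.
move=> r0 hs bl; have hI := @ee_Im s 1 r0 hs.
case: l bl => [|l] bl.
  rewrite ccS /cnext big_geq // mulr0 add0r (_ : cc _ _ _ _ _ 0 0 = 1) // mulr1 /mu1 invr_eq0.
  by apply: Im_neq0; rewrite ImD ImN Im_nat sub0r oppr_eq0.
rewrite cc1 // /lam1 mul1r /bern_coef mulf_neq0 //.
  by rewrite (fmorph_eq0 (real_complex R)).
by apply: poch_Im_neq0; rewrite ImD ImN (Im_nat 1) sub0r oppr_eq0.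
Qed.

Definition pochp (c : C) (j : nat) : {poly C} := \prod_(i < j) ('X + (c + i%:R)%:P).

Lemma pochpE c j z : (pochp c j).[z] = poch (z + c) j.
Proof.
by rewrite /pochp horner_prod; apply: eq_bigr => i _; rewrite hornerD hornerX hornerC addrA.
Qed.

Lemma ee_dir s z v i : ee (crd 0 (s + z *: v)) i = ee (crd 0 s) i - z * \sum_(0 <= j < i) crd 0 v j.
Proof.
rewrite /ee; under eq_bigr do rewrite crdD crdZ.
by rewrite big_split /= -mulr_sumr; ring.
Qed.

(** Along the coordinate s_i the coefficients of level i are constant and, multiplied by l - ee,
    c_(i+1)(l) is a polynomial in z. It vanishes identically, and its value at z = E - l is
    c_i(l). *)
Lemma cc_zero_down (O : V -> Prop) i l : (i < r)%N ->
  (forall s, O s -> exists2 d : R, 0 < d & forall t, vn (t - s) < d -> O t) ->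
  (forall s, O s -> D0 s) -> (forall s, O s -> cs s i.+1 l = 0) ->
  forall s, O s -> cs s i l = 0.
Proof.
move=> ir oO hO c0 s Os.
pose v : V := delta_mx 0 (Ordinal ir).
have vj j : crd 0 v j = (j == i)%:R.
  rewrite /crd; case: insubP => [k _ kj|].
    by rewrite mxE eqxx /= -val_eqE /= kj add0n.
  by rewrite add0n -leqNgt => rj; rewrite gtn_eqF // (leq_trans ir).
have vs : \sum_(0 <= j < i.+1) crd 0 v j = 1.
  rewrite big_nat_recr //= vj eqxx big_nat_cond big1 ?add0r // => j /andP[/andP[_ ji] _].
  by rewrite vj ltn_eqF.
set E := ee (crd 0 s) i.+1.
have cz z k : cs (s + z *: v) i k = cs s i k.
  by apply: cc_local => j ji; rewrite crdD crdZ vj ltn_eqF // mulr0 addr0.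
pose P : {poly C} := ('X + (l%:R - E)%:P) * (\sum_(0 <= k < l) (cs s i k *
   (bern B (a i.+1 - a i) (l - k))%:C%C) *: pochp (1 - E + k%:R) (l - k).-1) + (cs s i l)%:P.
have PE z : P.[z] = (z + (l%:R - E)) * (\sum_(0 <= k < l) cs s i k *
     bern_coef B (a i.+1 - a i) (l - k) (1 - (E - z) + k%:R)) + cs s i l.
  rewrite /P hornerD hornerM hornerC hornerD hornerX hornerC horner_sum.
  congr (_ * _ + _); apply: eq_bigr => k _; rewrite hornerZ pochpE -mulrA /bern_coef.
  by congr (_ * (_ * poch _ _)); ring.
suff P0 : P = 0.
  have := PE (E - l%:R); rewrite P0 horner0.
  have -> : E - l%:R + (l%:R - E) = 0 by ring.
  by rewrite mul0r add0r => <-.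
apply: (@poly_local_zero O s v P (oO s Os)) => z Oz.
have eez : ee (crd 0 (s + z *: v)) i.+1 = E - z by rewrite ee_dir vs mulr1.
have lz : l%:R - (E - z) != 0.
  apply: Im_neq0; rewrite ImD ImN Im_nat sub0r oppr_eq0 -eez.
  by apply: ee_Im => //; exact: hO.
have := c0 _ Oz; rewrite ccS /cnext /mu1 eez /lam1 mul1r cz.
under eq_bigr do rewrite cz.
move=> h; rewrite PE; set T := \sum_(0 <= k < l) _ in h *.
have -> : T = - ((l%:R - (E - z))^-1 * cs s i l) by apply/eqP; rewrite -addr_eq0 h.
have -> : z + (l%:R - E) = l%:R - (E - z) by ring.
by rewrite mulrN mulrA divff // mul1r addNr.
Qed.

Lemma cc_nonvanish i l (O : V -> Prop) : (i < r)%N -> pol i l ->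
  (exists s, O s) ->
  (forall s, O s -> exists2 d : R, 0 < d & forall t, vn (t - s) < d -> O t) ->
  (forall s, O s -> D0 s) -> exists2 s, O s & cs s i l != 0.
Proof.
move=> ir pil [s0 Os0] oO hO; apply: contrapT => H.
have c0 s : O s -> cs s i l = 0.
  by move=> Os; apply/eqP; apply: contrapT => /negP n; apply: H; exists s.
case: i ir pil c0 {H} => [|[|i]] ir pil c0.
- by have := c0 _ Os0; rewrite /= (eqP pil) => /eqP; rewrite eqxx oner_eq0.
- have := cc1_neq0 (ltnW ir) (hO _ Os0) pil.
  by rewrite c0 ?eqxx.
have c2 : forall s, O s -> cs s 2 l = 0.
  elim: i ir c0 {pil} => [|i IH] ir c0 //; apply: IH; first exact: ltnW.
  by apply: cc_zero_down c0 => //; exact: ltnW.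
have r2 : (2 < r)%N by exact: leq_trans ir.
have r0 : (0 < r)%N by exact: leq_trans r2.
have r1 : (1 < r)%N by exact: leq_trans r2.
have c1 := cc_zero_down r1 oO hO c2.
set b1 := a 1%N - a 0%N; set b2 := a 2%N - a 1%N.
have b1l : bern B b1 l = 0.
  apply/eqP; apply: contraT => n.
  by have := cc1_neq0 r0 (hO _ Os0) n; rewrite c1 ?eqxx.
have l0 : (0 < l)%N by case: (l) b1l => // /eqP; rewrite bern0 // oner_eq0.
set s := s0 in Os0.
(* This direction moves [ee] at 1 and fixes it at 2, so only the factors coming from c_1 vary. *)
pose v : V := delta_mx 0 (Ordinal r0) - delta_mx 0 (Ordinal r1).
have v0 : crd 0 v 0 = 1.
  by rewrite -[0%N]/(nat_of_ord (Ordinal r0)) crdE !mxE /= subr0.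
have v1 : crd 0 v 1 = -1.
  by rewrite -[1%N]/(nat_of_ord (Ordinal r1)) crdE !mxE /= sub0r.
set x := crd 0 s 0; set E := ee (crd 0 s) 2.
have e1 z : ee (crd 0 (s + z *: v)) 1 = 1 - (x + z).
  by rewrite ee_dir big_nat1 v0 /ee big_nat1 -/x; ring.
have e2 z : ee (crd 0 (s + z *: v)) 2 = E.
  by rewrite ee_dir -/E !big_nat_recr //= big_geq // v0 v1; ring.
pose A k : C := (bern B b1 k)%:C%C * bern_coef B b2 (l - k) (1 - E + k%:R).
(* This is c_2(l) times x + z - 1, the denominator of c_1(0), written in rising factorials of z. *)
pose P : {poly C} := \sum_(0 <= k < l) A k *: pochp (x - 1) k.
have P0 : P = 0.
  apply: (@poly_local_zero O s v P (oO s Os0)) => z Oz.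
  have hz := hO _ Oz.
  have xz : x + z - 1 != 0.
    have := @ee_Im _ 1 r0 hz; rewrite e1 => /Im_neq0.
    by apply: contra_neq => h; rewrite -[LHS]opprK opprB h oppr0.
  have := c2 _ Oz; rewrite ccS /cnext [lam1 R 1]/lam1 mul1r (c1 _ Oz) mulr0 addr0 e2 => h.
  rewrite -[RHS](mulr0 (x + z - 1)) -[X in _ = _ * X]h mulr_sumr.
  rewrite /P horner_sum; apply: eq_big_nat => k /andP[_ kl].
  have -> : (A k *: pochp (x - 1) k).[z] = (bern B b1 k)%:C%C * poch (x + z - 1) k *
      bern_coef B b2 (l - k) (1 - E + k%:R).
    rewrite hornerZ pochpE /A mulrAC; congr (_ * poch _ _ * _); ring.
  rewrite -/b2 [RHS]mulrA; congr (_ * bern_coef B b2 (l - k) (1 - E + k%:R)).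
  case: k kl => [|k] kl.
    rewrite bern0 // rmorph1 mul1r {1}/poch big_ord0 ccS /cnext big_geq // mulr0 add0r.
    rewrite (_ : cc _ _ _ _ _ 0 0 = 1) // mulr1 /mu1 e1.
    by rewrite (_ : 0%:R - (1 - (x + z)) = x + z - 1) ?divff //; ring.
  rewrite cc1 // /lam1 mul1r /bern_coef -/b1 e1 /= mulrCA; congr (_ * _).
  rewrite -add1n pochD {1}/poch big_ord1 addr0; congr (_ * poch _ _); ring.
(* A triangular system: at z = 1 - x - m the rising factorials of index above m vanish and that of
   index m does not. *)
have AE m : (m < l)%N -> A m = 0.
  elim/ltn_ind: m => m IH ml.
  have : P.[1 - x - m%:R] = 0 by rewrite P0 horner0.
  rewrite /P horner_sum big_mkord (bigD1 (Ordinal ml)) //= big1 ?addr0; last first.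
    move=> k; rewrite -val_eqE /= => km; case: (ltngtP k m) km => // km _.
      by rewrite IH ?scale0r ?horner0.
    rewrite hornerZ pochpE.
    have -> : 1 - x - m%:R + (x - 1) = - m%:R by ring.
    by rewrite /poch (bigD1 (Ordinal km)) //= addNr mul0r mulr0.
  rewrite hornerZ pochpE.
  have -> : 1 - x - m%:R + (x - 1) = - m%:R by ring.
  move/eqP; rewrite mulf_eq0 => /orP[/eqP //|].
  rewrite /poch => /eqP h; have /prodf_neq0 : forall k : 'I_m, true -> (- m%:R + k%:R : C) != 0.
    by move=> k _; rewrite addrC subr_eq0 eqr_nat ltn_eqF.
  by rewrite h eqxx.
have [k kl] := bern_nonvanish hB l (a01 0%N) (a01 1%N) (a01 2%N).
rewrite -/b1 -/b2 leq_eqVlt in kl *.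
move: kl => /predU1P[->|kl]; first by rewrite b1l mul0r eqxx.
have := AE k kl; rewrite /A /bern_coef mulrA => /eqP; rewrite mulf_eq0 => /orP[|].
  by rewrite -rmorphM (fmorph_eq0 (real_complex R)) => ->.
move=> /eqP h _; have : poch (1 - E + k%:R) (l - k).-1 != 0.
  apply: poch_Im_neq0; rewrite !ImD ImN !Im_nat addr0 (Im_nat 1) sub0r oppr_eq0.
  by apply: ee_Im => //; exact: hO.
by rewrite h eqxx.
Qed.

End GenericPoints.

(** * Nonvanishing of the shorter zeta functions *)

Section NonVanishing.
Variables (R : realType) (r : nat).
Local Notation C := (Cplx R).
Local Notation V := 'rV[C]_r.
Variable B : nat -> {poly R}.
Hypothesis hB : bernoulli_polynomials B.
Implicit Types (p s : V).

(** In the order of [R[i]], 0 < c means real and positive. The bound is the contribution of the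
    single chain n + 1, ..., n + i. *)
Lemma nested_sum_pos (F : nat -> nat -> C) i n : (forall j n, (j < i)%N -> 0 < F j n.+1) ->
  exists2 c : C, 0 < c & forall K, (n + i <= K)%N -> c <= nested_sum F K i n.
Proof.
elim: i n => [|i IH] n F0; first by exists 1; [exact: ltr01|move=> K _ /=; exact: lexx].
have ge0 K k : (k <= i)%N -> forall n, 0 <= nested_sum F K k n.
  elim: k => [|k IHk] ki n' /=; first exact: ler01.
  by apply: sumr_ge0 => j _; rewrite mulr_ge0 ?IHk ?(ltnW ki) // ltW // F0 // ltnW.
have [|c c0 hc] := IH n.+1; first by move=> j k ji; apply: F0; exact: leqW.
exists (F i n.+1 * c); first by rewrite mulr_gt0 // F0.
move=> K nK; have lt_nK : (n < K)%N by lia.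
rewrite /= big_ltn //; apply: le_trans (_ : _ <= F i n.+1 * nested_sum F K i n.+1) _.
  by apply: ler_wpM2l; [exact/ltW/F0|apply: hc; lia].
by rewrite lerDl; apply: sumr_ge0 => j _; rewrite mulr_ge0 ?ge0 // ltW ?F0.
Qed.

Lemma ctends_neq0 (u : nat -> C) (z c : C) (N : nat) : 0 < c ->
  (forall K, (N <= K)%N -> c <= u K) -> ctends u z -> z != 0.
Proof.
move=> c0 cu uz; apply/eqP => z0; move: uz; rewrite z0.
have cr : 0 < complex.Re c by move: c0; rewrite ltcE /= => /andP[].
move=> /(_ _ cr)[M uM]; have /= := uM _ (leq_maxr N M); rewrite subr0 => h.
have cM := cu _ (leq_maxl N M).
have h0 : 0 <= u (maxn N M) by exact: le_trans (ltW c0) cM.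
have := cM; rewrite -(ger0_norm h0) normr_normc lecE /= => /andP[_].
by rewrite leNgt h.
Qed.

Lemma good_D0 i0 m pol s : (i0 + m <= r)%N -> D0 s -> good (crd i0) m pol s.
Proof.
move=> im hs i l ilm _; apply/eqP => E.
have := @ee_crd_Im _ _ s i0 i.+1 isT (leq_trans _ im) hs.
by rewrite leq_add2l -E Im_nat eqxx => /(_ ilm).
Qed.

Variable a : nat -> R.
Hypothesis a01 : forall i, 0 <= a i <= 1.

(** With all pairs declared polar, the vanishing condition on nonpolar coefficients is trivial; [D0]
    avoids all these hyperplanes anyway. *)
Let all_pol (_ _ : nat) := true.

Let all_npol m lam mu (s : nat -> C) i l : (i < m)%N -> ~~ all_pol i l ->
  cc B a lam mu s i l = 0.
Proof. by []. Qed.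

Let bid i : bern_identity B (a i.+1 - a i).
Proof. exact: bern_bid. Qed.

(* All the series involved at this point have positive terms. *)
Let p2 : V := const_mx 2.

Let Om_p2 i0 m : (i0 + m <= r)%N -> Om (crd i0) m 0 p2.
Proof.
move=> im i ilm; have -> : ee (crd i0 p2) i.+1 = - i.+1%:R.
  rewrite /ee (eq_big_nat _ _ (F2 := fun=> 2)) => [|j /andP[_ ji]]; last first.
    have jr : (i0 + j < r)%N by lia.
    by rewrite /crd (insubT (fun k => k < r)%N jr) mxE.
  by rewrite sumr_const_nat subn0 -mulr_natr; ring.
by case: i ilm => [|i] _; rewrite -(rmorph_nat (real_complex R)) /= oppr_lt0 ltr0n.
Qed.

Lemma Tval_p2_neq0 i0 m : (i0 + m <= r)%N -> Tval B a (crd i0) m 0 p2 != 0.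
Proof.
move=> im; have hO := Om_p2 im.
have gp : good (crd i0) m all_pol p2.
  move=> i l ilm _; apply/eqP => E; have := hO i ilm.
  by rewrite -E Re_nat ltr_nat ltn0.
rewrite (TvalE a01 bid (@affine_crd R r i0) (@all_npol m) 0 gp hO).
rewrite /TT /Gsum big_geq // add0r.
have cv := nested_sum_cvg a01 B (fun i im => hO i im) (leqnn m) 0.
have F0 i n : (i < m)%N -> 0 < (cpow (n.+1%:R + a i) (crd i0 p2 i))^-1.
  move=> ilm; have jr : (i0 + i < r)%N by lia.
  rewrite /crd (insubT (fun k => k < r)%N jr) mxE.
  have x0 : 0 < n.+1%:R + a i by case/andP: (a01 i) => h _; rewrite ltr_wpDr.
  by rewrite cpow_nat // invr_gt0 exprn_gt0 // ltcR.
have [c c0 hc] := nested_sum_pos (F := fun i n => (cpow (n%:R + a i) (crd i0 p2 i))^-1) 0 F0.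
exact: ctends_neq0 c0 hc cv.
Qed.

(** Otherwise the identity theorem, applied to the local regularisations, would carry the vanishing
    near s to [p2]. *)
Lemma Tval_nonvanish i0 m s (e : R) : (i0 + m <= r)%N -> 0 < e ->
  exists t, [/\ D0 t, vn (t - s) < e & Tval B a (crd i0) m 0 t != 0].
Proof.
move=> im e0; apply: contrapT => H.
have f0 t : vn (t - s) < e -> D0 t -> Tval B a (crd i0) m 0 t = 0.
  by move=> ts Dt; apply/eqP; apply: contrapT => /negP n; apply: H; exists t.
have hN := Om_p2 im; have aff := @affine_crd R r i0.
have loc p : exists (d M : R) (g h : V -> C), [/\ 0 < d, jet p d M g &
    forall t, vn (t - p) < d -> D0 t -> h t * Tval B a (crd i0) m 0 t = g t /\ h t != 0].
  have [N pN] := Om_exists (crd i0) m p.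
  have [d [M [d0 jg]]] := reg_holo a01 bid aff (@all_npol m) 0 pN.
  have [d' d0' hd'] := Tval_local a01 bid aff (@all_npol m) 0 pN.
  have m0 : 0 < Num.min d d' by rewrite lt_min d0.
  eexists (Num.min d d'), M, _, (regfactor (crd i0) m all_pol p N); split=> //.
    by apply: jet_shrink jg; rewrite m0 ge_min lexx.
  move=> t; rewrite lt_min => /andP[_ td] Dt; split; first exact/hd'/good_D0.
  exact/regfactor_neq0/good_D0.
have [d d0 hd] := identity_theorem (@D0_dense R r) loc e0 f0 p2.
have gp : good (crd i0) m all_pol p2.
  move=> i l ilm _; apply/eqP => E; have := hN i ilm.
  by rewrite -E Re_nat ltr_nat ltn0.
have [d' [M [d0' jg]]] := Tval_holo a01 bid aff (@all_npol m) 0 gp.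
have := Tval_p2_neq0 im; rewrite (zero_on_dense (@D0_dense R r) d0' jg _ d0 hd) ?eqxx //.
by rewrite subrr vn0.
Qed.

End NonVanishing.

(** * Generic points of a polar hyperplane *)

Section GenericPolarPoints.
Variables (R : realType) (r : nat).
Local Notation C := (Cplx R).
Local Notation V := 'rV[C]_r.
Variables (B : nat -> {poly R}) (a : nat -> R).
Hypothesis hB : bernoulli_polynomials B.
Hypothesis a01 : forall i, 0 <= a i < 1.
Implicit Types (p q s : V).
Local Notation S0 := (@crd R r 0).
Local Notation pole := (pol B a).

Lemma holo_neq0_near (f : V -> C) s : holo s f -> f s != 0 ->
  exists2 d : R, 0 < d & forall t, vn (t - s) < d -> f t != 0.
Proof.
move=> [d [M [d0 jf]]]; rewrite -normc_gt0 => fs.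
have s0 : vn (s - s) < d by rewrite subrr vn0.
have [e e0 he] := jet_cont d0 jf s0 fs; exists e => // t /he h.
by apply/eqP => ft; move: h; rewrite ft sub0r normcN ltxx.
Qed.

Section OnHyperplane.
Variables (s : V) (i l : nat) (ir : (i < r)%N).
Hypothesis hs : D0 s.

(** Projection along coordinate i alone: the coefficients of level i depend on the earlier variables
    and the residual zeta function on the later ones, so neither changes. *)
Definition to_hyper : V := s + (ee (S0 s) i.+1 - l%:R) *: delta_mx 0 (Ordinal ir).
Local Notation q := to_hyper.

Lemma crd_to_hyper j : j != i -> crd 0 q j = crd 0 s j.
Proof.
move=> ji; rewrite crdD crdZ /crd; case: insubP => [k _ kj|_]; last by rewrite mulr0 addr0.
by rewrite mxE eqxx -val_eqE /= kj add0n (negPf ji) mulr0 addr0.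
Qed.

Lemma ee_to_hyper j : ee (S0 q) j.+1 =
  if (i <= j)%N then ee (S0 s) j.+1 - (ee (S0 s) i.+1 - l%:R) else ee (S0 s) j.+1.
Proof.
rewrite ee_dir; have vj k : crd 0 (delta_mx 0 (Ordinal ir) : V) k = (k == i)%:R.
  rewrite /crd; case: insubP => [k' _ kj|].
    by rewrite mxE eqxx /= -val_eqE /= kj add0n.
  by rewrite add0n -leqNgt => rj; rewrite gtn_eqF // (leq_trans ir).
case: ifP => ij.
  rewrite big_mkord (bigD1 (Ordinal (ij : (i < j.+1)%N))) //= big1 => [|k].
    by rewrite vj eqxx addr0 mulr1.
  by rewrite -val_eqE /= vj => /negPf ->.
rewrite big_nat_cond big1 ?mulr0 ?subr0 // => k /andP[/andP[_ kj] _].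
by rewrite vj; case: eqP kj => // ->; rewrite ltnS ij.
Qed.

(** For j > i the value differs by an integer from a sum of coordinates after i, which is not real;
    this is why [D0] constrains sums over all intervals. *)
Lemma ee_to_hyper_ne j k : (j < r)%N -> j != i -> (k%:R == ee (S0 q) j.+1) = false.
Proof.
move=> jr ji; apply/eqP => E; suff : complex.Im (ee (S0 q) j.+1) != 0 by rewrite -E Im_nat eqxx.
rewrite ee_to_hyper; case: leqP => ij; last exact: ee_Im.
have -> : ee (S0 s) j.+1 = ee (S0 s) i.+1 + ee (crd i.+1 s) (j - i).
  have -> : j.+1 = (i.+1 + (j - i))%N by rewrite addSn subnKC.
  exact: ee_shift.
have -> : ee (S0 s) i.+1 + ee (crd i.+1 s) (j - i) - (ee (S0 s) i.+1 - l%:R) =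
  ee (crd i.+1 s) (j - i) + l%:R by ring.
rewrite ImD Im_nat addr0; apply: ee_crd_Im => //; last by lia.
by rewrite subn_gt0 ltn_neqAle eq_sym ji.
Qed.

Variable N : nat.
Hypotheses (lN : (l < N)%N) (pil : pole i l).

Lemma lamp_to_hyper t j : (j < r)%N ->
  lamp S0 pole q N t j = if j == i then l%:R - ee (S0 t) i.+1 else 1.
Proof.
move=> jr; rewrite /lamp; case: eqP => [->|/eqP ji].
  have -> : sing S0 pole q N i.
    by apply/hasP; exists l; rewrite ?mem_iota // pil ee_to_hyper leqnn subKr eqxx.
  by rewrite ee_to_hyper leqnn subKr.
case: ifP => // /hasP[k _ /andP[_]].
by rewrite ee_to_hyper_ne.
Qed.

Lemma mup_to_hyper j k : (j < r)%N -> j != i ->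
  mup S0 pole q N q j k = mu1 (S0 q) j k.
Proof.
by move=> jr ji; rewrite /mup ee_to_hyper_ne // lamp_to_hyper // (negPf ji) mul1r.
Qed.

Lemma regfactor_to_hyper t : regfactor S0 r pole q N t = l%:R - ee (S0 t) i.+1.
Proof.
rewrite /regfactor big_mkord (bigD1 (Ordinal ir)) //= big1 => [|k].
  by rewrite lamp_to_hyper // eqxx mulr1.
by rewrite -val_eqE /= lamp_to_hyper // => /negPf ->.
Qed.

Lemma TT_to_hyper_neq0 :
  cc B a (@lam1 R) (mu1 (S0 s)) (S0 s) i l != 0 ->
  TT B (fun j => a (i.+1 + j)%N) (N - l) (@lam1 R) (mu1 (crd i.+1 s)) (crd i.+1 s)
    (r - i.+1) 0 != 0 ->
  TT B a N (lamp S0 pole q N q) (mup S0 pole q N q) (S0 q) r 0 != 0.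
Proof.
have cE : cc B a (lamp S0 pole q N q) (mup S0 pole q N q) (S0 q) i l =
    cc B a (@lam1 R) (mu1 (S0 s)) (S0 s) i l.
  apply: cc_ext => j ji; have jr := ltn_trans ji ir; split.
  - by rewrite lamp_to_hyper // ltn_eqF.
  - by move=> k; rewrite mup_to_hyper ?ltn_eqF // /mu1 ee_to_hyper leqNgt ji.
  - by rewrite crd_to_hyper // ltn_eqF.
have shE : (fun j => crd 0 q (i.+1 + j)) = crd i.+1 s.
  by apply: funext => j; rewrite crd_to_hyper ?crd_shift //; lia.
move=> c0; rewrite -cE in c0 * => t0.
have el : ee (S0 q) i.+1 = l%:R by rewrite ee_to_hyper leqnn subKr.
rewrite (TT_residue el lN _ _ _ _ c0 ir).
- by rewrite shE mulf_neq0.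
- by rewrite lamp_to_hyper // eqxx el subrr.
- move=> k kN; rewrite /mup el eqr_nat; case: eqP => // _.
  by rewrite lamp_to_hyper // eqxx el subrr mul0r.
- by move=> j /andP[ij jr]; rewrite lamp_to_hyper // gtn_eqF.
- by move=> j k /andP[ij jr] _; rewrite mup_to_hyper // gtn_eqF.
Qed.

End OnHyperplane.

Let a01' i : 0 <= a i <= 1.
Proof. by case/andP: (a01 i) => -> /ltW ->. Qed.

Lemma generic_point p i l (e : R) : (i < r)%N -> pole i l -> l%:R = ee (S0 p) i.+1 -> 0 < e ->
  exists q N, [/\ vn (q - p) < e, l%:R = ee (S0 q) i.+1, Om S0 r N q,
    forall t, regfactor S0 r pole q N t = l%:R - ee (S0 t) i.+1 &
    TT B a N (lamp S0 pole q N q) (mup S0 pole q N q) (S0 q) r 0 != 0].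
Proof.
move=> ir pil lp e0; set v : V := delta_mx 0 (Ordinal ir).
have vv : 0 < vn v + 1 by rewrite ltr_pwDr // vn_ge0.
(* The projection moves s by the modulus of ee(s) - ee(p) times vn v; this keeps the move below
   e/2. *)
have w0 : 0 < e / 2 / (vn v + 1) by rewrite !divr_gt0.
have [d d0 hd] := affine_near p (affine_ee (@affine_crd R r 0) i.+1) w0.
have m0 : 0 < Num.min d (e / 2) by rewrite lt_min d0 divr_gt0.
pose a' j := a (i.+1 + j)%N; pose T' : V -> C := Tval B a' (crd i.+1) (r - i.+1) 0.
have im : (i.+1 + (r - i.+1) <= r)%N by rewrite subnKC.
have a'01 j : 0 <= a' j <= 1 by exact: a01'.
have bid j : bern_identity B (a' j.+1 - a' j) by exact: bern_bid.
have np lam mu (t : nat -> C) j k : (j < r - i.+1)%N -> ~~ (fun _ _ => true) j k -> cc B a' lam mu t j k = 0 by [].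
(* An open set where the shorter zeta function has no zero; [cc_nonvanish] finds in it a point where
   the coefficient is nonzero too. *)
pose O s := [/\ D0 s, vn (s - p) < Num.min d (e / 2) & T' s != 0].
have Oopen s : O s -> exists2 d' : R, 0 < d' & forall t, vn (t - s) < d' -> O t.
  move=> [Ds sd Ts]; have [d1 d10 h1] := D0_near Ds.
  have [d2 d20 h2] := (open_vn _).1 (@open_vball R r p (Num.min d (e / 2))) s sd.
  have gs := @good_D0 R r i.+1 (r - i.+1) (fun _ _ => true) s im Ds.
  have [d3 d30 h3] := holo_neq0_near
    (Tval_holo a'01 bid (@affine_crd R r i.+1) np 0 gs) Ts.
  exists (Num.min d1 (Num.min d2 d3)); first by rewrite !lt_min d10 d20.
  by move=> t; rewrite !lt_min => /and3P[/h1 ? /h2 ? /h3 ?].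
have [s [Ds sd Ts] cs] : exists2 s, O s & cc B a (@lam1 R) (mu1 (S0 s)) (S0 s) i l != 0.
  apply: (cc_nonvanish hB a01 ir pil) => [||s []] //.
  by have [s hs] := Tval_nonvanish hB a'01 p im m0; exists s.
have gs := @good_D0 R r i.+1 (r - i.+1) (fun _ _ => true) s im Ds.
set q := to_hyper s l ir.
have [N1 hN1] := Om_exists (crd i.+1) (r - i.+1) s.
have [N2 hN2] := Om_exists S0 r q.
(* Large enough for q, for the index l and, after subtraction of l, for the tail. *)
pose N := maxn (l + N1).+1 N2.
have lN : (l < N)%N by rewrite /N; lia.
exists q, N; split.
- have -> : q - p = (s - p) + (ee (S0 s) i.+1 - ee (S0 p) i.+1) *: v.
    by rewrite /q /to_hyper -lp addrAC.
  apply: le_lt_trans (vnD _ _) _; rewrite vnZ.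
  move: sd; rewrite lt_min => /andP[/hd]; rewrite ltr_pdivlMr // => h1 h2.
  have := normc_ge0 (ee (S0 s) i.+1 - ee (S0 p) i.+1); nra.
- by rewrite ee_to_hyper leqnn subKr.
- by apply: Om_le hN2; rewrite leq_maxr.
- by move=> t; exact: regfactor_to_hyper.
- apply: TT_to_hyper_neq0 => //.
  have hN : Om (crd i.+1) (r - i.+1) (N - l) s by apply: Om_le hN1; rewrite /N; lia.
  by rewrite -(TvalE a'01 bid (@affine_crd R r i.+1) np 0 gs hN).
Qed.

End GenericPolarPoints.

(** * The continuation and its poles *)

Section Continuation.
Variables (R : realType) (r : nat).
Local Notation C := (Cplx R).
Local Notation V := 'rV[C]_r.
Implicit Types (p q s : V).
Local Notation S0 := (@crd R r 0).

Lemma psumE (i : 'I_r) s : psum i s = i.+1%:R - ee (S0 s) i.+1.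
Proof.
rewrite /ee subKr big_mkord (big_ord_widen r (S0 s) (ltn_ord i)).
by apply: eq_bigr => j _; rewrite crdE.
Qed.

Lemma hyperE (i : 'I_r) k s : hyper i k s <-> k%:R = ee (S0 s) i.+1.
Proof.
rewrite /hyper /= psumE; split=> [h|->] //.
by apply: oppr_inj; exact: (addrI i.+1%:R (esym h)).
Qed.

Lemma hyper_formE (i : 'I_r) k s : hyper_form i k s = k%:R - ee (S0 s) i.+1.
Proof. by rewrite /hyper_form psumE; ring. Qed.

Lemma UdomE s : Udom s -> Om S0 r 0 s.
Proof.
move=> h i ir; have := h (Ordinal ir); rewrite psumE ReD Re_nat /=.
have -> : complex.Re (- ee (S0 s) i.+1) = - complex.Re (ee (S0 s) i.+1) by case: (ee _ _).
by rewrite ltrDl oppr_gt0.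
Qed.

Lemma holo_differentiable f p : holo p f -> differentiable (f : V -> C) p.
Proof.
by move=> [d [M [d0 jf]]]; apply: (jet_differentiable d0 jf); rewrite subrr vn0.
Qed.

Lemma differentiable_near (f : V -> C) p (e : R) : differentiable f p -> 0 < e ->
  exists2 d : R, 0 < d & forall t, vn (t - p) < d -> normc (f t - f p) < e.
Proof.
move=> /differentiable_continuous/(@cvgrPdist_lt _ _ _ (nbhs p)) h e0.
have {}e0 : (0 : C) < e%:C%C by rewrite ltcR.
have /nbhs_vn[d d0 hd] := h _ e0; exists d => // t /hd.
by rewrite normr_normc ltcR normcB.
Qed.

Variables (alpha : 'I_r -> R).

Definition shifts (j : nat) : R := if insub j is Some k then alpha k else 0.

Lemma shiftsE (i : 'I_r) : shifts i = alpha i.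
Proof. by rewrite /shifts valK. Qed.

Lemma zeta_partialE s K : zeta_partial alpha s K =
  nested_sum (fun i n => (cpow (n%:R + shifts i) (S0 s i))^-1) K r 0.
Proof.
rewrite -sum_decreasing; apply: eq_bigr => n _.
by apply: eq_bigr => i _; rewrite shiftsE crdE.
Qed.

Variable B : nat -> {poly R}.

Lemma polar_indexE (i : 'I_r) k : polar_index B alpha i k <-> pol B shifts i k.
Proof.
rewrite /polar_index; case: i => [[|[|i]] ir] /=.
- by split=> [[[_ ->]|[]]|/eqP ->] //; left.
- have r0 : (0 < r)%N by exact: ltnW.
  have -> : shifts 1 - shifts 0 = alpha (Ordinal ir) - alpha (Ordinal r0).
    by rewrite -!shiftsE.
  have -> : (bern B (alpha (Ordinal ir) - alpha (Ordinal r0)) k != 0) =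
      ((B k).[alpha (Ordinal ir) - alpha (Ordinal r0)] != 0).
    by rewrite /bern mulf_eq0 invr_eq0 pnatr_eq0 [(_`! == 0)%N]gtn_eqF ?fact_gt0 // orbF.
  split=> [[[]|[_ h]]|/eqP h] //; last first.
    right; split=> // -[_ [i1 [i2 [e1 e2 b0]]]]; apply: h; rewrite -b0.
    by congr (_ .[alpha _ - alpha _]); apply/val_inj; rewrite /= ?e1 ?e2.
  apply/eqP => b0; apply: h; split=> //.
  by exists (Ordinal r0), (Ordinal ir).
- by split=> // _; right; split=> // -[].
Qed.

Hypothesis alpha01 : forall i, 0 <= alpha i < 1.
Hypothesis hB : bernoulli_polynomials B.
Local Notation a := shifts.
Local Notation pole := (pol B shifts).
Local Notation aff := (@affine_crd R r 0).

Let a01s i : 0 <= a i < 1.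
Proof. by rewrite /a; case: insubP => [k _ _|_]; rewrite ?lexx ?ltr01. Qed.

Let a01 i : 0 <= a i <= 1.
Proof. by case/andP: (a01s i) => -> /ltW ->. Qed.

Let bid i : bern_identity B (a i.+1 - a i).
Proof. exact: bern_bid. Qed.

Let npole lam mu (s : nat -> C) i l : (i < r)%N -> ~~ pole i l -> cc B a lam mu s i l = 0.
Proof. by move=> _; exact: npol. Qed.

Definition regular_points : set V := [set s | good S0 r pole s].

Definition zeta_cont : V -> C := Tval B a S0 r 0.

Lemma D0_regular s : D0 s -> regular_points s.
Proof. exact: good_D0. Qed.

Lemma open_regular_points : open regular_points.
Proof. by apply/open_vn => p gp; exact: (good_near aff gp). Qed.

Lemma open_D0_meets (W : set V) : open W -> W !=set0 -> exists2 s, W s & D0 s.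
Proof.
move=> /open_vn oW [p /oW[d d0 hd]].
by have [s Ds sd] := D0_dense p d0; exists s => //; exact: hd.
Qed.

Lemma holo_zeta_cont : holomorphic_on regular_points zeta_cont.
Proof. by move=> s gs; apply: holo_differentiable; exact: (Tval_holo a01 bid aff npole 0 gs). Qed.

(** The value of the numerator at [p] is recorded because its nonvanishing will show that [p] is a
    pole. *)
Lemma zeta_cont_local p N : Om S0 r N p -> exists d g, [/\ 0 < d,
  holomorphic_on [set s | vn (s - p) < d] g,
  g p = TT B a N (lamp S0 pole p N p) (mup S0 pole p N p) (S0 p) r 0 &
  forall s, vn (s - p) < d -> regular_points s -> regfactor S0 r pole p N s * zeta_cont s = g s].
Proof.
move=> pN; have [d [M [d0 jg]]] := reg_holo a01 bid aff npole 0 pN.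
have [d' d0' hd'] := Tval_local a01 bid aff npole 0 pN.
eexists (Num.min d d'), _; split; first by rewrite lt_min d0.
- move=> s /=; rewrite lt_min => /andP[sd _].
  exact: jet_differentiable d0 jg sd.
- by [].
- by move=> s; rewrite lt_min => /andP[_ sd] gs; exact: hd'.
Qed.

Lemma meromorphic_zeta_cont : meromorphic regular_points zeta_cont.
Proof.
split; [exact: open_regular_points| |exact: holo_zeta_cont|].
  move=> W W0 oW; have [s Ws Ds] := open_D0_meets oW W0.
  by exists s; split=> //; exact: D0_regular.
move=> p; have [N pN] := Om_exists S0 r p.
have [d [g [d0 hg _ hd]]] := zeta_cont_local pN.
exists [set s | vn (s - p) < d], g, (regfactor S0 r pole p N); split=> //.
- by split; [exact: open_vball|rewrite /= subrr vn0].
- by move=> s _; apply: holo_differentiable; exact: (regfactor_holo aff).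
- move=> W oW WV W0; have [s Ws Ds] := open_D0_meets oW W0.
  by exists s => //; exact/regfactor_neq0/good_D0.
Qed.

Lemma Udom_regular s : Udom s -> regular_points s.
Proof.
move=> /UdomE h i l ir _; apply/eqP => E; have := h i ir.
by rewrite -E Re_nat ltr_nat ltn0.
Qed.

Lemma zeta_cont_Udom s : Udom s -> zeta_cont s = multizeta alpha s.
Proof.
move=> Us; have hO := UdomE Us; have gs := Udom_regular Us.
rewrite /zeta_cont (TvalE a01 bid aff npole 0 gs hO) /TT /Gsum big_geq // add0r.
have /ctends_cvg cv := nested_sum_cvg a01 B (fun i im => hO i im) (leqnn r) 0.
apply/esym/cvg_lim; first exact: norm_hausdorff.
by rewrite (funext (zeta_partialE s)).
Qed.

(** The numerator would be (l - ee) g with g bounded near q, hence tend to 0 along the dense set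
    [D0], whereas it is continuous and nonzero at q. *)
Lemma generic_singular q N l i g : (i < r)%N -> l%:R = ee (S0 q) i.+1 -> Om S0 r N q ->
  (forall t, regfactor S0 r pole q N t = l%:R - ee (S0 t) i.+1) ->
  TT B a N (lamp S0 pole q N q) (mup S0 pole q N q) (S0 q) r 0 != 0 ->
  differentiable g q -> forall d, 0 < d ->
  ~ (forall s, vn (s - q) < d -> regular_points s -> zeta_cont s = g s).
Proof.
move=> ir lq qN hreg; have [d1 [u [d10 hu <- hd1]]] := zeta_cont_local qN.
rewrite -normc_gt0 => u0 dg d d0 H.
have qq : vn (q - q) < d1 by rewrite subrr vn0.
have u02 : 0 < normc (u q) / 2 by rewrite divr_gt0.
have [d2 d20 h2] := differentiable_near (hu q qq) u02.
have [d3 d30 h3] := differentiable_near dg (@ltr01 R).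
pose K := normc (g q) + 1.
have K0 : 0 < K by rewrite ltr_wpDl ?normc_ge0.
have [d4 d40 h4] := affine_near q (affine_ee aff i.+1) (divr_gt0 u02 K0).
have m0 : 0 < Num.min d (Num.min d1 (Num.min d2 (Num.min d3 d4))).
  by rewrite !lt_min d0 d10 d20 d30.
have [t /D0_regular gt] := D0_dense q m0.
rewrite !lt_min => /and5P[/H td /hd1 td1 /h2 td2 /h3 td3 /h4 td4].
have := td1 gt; rewrite hreg td // lq => E.
have h5 : normc (g t) <= K.
  have -> : g t = (g t - g q) + g q by rewrite subrK.
  by apply: le_trans (le_normcD _ _) _; rewrite addrC lerD2l ltW.
have h6 : normc (u t) < normc (u q) / 2.
  rewrite -E normcM normcB; apply: le_lt_trans (ler_wpM2l (normc_ge0 _) h5) _.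
  by rewrite -ltr_pdivlMr.
have := le_normcD (u t) (u q - u t); rewrite subrKC normcB.
lra.
Qed.

Lemma hyper_near_generic (i : 'I_r) k p (W : set V) : polar_index B alpha i k ->
  hyper i k p -> open W -> W p -> exists q N, [/\ W q, hyper i k q, Om S0 r N q,
    forall t, regfactor S0 r pole q N t = hyper_form i k t &
    TT B a N (lamp S0 pole q N q) (mup S0 pole q N q) (S0 q) r 0 != 0].
Proof.
move=> /polar_indexE pik /hyperE hp /open_vn oW /oW[d d0 hd].
have [q [N [qd lq qN hreg u0]]] := generic_point hB a01s (ltn_ord i) pik hp d0.
exists q, N; split=> //; [exact: hd|exact/hyperE|].
by move=> t; rewrite hreg hyper_formE.
Qed.

(** Regularity is an open condition, so it suffices to refute it at generic points, which are dense
    in the hyperplane. *)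
Lemma hyper_polar (i : 'I_r) k : polar_index B alpha i k ->
  hyper i k `<=` polar_set regular_points zeta_cont.
Proof.
move=> pik p hp [W [g [oW Wp hg E]]].
have [q [N [Wq /hyperE lq qN hreg u0]]] := hyper_near_generic pik hp oW Wp.
have /open_vn/(_ q Wq)[d d0 hd] := oW.
have hreg' t : regfactor S0 r pole q N t = k%:R - ee (S0 t) i.+1.
  by rewrite hreg hyper_formE.
apply: (generic_singular (ltn_ord i) lq qN hreg' u0 (hg q Wq) d0) => s /hd Ws gs.
exact: E.
Qed.

Lemma polar_set_zeta_cont : polar_set regular_points zeta_cont =
  [set s | exists (i : 'I_r) (k : nat), polar_index B alpha i k /\ hyper i k s].
Proof.
apply/seteqP; split=> p; last by move=> [i [k [pik]]]; exact: hyper_polar.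
move=> np; apply: contrapT => H; apply: np.
exists regular_points, zeta_cont; split=> //.
- exact: open_regular_points.
- move=> i l ir pil; apply/eqP => E; apply: H; exists (Ordinal ir), l.
  by split; [exact/polar_indexE|exact/hyperE].
- exact: holo_zeta_cont.
Qed.

(** At a generic point the local denominator is the affine form itself, so one multiplication by it
    leaves the holomorphic numerator. *)
Lemma simple_pole_zeta_cont (i : 'I_r) k : polar_index B alpha i k ->
  simple_pole_along regular_points zeta_cont (hyper_form i k).
Proof.
move=> pik; have hE s : hyper_form i k s = 0 -> hyper i k s.
  by rewrite hyper_formE => /eqP; rewrite subr_eq0 => /eqP/hyperE.
split=> [s /hE|p /hE hp W oW Wp]; first exact: hyper_polar.
have [q [N [Wq hq qN hreg u0]]] := hyper_near_generic pik hp oW Wp.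
have [d [g [d0 hg _ hd]]] := zeta_cont_local qN.
exists q; split=> //.
  by move/hyperE: hq; rewrite /= hyper_formE => ->; rewrite subrr.
exists [set s | vn (s - q) < d], g; split=> //.
- exact: open_vball.
- by rewrite /= subrr vn0.
- by move=> s /= sd gs; rewrite -hreg; exact: hd.
Qed.

End Continuation.

Theorem theorem3 (R : realType) (r : nat) (r_gt0 : (0 < r)%N)
    (alpha : 'I_r -> R) (alpha01 : forall i : 'I_r, 0 <= alpha i < 1)
    (B : nat -> {poly R}) (B_bernoulli : bernoulli_polynomials B) :
  exists (D : set 'rV[Cplx R]_r) (f : 'rV[Cplx R]_r -> Cplx R),
    [/\ meromorphic_continuation Udom (multizeta alpha) D f,
        polar_set D f =
          [set s | exists (i : 'I_r) (k : nat),
                     polar_index B alpha i k /\ hyper i k s]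
      & forall (i : 'I_r) (k : nat), polar_index B alpha i k ->
          simple_pole_along D f (hyper_form i k)].
Proof.
exists (regular_points alpha B), (zeta_cont alpha B); split.
- split; [exact: meromorphic_zeta_cont|exact: Udom_regular|exact: zeta_cont_Udom].
- exact: polar_set_zeta_cont.
- exact: simple_pole_zeta_cont.
Qed.
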